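(* In the setting of the context (residue characteristic $p$), let $\mathcal{B}=\mathfrak{r}_0\sqcup\dots\sqcup\mathfrak{r}_h$ be the partition such that the connected components of $\Sigma^*_{\mathcal{B}}$ are $\Sigma_{\mathfrak{r}_0},\dots,\Sigma_{\mathfrak{r}_h}$, with $\infty\in\mathfrak{r}_0$. Fix $i\in\{0,\dots,h\}$, write $\mathfrak{r}_i'=\mathfrak{r}_i\smallsetminus\{\infty\}$, and let $\mathfrak{s}_i$ be the smallest cluster containing $\mathfrak{r}_i$ if $i\ne0$. (a) For $\eta\in\mathbb{H}$, we have $\mathfrak{t}_{\mathfrak{r}_i'}(\eta)=0$ if and only if $\eta\in\Sigma_{\mathfrak{r}_i}$. (b) If $i\neq0$ (so that $\infty\notin\mathfrak{r}_i=\mathfrak{r}_i'$), then for $\alpha\in\mathfrak{r}_i$ the function $b\mapsto\mathfrak{t}_{\mathfrak{r}_i'}(\eta_{D_{\alpha,b}})$, when not taking the value $\frac{p\,v(p)}{p-1}$, has decreasing negative integer slopes on $(-\infty,d(\mathfrak{s}_i))$ (it is piecewise linear there). (c) For $\alpha\in\bar K\smallsetminus\mathfrak{r}_i$, the function $b\mapsto\mathfrak{t}_{\mathfrak{r}_i'}(\eta_{D_{\alpha,b}})$ has decreasing positive integer slopes on $(c,\infty)$ until it attains the value $\frac{p\,v(p)}{p-1}$, where $c\in\mathbb{R}$ is such that $D_{\alpha,b}\cap\mathfrak{r}_i=\varnothing$ for all $b>c$. (d) Assume that $\underline{\mathcal{B}}$ is clustered in pairs. Then for all $\eta\in\mathbb{H}$,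 $$\mathfrak{t}_{\mathfrak{r}_i'}(\eta)=\min\big\{\delta(\eta,\Sigma_{\mathfrak{r}_i}),\tfrac{p\,v(p)}{p-1}\big\}.$$
   Context: $K$ is a field complete with respect to a discrete valuation $v:K^\times\to\mathbb{Q}$, with algebraically closed residue field $k$ of characteristic $p$, where $p$ is a prime different from the characteristic of $K$; $v$ is extended to $\bar K$ and its completion $\mathbb{C}_K$. $f\in K[x]$ is monic with each root of multiplicity between $1$ and $p-1$, and $p\nmid\deg f$; the curve $y^p=f(x)$ has positive genus. $\mathcal{B}$ consists of the roots of $f$ in $\bar K$ together with $\infty$. $\underline{\mathcal{B}}$ is the multiset on $\mathcal{B}$ in which each root of $f$ has its multiplicity as a root and $\infty$ has multiplicity $p\lceil\deg(f)/p\rceil-\deg(f)$; for $A\subseteq\mathcal{B}$, $\underline{A}$ is $A$ with these multiplicities and $\#\underline{A}$ their sum. A cluster is a non-empty subset $\mathfrak{s}=\mathcal{B}\cap D$, $D$ a disc; its depth is $d(\mathfrak{s})=\min_{z,z'\in\mathfrak{s}}v(z-z')$. Berkovich line: ignoring Type IV points, $\mathbb{P}_{\mathbb{C}_K}^{1,\mathrm{an}}$ consists of Type I points $\eta_z$ ($z\in\mathbb{C}_K\cup\{\infty\}$) and points $\eta_D$ for discs $D=D_{\alpha,b}=\{z\in\mathbb{C}_K: v(z-\alpha)\ge b\}$, $b\in\mathbb{R}$ (Type II if $b\in\mathbb{Q}$, else Type III), $d(D)=b$; $\mathbb{H}$ is the set of Type II and III points. $\eta>\eta'$ means strict containment of the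 corresponding subsets ($\eta_\infty$ is largest); $\eta\vee\eta'$ is the join. $\delta(\eta_D,\eta_{D'})=d(D')-d(D)$ for $D\supseteq D'$, and $\delta(\eta,\eta')=\delta(\eta,\eta\vee\eta')+\delta(\eta',\eta\vee\eta')$ in general; $\mathbb{H}$ has the metric topology, extended so that $\eta_{D_{w,i}}\to\eta_w$ as $i\to\infty$ and $\to\eta_\infty$ as $i\to-\infty$. Any two points are joined by a unique non-backtracking path. For connected $\Lambda\subset\mathbb{H}$, $\delta(\eta,\Lambda)$ is the distance from $\eta$ to its closest point of $\Lambda$. For $A\subset\bar K\cup\{\infty\}$, $\Sigma_A$ is the intersection of $\mathbb{H}$ with the convex hull of $\{\eta_z\}_{z\in A}$ (for $\#A\ge2$, the union of the open paths between pairs of points $\eta_z,\eta_w$, $z\ne w\in A$). For $\eta\in\Sigma_{\mathcal{B}}$, let $U_1,\dots,U_s,U_\infty$ be the connected components of $\Sigma_{\mathcal{B}}\smallsetminus\{\eta\}$, with $\eta_\infty$ a limit point of $U_\infty$, and $\mathfrak{c}_i=\{z\in\mathcal{B}:\eta_z\text{ is a limit point of }U_i\}$, $1\le i\le s$. $\Sigma^*_{\mathcal{B}}$ is the set of $\eta\in\Sigma_{\mathcal{B}}$ with $p\nmid\#\underline{\mathfrak{c}}_i$ for some $i\in\{1,\dots,s\}$. It is known that the connected components of $\Sigma^*_{\mathcal{B}}$ are of the form $\Sigma_{\mathfrak{r}_0},\dots,\Sigma_{\mathfrak{r}_h}$ for a partition $\mathcal{B}=\mathfrak{r}_0\sqcup\dots\sqcup\mathfrak{r}_h$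 with $p\mid\#\underline{\mathfrak{r}}_i$. $\underline{\mathcal{B}}$ is clustered in pairs if $\Sigma^*_{\mathcal{B}}$ has exactly $\#\underline{\mathcal{B}}/p$ connected components and each is a single open path (equivalently, $\#\underline{\mathfrak{r}}_i=p$ and $\#\mathfrak{r}_i=2$ for all $i$). The functions $\mathfrak{t}$: $v$ is extended to polynomials by the Gauss valuation (minimum of the valuations of the coefficients). A part-$p$th-power decomposition of $0\ne g\in\bar K[x]$ is $g=q^p+\rho$ with $q,\rho\in\bar K[x]$, $\deg q\le\lfloor\deg(g)/p\rfloor$ ($q=0$ allowed); $t_{q,\rho}=v(\rho)-v(g)\in\mathbb{Q}\cup\{+\infty\}$. It is good if $t_{q,\rho}\ge\frac{p\,v(p)}{p-1}$, or if $t_{q,\rho}<\frac{p\,v(p)}{p-1}$ and no decomposition of $g$ has larger $t$. For $0\neq h\in\bar K[x]$ and a Type II point $\eta=\eta_{D_{\alpha,v(\beta)}}$ ($\alpha\in\bar K,\beta\in\bar K^\times$), set $h_{\alpha,\beta}(x)=h(\beta x+\alpha)$ and $\mathfrak{t}_h(\eta)=\min\{t_{q,\rho},\frac{p\,v(p)}{p-1}\}$ for any good decomposition $h_{\alpha,\beta}=q^p+\rho$; this is well defined and extends continuously to $\mathbb{H}$. For a subset $\mathfrak{r}\subseteq\mathcal{B}\smallsetminus\{\infty\}$, $f_{\mathfrak{r}}$ is the monic polynomial of degree $\#\underline{\mathfrak{r}}$ with multiset of roots $\underline{\mathfrak{r}}$, and $\mathfrak{t}_{\mathfrak{r}}:=\mathfrak{t}_{f_{\mathfrak{r}}}$.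 *)

(* Defs.v *)
From HB Require Import structures.
From mathcomp Require Import all_boot all_order all_algebra.
From mathcomp Require Import all_classical all_reals all_analysis.

Set Implicit Arguments.
Unset Strict Implicit.
Unset Printing Implicit Defensive.

Import Order.TTheory GRing.Theory Num.Theory.

Local Open Scope classical_set_scope.
Local Open Scope ring_scope.

Record is_valuation (G : realDomainType) (F : fieldType) (v : F -> \bar G) :
    Prop := {
  val_neqNy : forall x, v x != -oo%E ;
  val_eqy : forall x, v x = +oo%E <-> x = 0 ;
  valM : forall x y, v (x * y) = (v x + v y)%E ;
  valD : forall x y, (Order.min (v x) (v y) <= v (x + y)%R)%E }.

Definition discrete_valuation (F : fieldType) (v : F -> \bar rat) : Prop :=
  is_valuation v /\
  exists2 e : rat, 0 < e &
    (exists x, v x = e%:E) /\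
    (forall x, x != 0 -> exists n : int, v x = (e *~ n)%:E).

Definition val_complete (F : fieldType) (v : F -> \bar rat) : Prop :=
  forall u : nat -> F,
    (forall M : rat, exists N : nat, forall m n : nat,
      (N <= m)%N -> (N <= n)%N -> (M%:E <= v (u m - u n)%R)%E) ->
    exists l : F, forall M : rat, exists N : nat, forall n : nat,
      (N <= n)%N -> (M%:E <= v (u n - l)%R)%E.

(* [red] is only meaningful on the valuation ring {v >= 0}: it is a surjective
   ring morphism from there onto [k], with kernel the maximal ideal {v > 0}. *)
Record is_residue_map (F k : fieldType) (v : F -> \bar rat) (red : F -> k) :
    Prop := {
  red1 : red 1 = 1 ;
  redD : forall x y, (0 <= v x)%E -> (0 <= v y)%E ->
    red (x + y) = red x + red y ;
  redM : forall x y, (0 <= v x)%E -> (0 <= v y)%E ->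
    red (x * y) = red x * red y ;
  red_eq0 : forall x, (0 <= v x)%E -> (red x = 0 <-> (0 < v x)%E) ;
  red_surj : forall c : k, exists2 x, (0 <= v x)%E & red x = c }.

Definition is_algebraic_closure (K : fieldType) (L : closedFieldType)
    (iota : {rmorphism K -> L}) : Prop :=
  forall x : L, algebraicOver iota x.

Definition is_completion (L C : fieldType) (psi : {rmorphism L -> C})
    (vL : L -> \bar rat) (vC : C -> \bar rat) : Prop :=
  [/\ is_valuation vC,
      (forall x, vC (psi x) = vL x),
      val_complete vC &
      (forall (z : C) (M : rat), exists x : L, (M%:E <= vC (z - psi x)%R)%E)].

Section Genus.

Variables (k : closedFieldType) (F : fieldType) (j : {rmorphism k -> F}).

Definition place (w : F -> \bar int) : Prop :=
  [/\ is_valuation w, (forall c, c != 0 -> w (j c) = 0%E) &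
      exists u, w u = 1%E].

(* A divisor is given by a finite family of distinct places [ws] with
   coefficients [ms]; this is its Riemann-Roch space L(D). *)
Definition rr_space (n : nat) (ws : 'I_n -> F -> \bar int) (ms : 'I_n -> int)
    : set F :=
  [set u | (forall i, ((- ms i)%R%:E <= ws i u)%E) /\
           (forall w, place w -> (forall i, w <> ws i) -> (0 <= w u)%E)].

Definition lin_indep (m : nat) (e : 'I_m -> F) : Prop :=
  forall c : 'I_m -> k, \sum_i j (c i) * e i = 0 -> forall i, c i = 0.

(* There is a divisor D with g <= deg D + 1 - dim L(D). *)
Definition genus_ge (g : nat) : Prop :=
  exists n (ws : 'I_n -> F -> \bar int) (ms : 'I_n -> int),
    [/\ injective ws, (forall i, place (ws i)) &
        forall m (e : 'I_m -> F),
          (forall i, rr_space ws ms (e i)) -> lin_indep e ->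
          (g + m)%:Z <= \sum_i ms i + 1].

(* The genus is the maximum of deg D + 1 - dim L(D) over all divisors D. *)
Definition is_genus (g : nat) : Prop :=
  genus_ge g /\ forall g', genus_ge g' -> (g' <= g)%N.

Definition eval_xy (X Y : F) (P : {poly {poly k}}) : F :=
  (map_poly (fun c : {poly k} => (map_poly j c).[X]) P).[Y].

(* F = k(X, Y) with X transcendental over k and Y^p = f(X). *)
Definition superelliptic_function_field (p : nat) (f : {poly k}) (X Y : F)
    : Prop :=
  [/\ ~ algebraicOver j X,
      Y ^+ p = (map_poly j f).[X] &
      forall u, exists P Q : {poly {poly k}},
        eval_xy X Y Q != 0 /\ u = eval_xy X Y P / eval_xy X Y Q].

End Genus.

Definition superelliptic_positive_genus (k : closedFieldType) (p : nat)
    (f : {poly k}) : Prop :=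
  exists (F : fieldType) (j : {rmorphism k -> F}) (X Y : F),
    superelliptic_function_field j p f X Y /\
    exists2 g : nat, is_genus j g & (0 < g)%N.

Section Berkovich.

Variables (R : realType) (C : fieldType) (vC : C -> \bar rat).

Definition closed_disc (a : C) (b : R) : set C :=
  [set z | (b%:E <= er_map (ratr : rat -> R) (vC (z - a)%R))%E].

(* The points of H; the depth is part of the data, but when the value group is
   dense it is determined by the underlying set. *)
Record disc := Disc {
  disc_set : set C ;
  depth : R ;
  disc_ex : exists a, disc_set = closed_disc a depth }.

Definition mkdisc (a : C) (b : R) : disc :=
  @Disc (closed_disc a b) b (ex_intro _ a erefl).

HB.instance Definition _ := gen_eqMixin disc.
HB.instance Definition _ := gen_choiceMixin disc.

(* The Berkovich projective line without its points of Type IV.  Infinity is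
   [None] in [option C]. *)
Inductive berk := TypeI of option C | TypeH of disc.

HB.instance Definition _ := gen_eqMixin berk.
HB.instance Definition _ := gen_choiceMixin berk.

Definition region (x : berk) : set (option C) :=
  match x with
  | TypeI (Some z) => [set Some z]
  | TypeI None => setT
  | TypeH D => Some @` disc_set D
  end.

Definition leB (x y : berk) : Prop := region x `<=` region y.

Definition is_join (x y z : berk) : Prop :=
  [/\ leB x z, leB y z & forall w, leB x w -> leB y w -> leB z w].

Definition disc_join (D E : disc) : disc :=
  xget D [set J | is_join (TypeH D) (TypeH E) (TypeH J)].

Definition delta (D E : disc) : R :=
  (depth D - depth (disc_join D E)) + (depth E - depth (disc_join D E)).

(* The finest topology which is the metric topology on H and for which
   D_{w,i} tends to w as i -> +oo and to infinity as i -> -oo. *)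
Definition berk_open (O : set berk) : Prop :=
  [/\ (forall D, O (TypeH D) ->
         exists2 e : R, 0 < e & forall E, delta D E < e -> O (TypeH E)),
      (forall w : C, O (TypeI (Some w)) ->
         exists N : R, forall b, N <= b -> O (TypeH (mkdisc w b))) &
      (O (TypeI None) -> forall w : C,
         exists N : R, forall b, b <= N -> O (TypeH (mkdisc w b)))].

Lemma berk_openT : berk_open setT.
Proof. by split=> [D _|w _|_ w]; [exists 1|exists 0|exists 0]. Qed.

Lemma berk_openI (A B : set berk) :
  berk_open A -> berk_open B -> berk_open (A `&` B).
Proof.
move=> [A1 A2 A3] [B1 B2 B3]; split.
- move=> D [/A1 [e e0 He] /B1 [e' e'0 He']].
  exists (Num.min e e'); first by rewrite lt_min e0.
  by move=> E; rewrite lt_min => /andP[/He ? /He' ?].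
- move=> w [/A2 [N HN] /B2 [N' HN']]; exists (Num.max N N') => b.
  by rewrite ge_max => /andP[/HN ? /HN' ?].
- move=> [/A3 HA /B3 HB] w; have [N HN] := HA w; have [N' HN'] := HB w.
  exists (Num.min N N') => b.
  by rewrite le_min => /andP[/HN ? /HN' ?].
Qed.

Lemma berk_open_bigU (I : Type) (A : I -> set berk) :
  (forall i, berk_open (A i)) -> berk_open (\bigcup_i A i).
Proof.
move=> HA; split.
- move=> D [i _ Ai]; have [H _ _] := HA i; have [e e0 He] := H _ Ai.
  by exists e => // E /He ?; exists i.
- move=> w [i _ Ai]; have [_ H _] := HA i; have [N HN] := H _ Ai.
  by exists N => b /HN ?; exists i.
- move=> [i _ Ai] w; have [_ _ H] := HA i; have [N HN] := H Ai w.
  by exists N => b /HN ?; exists i.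
Qed.

HB.instance Definition _ :=
  isOpenTopological.Build berk berk_openT berk_openI berk_open_bigU.

(* The non-backtracking path from x to y climbs from x to the join of x and y
   and then descends to y. *)
Definition path_between (x y : berk) : set berk :=
  [set z | exists2 J, is_join x y J & leB z J /\ (leB x z \/ leB y z)].

Definition open_path (x y : berk) : set berk :=
  path_between x y `\` [set x; y].

Definition dist_to (D : disc) (Lambda : set berk) : R :=
  inf [set delta D E | E in [set E | Lambda (TypeH E)]].

End Berkovich.

Arguments TypeI {R C vC} _.

Definition is_component (T : topologicalType) (S U : set T) : Prop :=
  exists2 x, S x & U = connected_component S x.

Section Tree.

Variables (R : realType) (p : nat) (L : closedFieldType) (C : fieldType).
Variables (psi : {rmorphism L -> C}) (vC : C -> \bar rat) (f : {poly L}).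

Notation berk := (berk R vC).

Definition branch_set : set (option L) :=
  [set z | if z is Some a then root f a else True].

Definition multiplicity (z : option L) : nat :=
  if z is Some a then mup a f
  else (p * (((size f).-1 + p.-1) %/ p) - (size f).-1)%N.

Definition mcard (A : set (option L)) : nat :=
  \big[addn/0%N]_(z \in A) multiplicity z.

Definition eta (z : option L) : berk := TypeI (omap psi z).

Definition Sigma (A : set (option L)) : set berk :=
  [set x | exists z w, [/\ A z, A w, z <> w & open_path (eta z) (eta w) x]].

Definition limits_in_branch_set (U : set berk) : set (option L) :=
  [set z | branch_set z /\ limit_point U (eta z)].

Definition Sigma_star : set berk :=
  [set x | Sigma branch_set x /\
     exists U, [/\ is_component (Sigma branch_set `\ x) U,
                   ~ limit_point U (eta None) &
                   ~~ (p %| mcard (limits_in_branch_set U))%N]].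

Definition component_partition (h : nat) (r : 'I_h.+1 -> set (option L))
    : Prop :=
  [/\ \bigcup_i r i = branch_set,
      trivIset setT r,
      (forall U, is_component Sigma_star U <-> exists i, U = Sigma (r i)) &
      (forall i, (p %| mcard (r i))%N)].

Definition clustered_in_pairs : Prop :=
  ([set U | is_component Sigma_star U] #= `I_(mcard branch_set %/ p))%card /\
  forall U, is_component Sigma_star U ->
    exists x y : berk, x <> y /\ U = open_path x y.

Definition is_cluster (s : set (option L)) : Prop :=
  s !=set0 /\
  exists D : disc R vC,
    s = branch_set `&` [set z | exists2 a, z = Some a & disc_set D (psi a)].

Definition smallest_cluster (A s : set (option L)) : Prop :=
  [/\ is_cluster s, A `<=` s & forall s', is_cluster s' -> A `<=` s' -> s `<=` s'].

(* Infinite exactly when the cluster is a singleton. *)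
Definition cluster_depth (s : set (option L)) : \bar R :=
  ereal_inf [set d | exists a a', [/\ s (Some a), s (Some a') &
    d = er_map (ratr : rat -> R) (vC (psi (a - a')))]].

Definition finite_part (A : set (option L)) : set L := [set a | A (Some a)].

Definition f_ (A : set L) : {poly L} :=
  \big[*%R/1]_(a \in A) ('X - a%:P) ^+ mup a f.

End Tree.

Section PthPower.

Variables (p : nat) (L : closedFieldType) (vL : L -> \bar rat).

Definition gauss (g : {poly L}) : \bar rat :=
  \big[Order.min/+oo%E]_(i < size g) vL g`_i.

Definition tmax : rat := p%:R * fine (vL p%:R) / (p.-1)%:R.

Definition decomposition (g q rho : {poly L}) : Prop :=
  g = q ^+ p + rho /\ (size q <= ((size g).-1 %/ p).+1)%N.

Definition t_dec (g rho : {poly L}) : \bar rat := (gauss rho - gauss g)%E.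

Definition good_decomposition (g q rho : {poly L}) : Prop :=
  decomposition g q rho /\
  ((tmax%:E <= t_dec g rho)%E \/
   (t_dec g rho < tmax%:E)%E /\
   forall q' rho', decomposition g q' rho' ->
     (t_dec g rho' <= t_dec g rho)%E).

Definition affine_subst (h : {poly L}) (a b : L) : {poly L} :=
  h \Po (b *: 'X + a%:P).

Variables (R : realType) (C : fieldType).
Variables (psi : {rmorphism L -> C}) (vC : C -> \bar rat).

Definition is_tfun (h : {poly L}) (t : disc R vC -> R) : Prop :=
  (forall a b q rho, b != 0 ->
     good_decomposition (affine_subst h a b) q rho ->
     (t (mkdisc vC (psi a) (ratr (fine (vL b)))))%:E =
       er_map (ratr : rat -> R)
         (Order.min (t_dec (affine_subst h a b) rho) tmax%:E)) /\
  (forall D (e : R), 0 < e -> exists2 d : R, 0 < d &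
     forall E, delta D E < d -> `|t E - t D| < e).

(* The unique continuous function on H with the prescribed values at the
   points of Type II. *)
Definition tfun (h : {poly L}) : disc R vC -> R :=
  xget (fun=> 0) [set t | is_tfun h t].

End PthPower.

(* On the interval S, F is piecewise linear with finitely many pieces, whose
   slopes m 0 > m 1 > ... > m n are integers satisfying P; the j-th piece is the
   part of S between the breakpoints c j and c j.+1. *)
Definition pl_decreasing_int_slopes (R : realType) (P : int -> Prop)
    (S : set R) (F : R -> R) : Prop :=
  exists (n : nat) (c : nat -> \bar R) (m : nat -> int),
    [/\ c 0%N = -oo%E /\ c n.+1 = +oo%E,
        (forall j, (j <= n)%N -> (c j < c j.+1)%E),
        (forall j, (j < n)%N -> m j.+1 < m j),
        (forall j, (j <= n)%N -> P (m j)) &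
        forall j x y, (j <= n)%N -> S x -> S y ->
          (c j <= x%:E <= c j.+1)%E -> (c j <= y%:E <= c j.+1)%E ->
          F y - F x = (m j)%:~R * (y - x)].

(* Main.v *)
Require Import Defs.
From mathcomp Require Import all_boot all_order all_algebra.
From mathcomp Require Import all_classical all_reals all_analysis.
From mathcomp Require Import zify ring lra.

(* The function t of a polynomial h is computed by the supremum of the levels
   v(h - q^p) - v(h) over all admissible q, truncated at p v(p) / (p - 1); this
   is Lipschitz in the disc.  A level below the truncation is the best one as
   soon as the error term h - q^p has a dominant monomial whose exponent is not
   divisible by p.  Removing p-th roots of the remaining monomials repeatedly
   brings the terms of exponent divisible by p arbitrarily close to the
   truncation level; where h is dominated by its constant or leading term these
   two extreme exponents are eliminated exactly, so that moving the radius away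
   from the critical one pushes the other terms above the truncation level.
   There t is a truncated minimum of lines, whose slopes come from exponents not
   divisible by p: this gives (b) and (c), and good decompositions on a dense
   set of discs.
   For (a), t vanishes at a disc D exactly when some residue class of D contains
   a number of roots not divisible by p.  For (d), a single open path has two
   ends, and t is read off from explicit decompositions with deg q <= 1. *)

Set Implicit Arguments.
Unset Strict Implicit.
Unset Printing Implicit Defensive.

Import Order.TTheory GRing.Theory Num.Theory.
Import numFieldNormedType.Exports.
Local Open Scope classical_set_scope.
Local Open Scope ring_scope.

(** * Valuations *)

(** The truncation T = p v(p) / (p - 1) is a balance point. When q is replaced by q + W, the cross
    terms of (q + W)^p are divisible by p and are strictly dominated by W^p as long as v(W) < v(q) +
    v(p) / (p - 1). Below that threshold the change is seen mainly through W^p, hence in exponents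
    divisible by p, and cannot cancel a dominant monomial of another exponent. The obstacle is that
    T is only approached: N extractions of p-th roots leave a gap T / p^N, and L need not be
    complete, so no limit is taken. The gap is absorbed only at some distance from the critical
    radius, so q has to change as the radius approaches it. Finitely many linear pieces remain
    nevertheless, because the slopes are differences of exponents bounded by the degree. Gauss
    valuations are taken at real radii throughout, which treats Type II and Type III points
    alike. *)

Section Valuation.

Variables (R : realType) (L : fieldType) (w : L -> \bar R).
Hypothesis w_val : is_valuation w.

Definition vge (c : R) (x : L) : bool := (c%:E <= w x)%E.
Definition vis (c : R) (x : L) : Prop := w x = c%:E.

Lemma val0 : w 0 = +oo%E.
Proof. exact/(val_eqy w_val). Qed.

Lemma vis_exists x : x != 0 -> exists c, vis c x.
Proof.
move=> x0; have := val_neqNy w_val x; have := val_eqy w_val x.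
rewrite /vis; case: (w x) => [r _ _|[H _] _|//]; first by exists r.
by move: x0; rewrite H ?eqxx.
Qed.

Lemma vis_neq0 c x : vis c x -> x != 0.
Proof. by rewrite /vis => H; apply/eqP => x0; move: H; rewrite x0 val0. Qed.

Lemma vis_vge c x : vis c x -> vge c x.
Proof. by rewrite /vge => ->. Qed.

Lemma vis_vgeE c d x : vis c x -> vge d x = (d <= c).
Proof. by rewrite /vge => ->; rewrite lee_fin. Qed.

Lemma vis_inj c d x : vis c x -> vis d x -> c = d.
Proof. by rewrite /vis => -> [->]. Qed.

Lemma vis1 : vis 0 1.
Proof.
have [c cE] := vis_exists (oner_neq0 L).
have := Defs.valM w_val 1 1; rewrite mulr1 cE -EFinD => -[] H.
by rewrite /vis cE; congr _%:E; lra.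
Qed.

Lemma visM c d x y : vis c x -> vis d y -> vis (c + d) (x * y).
Proof. by rewrite /vis (Defs.valM w_val) => -> ->. Qed.

Lemma visX c x n : vis c x -> vis (n%:R * c) (x ^+ n).
Proof.
move=> cx; elim: n => [|n IH]; first by rewrite expr0 mul0r; exact: vis1.
by rewrite exprS -add1n natrD mulrDl mul1r; exact: visM.
Qed.

Lemma visV c x : vis c x -> vis (- c) x^-1.
Proof.
move=> cx; have x0 := vis_neq0 cx.
have [d dx] : exists d, vis d x^-1 by apply: vis_exists; rewrite invr_eq0.
have := visM cx dx; rewrite divff // => /vis_inj /(_ vis1) H.
by rewrite /vis dx; congr _%:E; lra.
Qed.

Lemma visN1 : vis 0 (-1).
Proof.
have [c cE] : exists c, vis c (-1) by apply: vis_exists; rewrite oppr_eq0 oner_eq0.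
have := visM cE cE; rewrite mulrNN mulr1 => /vis_inj /(_ vis1) H.
by rewrite /vis cE; congr _%:E; lra.
Qed.

Lemma valN x : w (- x) = w x.
Proof. by rewrite -mulN1r (Defs.valM w_val) visN1 add0e. Qed.

Lemma visN c x : vis c x -> vis c (- x).
Proof. by rewrite /vis valN. Qed.

Lemma vgeN c x : vge c (- x) = vge c x.
Proof. by rewrite /vge valN. Qed.

Lemma vge0 c : vge c 0.
Proof. by rewrite /vge val0 leey. Qed.

Lemma vgeD c x y : vge c x -> vge c y -> vge c (x + y).
Proof.
move=> cx cy; apply: le_trans (Defs.valD w_val x y).
by rewrite le_min -!/(vge _ _) cx cy.
Qed.

Lemma vgeB c x y : vge c x -> vge c y -> vge c (x - y).
Proof. by move=> cx cy; apply: vgeD => //; rewrite vgeN. Qed.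

Lemma vge_sub c x y : vge c (x - y) = vge c (y - x).
Proof. by rewrite -opprB vgeN. Qed.

Lemma vgeM c d x y : vge c x -> vge d y -> vge (c + d) (x * y).
Proof. by rewrite /vge (Defs.valM w_val) EFinD; exact: leeD. Qed.

Lemma vge_le c d x : d <= c -> vge c x -> vge d x.
Proof. by move=> dc; apply: le_trans; rewrite lee_fin. Qed.

Lemma vge1 : vge 0 1.
Proof. exact: vis_vge vis1. Qed.

Lemma vge_nat n : vge 0 n%:R.
Proof.
by elim: n => [|n IH]; rewrite ?vge0 // -add1n natrD vgeD // vge1.
Qed.

Lemma vge_sum (I : Type) (s : seq I) (P : pred I) (F : I -> L) c :
  (forall i, P i -> vge c (F i)) -> vge c (\sum_(i <- s | P i) F i).
Proof.
by move=> H; elim/big_ind: _ => // [|x y]; [exact: vge0|exact: vgeD].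
Qed.

Lemma vis_dom c d x y : vis c x -> vge d y -> c < d -> vis c (x + y).
Proof.
move=> cx dy cd.
have xy : x + y != 0.
  apply/eqP => /eqP; rewrite addr_eq0 => /eqP xE.
  by move: dy; rewrite -vgeN -xE (vis_vgeE _ cx) leNgt cd.
have [e exy] := vis_exists xy; suff -> : c = e by [].
apply/eqP; rewrite eq_le; apply/andP; split.
  rewrite -(vis_vgeE _ exy); apply: vgeD; first exact: vis_vge.
  by apply: vge_le dy; exact: ltW.
have m1 : Num.min e d <= e by rewrite ge_min lexx.
have m2 : Num.min e d <= d by rewrite ge_min lexx orbT.
have := vgeB (vge_le m1 (vis_vge exy)) (vge_le m2 dy).
by rewrite addrK (vis_vgeE _ cx) ge_min => /orP[|]; lra.
Qed.

End Valuation.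

(** * Gauss valuations and approximate p-th powers *)

Section Gauss.

Variables (R : realType) (L : fieldType) (w : L -> \bar R).
Hypothesis w_val : is_valuation w.

(** A lower bound c for the Gauss valuation of h on the disc of depth b around 0, the minimum of
    v(h_m) + m b. A bound instead of a value keeps h = 0 harmless. *)
Definition gge (b c : R) (h : {poly L}) : Prop :=
  forall m, vge w (c - m%:R * b) h`_m.

Definition gis (b c : R) (h : {poly L}) : Prop :=
  gge b c h /\ exists m, vis w (c - m%:R * b) h`_m.

Implicit Types (b c d : R) (g h q : {poly L}).

Lemma gge_le b c d h : d <= c -> gge b c h -> gge b d h.
Proof. by move=> dc H m; apply: vge_le (H m); lra. Qed.

Lemma gge0 b c : gge b c 0.
Proof. by move=> m; rewrite coef0; exact: vge0. Qed.

Lemma ggeD b c g h : gge b c g -> gge b c h -> gge b c (g + h).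
Proof. by move=> G H m; rewrite coefD; exact: vgeD. Qed.

Lemma ggeN b c h : gge b c h -> gge b c (- h).
Proof. by move=> H m; rewrite coefN vgeN. Qed.

Lemma ggeB b c g h : gge b c g -> gge b c h -> gge b c (g - h).
Proof. by move=> G H; apply: ggeD => //; exact: ggeN. Qed.

Lemma ggeM b c d g h : gge b c g -> gge b d h -> gge b (c + d) (g * h).
Proof.
move=> G H m; rewrite coefM; apply: vge_sum => // j _.
apply: vge_le (vgeM w_val (G j) (H (m - j)%N)).
have jm : (j <= m)%N by rewrite -ltnS.
by rewrite natrB //; lra.
Qed.

Lemma gge_sum (I : Type) (s : seq I) (P : pred I) (F : I -> {poly L}) b c :
  (forall i, P i -> gge b c (F i)) -> gge b c (\sum_(i <- s | P i) F i).
Proof.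
by move=> H; elim/big_ind: _ => // [|x y]; [exact: gge0|exact: ggeD].
Qed.

Lemma ggeC b c x : vge w c x -> gge b c x%:P.
Proof.
move=> cx m; rewrite coefC; case: eqP => [->|_]; last exact: vge0.
by rewrite mul0r subr0.
Qed.

Lemma gge1 b : gge b 0 1.
Proof. by apply: ggeC; exact: vge1. Qed.

Lemma gge_polyX b : gge b b 'X.
Proof.
move=> m; rewrite coefX; case: eqP => [->|_]; last exact: vge0.
by rewrite mul1r subrr; exact: vge1.
Qed.

Lemma ggeX b c h n : gge b c h -> gge b (n%:R * c) (h ^+ n).
Proof.
move=> H; elim: n => [|n IH]; first by rewrite expr0 mul0r; exact: gge1.
by rewrite exprS -add1n natrD mulrDl mul1r; exact: ggeM.
Qed.

Lemma gge_polyXn b n : gge b (n%:R * b) 'X^n.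
Proof. by apply: ggeX; exact: gge_polyX. Qed.

Lemma ggeZ b c d x h : vge w c x -> gge b d h -> gge b (c + d) (x *: h).
Proof. by rewrite -mul_polyC => /(@ggeC b) X H; exact: ggeM. Qed.

Lemma gge_comp_translate b c a h :
  vge w b a -> gge b c h -> gge b c (h \Po ('X + a%:P)).
Proof.
move=> ba H; rewrite comp_polyE; apply: gge_sum => i _.
have -> : c = (c - i%:R * b) + i%:R * b by lra.
by apply: ggeZ => //; apply: ggeX; apply: ggeD; [exact: gge_polyX|exact: ggeC].
Qed.

Lemma gis_exists b h : h != 0 -> exists c, gis b c h.
Proof.
move=> h0.
have sh : ((size h).-1 < size h)%N by rewrite prednK // size_poly_gt0.
pose P (i : 'I_(size h)) := h`_i != 0.
pose u (i : 'I_(size h)) : R := fine (w h`_i) + i%:R * b.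
have P0 : P (Ordinal sh) by rewrite /P /= -lead_coefE lead_coef_eq0.
have uE (i : 'I_(size h)) : P i -> vis w (u i - i%:R * b) h`_i.
  by move=> /(vis_exists w_val) [r rE]; rewrite /u rE /= addrK.
case: (@Order.TotalTheory.arg_minP _ _ _ (Ordinal sh) P u P0) => i Pi ui.
exists (u i); split; last by exists i; exact: uE.
move=> m; have [->|hm] := eqVneq h`_m 0; first exact: vge0.
have ms : (m < size h)%N.
  by rewrite ltnNge; apply: contra hm => /leq_sizeP /(_ m (leqnn _)) /eqP.
rewrite (vis_vgeE _ (uE (Ordinal ms) hm)) /=.
by have := ui (Ordinal ms) hm; rewrite /=; lra.
Qed.

Lemma gis_gge b c d h : gis b c h -> gge b d h -> d <= c.
Proof.
by move=> [_ [m hm]] /(_ m); rewrite (vis_vgeE _ hm); lra.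
Qed.

Lemma gis_inj b c d h : gis b c h -> gis b d h -> c = d.
Proof.
move=> H G; apply/eqP; rewrite eq_le; apply/andP; split.
  exact: gis_gge G H.1.
exact: gis_gge H G.1.
Qed.

Lemma gis_neq0 b c h : gis b c h -> h != 0.
Proof.
move=> [_ [m hm]]; apply/eqP => h0.
by have := vis_neq0 w_val hm; rewrite h0 coef0 eqxx.
Qed.

(** * Powers of exponent p modulo terms divisible by p *)

Variables (p : nat) (vp : R).
Hypotheses (p_prime : prime p) (vpE : vis w vp p%:R) (vp_gt0 : 0 < vp).

Local Notation pR := (p%:R : R).

Let pR_ge2 : 2 <= pR.
Proof. by rewrite ler_nat prime_gt1. Qed.

(** The cross terms carry binomial coefficients divisible by p, and the bound v(p) + (p - i) c + i d
    on the i-th one is affine in i. Hence only i = 1 and i = p - 1 matter, which are the two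
    hypotheses on e. *)
Lemma gge_frobeniusD b c d e g h :
  gge b c g -> gge b d h ->
  e <= vp + (pR - 1) * c + d -> e <= vp + c + (pR - 1) * d ->
  gge b e ((g + h) ^+ p - g ^+ p - h ^+ p).
Proof.
move=> G H e1 e2.
have binE n : (g + h) ^+ n.+1 - g ^+ n.+1 - h ^+ n.+1 =
    \sum_(i < n) (g ^+ (n.+1 - i.+1) * h ^+ i.+1) *+ 'C(n.+1, i.+1).
  rewrite exprDn big_ord_recl big_ord_recr /= subn0 subnn !expr0 bin0 binn.
  rewrite mulr1 mul1r !mulr1n; under eq_bigr do rewrite /bump /= add1n.
  by rewrite /bump /= add1n [X in X - _ - _]addrC !addrK.
have := binE p.-1; rewrite prednK ?prime_gt0 // => ->.
apply: gge_sum => i _.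
have ip : (i.+1 < p)%N by rewrite -[X in (_ < X)%N](prednK (prime_gt0 p_prime)) ltnS.
have /dvdnP [k ->] : (p %| 'C(p, i.+1))%N by apply: prime_dvd_bin => //; rewrite ltn0Sn.
rewrite mulrnA -mulr_natl -[_ *+ k]mulr_natl.
set s := (p - i.+1)%N; have sE : s%:R = pR - (i.+1)%:R by rewrite /s natrB // ltnW.
have i1 : 1 <= (i.+1)%:R :> R by rewrite ler1n.
have i2 : (i.+1)%:R <= pR - 1 :> R by rewrite lerBrDr natr1 ler_nat.
have := ggeM (ggeC b (vis_vge vpE))
  (ggeM (ggeC b (vge_nat w_val k)) (ggeM (ggeX s G) (ggeX i.+1 H))).
rewrite !polyCMn polyC1; apply: gge_le.
move: i1 i2; rewrite sE; set I := (i.+1)%:R => i1 i2.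
case: (leP c d) => cd; nra.
Qed.

Lemma gge_frobenius_sum (I : Type) (s : seq I) (F : I -> {poly L}) b c :
  (forall i, gge b c (F i)) ->
  gge b (vp + pR * c) ((\sum_(i <- s) F i) ^+ p - \sum_(i <- s) F i ^+ p).
Proof.
move=> H; elim: s => [|i s IH].
  by rewrite !big_nil expr0n gtn_eqF ?prime_gt0 // subrr; exact: gge0.
rewrite !big_cons.
have S : gge b c (\sum_(j <- s) F j) by apply: gge_sum.
rewrite [X in gge _ _ X](_ : _ = ((F i + \sum_(j <- s) F j) ^+ p - F i ^+ p -
  (\sum_(j <- s) F j) ^+ p) +
  ((\sum_(j <- s) F j) ^+ p - \sum_(j <- s) F j ^+ p)); last by ring.
by apply: ggeD => //; apply: gge_frobeniusD (H i) S _ _; lra.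
Qed.

(** The p-th power of q without its cross terms; only exponents divisible by p occur in it. *)
Definition frobp q : {poly L} := \sum_(i < size q) (q`_i ^+ p) *: 'X^(i * p).

Lemma coef_frobp q m : (frobp q)`_m = if (p %| m)%N then q`_(m %/ p) ^+ p else 0.
Proof.
rewrite coef_sum; under eq_bigr do rewrite coefZ coefXn.
case: ifP => [/dvdnP[k ->]|pm]; last first.
  rewrite big1 // => i _; case: eqP => [mE|_]; last by rewrite mulr0.
  by move: pm; rewrite mE dvdn_mull.
rewrite mulnK ?prime_gt0 //.
have [ks|ks] := ltnP k (size q).
  rewrite (bigD1 (Ordinal ks)) //= eqxx mulr1 big1 ?addr0 // => i ik.
  rewrite eqn_pmul2r ?prime_gt0 //; case: eqP => [kE|_]; last by rewrite mulr0.
  by case/eqP: ik; exact/val_inj.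
rewrite [in RHS]nth_default // expr0n gtn_eqF ?prime_gt0 // big1 // => i _.
rewrite eqn_pmul2r ?prime_gt0 //; case: eqP => [kE|_]; last by rewrite mulr0.
by move: ks; rewrite kE leqNgt ltn_ord.
Qed.

Lemma gge_frobp b c q : gge b c q -> gge b (vp + pR * c) (q ^+ p - frobp q).
Proof.
move=> H; rewrite -[X in X ^+ p](coefK q) poly_def.
have -> : frobp q = \sum_(i < size q) (q`_i *: 'X^i) ^+ p.
  by apply: eq_bigr => i _; rewrite exprZn -exprM.
apply: gge_frobenius_sum => i m; rewrite coefZ coefXn.
by case: eqP => [->|_]; rewrite ?mulr1 ?mulr0 //; exact: vge0.
Qed.

Lemma gis_frobp_coef b c q : gis b c q ->
  exists i, vis w (pR * c - (i * p)%:R * b) (frobp q)`_(i * p).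
Proof.
move=> [_ [i qi]]; exists i; rewrite coef_frobp dvdn_mull // mulnK ?prime_gt0 //.
by rewrite natrM; have := visX w_val p qi; congr vis; ring.
Qed.

(** A dominant monomial of q survives in q^p at p times its exponent, since the cross terms gain
    v(p) > 0. *)
Lemma gge_exp_inv b c q : gge b c (q ^+ p) -> gge b (c / pR) q.
Proof.
move=> H; have [->|q0] := eqVneq q 0; first exact: gge0.
have [d qd] := gis_exists b q0; have [i qi] := gis_frobp_coef qd.
have E : q ^+ p = frobp q + (q ^+ p - frobp q) by ring.
have lt : pR * d - (i * p)%:R * b < vp + pR * d - (i * p)%:R * b by move: vp_gt0; lra.
have := vis_dom w_val qi (gge_frobp qd.1 (i * p)) lt; rewrite -coefD -E => qpi.
apply: gge_le qd.1; have := H (i * p)%N; rewrite (vis_vgeE _ qpi).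
by rewrite ler_pdivrMr; move: pR_ge2; lra.
Qed.

Definition tlevel : R := pR * vp / (p.-1)%:R.

Lemma tlevelE : tlevel * (pR - 1) = pR * vp.
Proof.
rewrite /tlevel -subn1 natrB ?prime_gt0 // divfK //.
by apply/eqP; move: pR_ge2; lra.
Qed.

Lemma tlevel_gt0 : 0 < tlevel.
Proof.
apply: divr_gt0; first by rewrite mulr_gt0 // ltr0n prime_gt0.
by rewrite ltr0n -subn1 subn_gt0 prime_gt1.
Qed.

(* If q' did better than q, the difference q'^p - q^p would be dominated by
   (q' - q)^p, hence by its monomials of exponent divisible by p. *)
Lemma level_maximal b V t h q q' m c :
  gge b V h -> 0 <= t < tlevel -> gge b (V + t) (h - q ^+ p) ->
  ~~ (p %| m)%N -> vis w (V + t - m%:R * b) (h - q ^+ p)`_m ->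
  V + t < c -> ~ gge b c (h - q' ^+ p).
Proof.
move=> hV /andP[t0 tT] ht pm hm tc hc.
have TE := tlevelE; have p2 := pR_ge2.
have qV : gge b (V / pR) q.
  apply: gge_exp_inv; have -> : q ^+ p = h - (h - q ^+ p) by ring.
  by apply: ggeB => //; apply: gge_le ht; lra.
pose W := q' - q; pose D := q' ^+ p - q ^+ p.
have DE : D = (h - q ^+ p) - (h - q' ^+ p) by rewrite /D; ring.
have Dm : vis w (V + t - m%:R * b) D`_m.
  rewrite DE coefB; apply: vis_dom => //; first by rewrite vgeN //; exact: hc.
  by lra.
have Dt : gge b (V + t) D by rewrite DE; apply: ggeB => //; apply: gge_le hc; lra.
have W0 : W != 0.
  rewrite subr_eq0; apply/eqP => qq; have := vis_neq0 w_val Dm.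
  by rewrite /D qq subrr coef0 eqxx.
have [om Wom] := gis_exists b W0.
pose E := (q + W) ^+ p - q ^+ p - W ^+ p.
have qW : q + W = q' by rewrite /W; ring.
have DWE : D = W ^+ p + E by rewrite /E /D qW; ring.
have VE : V = pR * (V / pR) by field; lra.
have TE' : tlevel = pR * (tlevel / pR) by field; lra.
have vpE' : vp = (tlevel / pR) * (pR - 1).
  by rewrite mulrAC TE mulrAC divff ?mul1r //; lra.
move: VE TE' vpE'; set x := V / pR; set y := tlevel / pR => VE TE' vpE'.
have y0 : 0 < y by rewrite divr_gt0 ?tlevel_gt0 //; lra.
(* Here y = T / p = v(p) / (p - 1). In the first case the two p-th powers agree up to level T,
   against the monomial m of level t < T. *)
have [big|small] := leP (x + y) om.
  have : gge b (V + tlevel) D.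
    rewrite DWE; apply: ggeD.
      by apply: gge_le (ggeX p Wom.1); rewrite VE TE' -mulrDr ler_wpM2l //; lra.
    have WW : gge b (x + y) W by apply: gge_le Wom.1.
    by apply: gge_frobeniusD qV WW _ _; rewrite -/x; nra.
  by move=> /(_ m); rewrite (vis_vgeE _ Dm); lra.
(* As om < x + y and v(p) = (p - 1) y, both bounds on the cross terms exceed p om. *)
pose e := Num.min (vp + (pR - 1) * x + om) (vp + x + (pR - 1) * om).
have e_gt : pR * om < e by rewrite lt_min; apply/andP; split; nra.
have Ee : gge b e E.
  by apply: gge_frobeniusD qV Wom.1 _ _; rewrite -/x /e ge_min lexx ?orbT.
pose e' := Num.min e (vp + pR * om).
have e'_gt : pR * om < e' by rewrite lt_min e_gt /=; move: vp_gt0; lra.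
have rest : gge b e' (D - frobp W).
  rewrite DWE addrAC; apply: ggeD.
    by apply: gge_le (gge_frobp Wom.1); rewrite ge_min lexx orbT.
  by apply: gge_le Ee; rewrite ge_min lexx.
(* [W ^+ p] shows up in D at an exponent i p with value p om, so V + t <= p om. The exponent m, not
   divisible by p, sees only terms of value above p om, which contradicts [Dm]. *)
have [i Wi] := gis_frobp_coef Wom.
have Di : vis w (pR * om - (i * p)%:R * b) D`_(i * p).
  have -> : D = frobp W + (D - frobp W) by ring.
  by rewrite coefD; apply: vis_dom (rest _) _ => //; lra.
have := Dt (i * p)%N; rewrite (vis_vgeE _ Di) => i1.
have := rest m; rewrite coefB coef_frobp (negPf pm) subr0 (vis_vgeE _ Dm); lra.
Qed.

End Gauss.

(** * The best level of a part-p-th-power decomposition *)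

Lemma coef0_exp (A : nzRingType) (q : {poly A}) n : (q ^+ n)`_0 = q`_0 ^+ n.
Proof. by rewrite -!horner_coef0 horner_exp_comm // /comm_poly mulr0 mul0r. Qed.

Lemma coef_exp_top (A : nzRingType) (q : {poly A}) k n : (size q <= k.+1)%N ->
  (size (q ^+ n) <= (k * n).+1)%N /\ (q ^+ n)`_(k * n) = q`_k ^+ n.
Proof.
move=> qk; elim: n => [|n [IH1 IH2]]; first by rewrite muln0 size_poly1 coef1.
have top : (q ^+ n.+1)`_(k * n.+1) = q`_k ^+ n.+1.
  rewrite exprS coefM mulnS.
  have kk : (k < (k + k * n).+1)%N by rewrite ltnS leq_addr.
  rewrite (bigD1 (Ordinal kk)) //= addKn IH2 -exprS big1 ?addr0 // => i ik.
  have [ki|ik'] := ltnP k i; first by rewrite nth_default ?mul0r // (leq_trans qk).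
  rewrite [X in _ * X]nth_default ?mulr0 // (leq_trans IH1) // ltn_subRL.
  rewrite ltn_add2r ltn_neqAle ik' andbT.
  by apply: contra ik => /eqP ik; apply/eqP/val_inj.
split => //; rewrite exprS (leq_trans (size_polyMleq _ _)) // mulnS.
have := leq_add qk IH1; rewrite addSn addnS.
by case: (_ + _)%N.
Qed.

Section Level.

Variables (R : realType) (L : closedFieldType) (w : L -> \bar R).
Hypothesis w_val : is_valuation w.
Variables (p : nat) (vp : R).
Hypotheses (p_prime : prime p) (vpE : vis w vp p%:R) (vp_gt0 : 0 < vp).

Implicit Types (b c d : R) (h q : {poly L}).

Local Notation pR := (p%:R : R).
Local Notation T := (tlevel p vp).
Local Notation T_gt0 := (tlevel_gt0 p_prime vp_gt0).

Let pR_ge2 : 2 <= pR.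
Proof. by rewrite ler_nat prime_gt1. Qed.

Lemma root_exists (x : L) n : (0 < n)%N -> exists y, y ^+ n = x.
Proof.
move=> n0; have [y] := @solve_monicpoly L n (fun i => if i == 0%N then x else 0) n0.
rewrite (bigD1 (Ordinal n0)) //= big1 => [|i]; last first.
  by rewrite -val_eqE /= => /negPf ->; rewrite mul0r.
by rewrite expr0 mulr1 addr0 => yE; exists y.
Qed.

Definition pth_root (x : L) : L := xget 0 [set y | y ^+ p = x].

Lemma pth_rootK x : pth_root x ^+ p = x.
Proof.
have [y yE] := root_exists x (prime_gt0 p_prime).
by rewrite /pth_root; apply: (@xgetPex _ 0 [set y | y ^+ p = x]); exists y.
Qed.

Lemma pth_root_eq0 x : (pth_root x == 0) = (x == 0).
Proof. by rewrite -{2}(pth_rootK x) expf_eq0 prime_gt0. Qed.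

Lemma vge_pth_root c x : vge w c x -> vge w (c / pR) (pth_root x).
Proof.
have [->|x0] := eqVneq x 0.
  by move: (pth_root_eq0 0); rewrite eqxx => /eqP -> _; exact: vge0.
have : pth_root x != 0 by rewrite pth_root_eq0.
move=> /(vis_exists w_val)[d dE].
have := visX w_val p dE; rewrite pth_rootK => xE.
rewrite (vis_vgeE _ dE) (vis_vgeE _ xE) ler_pdivrMr 1?mulrC //.
by move: pR_ge2; lra.
Qed.

Definition pth_size h := ((size h).-1 %/ p).+1.

Lemma leq_size_subX h q :
  (size q <= pth_size h)%N -> (size (h - q ^+ p)%R <= (size h).-1.+1)%N.
Proof.
move=> qh; rewrite (leq_trans (size_polyD _ _)) // size_polyN geq_max leqSpred /=.
have [sq _] := coef_exp_top p qh; apply: leq_trans sq _.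
by rewrite ltnS leq_trunc_div.
Qed.

(** Exponents i p to which the cross terms of a p-th power of admissible degree never contribute, so
    that a p-th root removes the coefficient exactly. *)
Definition pure_exponent h i :=
  forall q, (size q <= pth_size h)%N -> (q ^+ p)`_(i * p) = q`_i ^+ p.

Lemma pure_exponent0 h : pure_exponent h 0.
Proof. by move=> q _; rewrite mul0n coef0_exp. Qed.

Lemma pure_exponent_top h : pure_exponent h ((size h).-1 %/ p).
Proof. by move=> q qh; case: (coef_exp_top p qh). Qed.

(* Each step removes the p-th powers found in the error term; the distance of
   the level to [T] is divided by p, since [vp + (T - d) / p = T - d / p]. *)
Lemma pth_part_approx b V h N : gge w b V h -> exists q,
  [/\ (size q <= pth_size h)%N, gge w b (V / pR) q, gge w b V (h - q ^+ p),
    (forall i, vge w (V + T - T / pR ^+ N - (i * p)%:R * b)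
      (h - q ^+ p)`_(i * p)) &
    (forall i, pure_exponent h i ->
       (N == 0%N) && (q`_i == 0) || ((h - q ^+ p)`_(i * p) == 0))].
Proof.
have p2 := pR_ge2; have vp0 := vp_gt0.
move=> hV; elim: N => [|N [q [sq qV rV rp re]]].
  exists 0; rewrite expr0n gtn_eqF ?prime_gt0 // subr0; split => //.
  - by rewrite size_poly0.
  - exact: gge0.
  - by move=> i; rewrite expr0 divr1 addrK; exact: hV.
  - by move=> i _; rewrite coef0 !eqxx.
have [r rdef] : exists r, r = h - q ^+ p by exists (h - q ^+ p).
rewrite -rdef in rV rp re.
(* [frobp p W] reproduces the coefficients of r at all exponents divisible by p; what remains there
   after the subtraction comes from cross terms. *)
pose W := \poly_(i < pth_size h) pth_root r`_(i * p).
have sW : (size W <= pth_size h)%N by exact: size_poly.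
pose t := T - T / pR ^+ N.
have pN1 : 1 <= pR ^+ N by apply: exprn_ege1; lra.
have t0 : 0 <= t.
  rewrite subr_ge0 ler_pdivrMr; last exact: lt_le_trans ltr01 pN1.
  by apply: ler_peMr => //; apply: ltW; exact: T_gt0.
have tE : T - T / pR ^+ N.+1 = vp + t / pR.
  rewrite /t exprS; have TE := tlevelE vp p_prime.
  have vpT : vp = T * (pR - 1) / pR.
    by rewrite TE mulrAC divff ?mul1r //; apply/eqP; lra.
  rewrite [X in _ = X + _]vpT; field; apply/andP.
  by split=> //; apply/eqP => ?; lra.
have WV : gge w b ((V + t) / pR) W.
  move=> i; rewrite coef_poly; case: ifP => // _; last exact: vge0.
  have := vge_pth_root (rp i); congr vge; rewrite natrM /t; field; lra.
have rW i : r`_(i * p) = (frobp p W)`_(i * p).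
  rewrite coef_frobp // dvdn_mull // mulnK ?prime_gt0 // coef_poly.
  case: ltnP => iK; first by rewrite pth_rootK.
  rewrite expr0n gtn_eqF ?prime_gt0 // nth_default //.
  rewrite rdef; apply: leq_trans (leq_size_subX sq) _.
  by move: iK; rewrite /pth_size ltn_divLR ?prime_gt0.
pose E := (q + W) ^+ p - q ^+ p - W ^+ p.
have VE : V = pR * (V / pR) by field; lra.
have VtE : V + t = pR * ((V + t) / pR) by field; lra.
have Ee : gge w b (V + vp + t / pR) E.
  by apply: (gge_frobeniusD w_val p_prime vpE) qV WV _ _; nra.
have WW : gge w b (V + vp + t / pR) (W ^+ p - frobp p W).
  by apply: gge_le (gge_frobp w_val p_prime vpE WV); nra.
have r'E : h - (q + W) ^+ p = r - W ^+ p - E by rewrite rdef /E; ring.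
have Vle : V <= V + vp + t / pR.
  by have : 0 <= t / pR; [apply: divr_ge0 => //; lra|lra].
exists (q + W); split.
- by rewrite (leq_trans (size_polyD _ _)) // geq_max sq.
- apply: ggeD => //; apply: gge_le WV; rewrite ler_pM2r ?invr_gt0; lra.
- rewrite r'E; apply: ggeB => //; last exact: gge_le Ee.
  apply: ggeB => //; apply: gge_le (ggeX w_val p WV); lra.
- move=> i; have -> : (h - (q + W) ^+ p)`_(i * p) =
      - (W ^+ p - frobp p W)`_(i * p) - E`_(i * p).
    by rewrite r'E !coefB rW; ring.
  rewrite -[V + T - _]addrA tE addrA.
  by apply: vgeB => //; rewrite vgeN.
(* At a pure exponent the first extraction annihilates the error coefficient; from then on the
   coefficient of [W] there is 0. *)
- move=> i ei; apply/orP; right; rewrite coefB ei; last first.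
    by rewrite (leq_trans (size_polyD _ _)) // geq_max sq.
  have Wi : W`_i ^+ p = r`_(i * p).
    by rewrite rW coef_frobp // dvdn_mull // mulnK ?prime_gt0.
  have rE : r`_(i * p) = h`_(i * p) - q`_i ^+ p by rewrite rdef coefB ei.
  rewrite coefD; case/orP: (re i ei) => [/andP[_ /eqP q0]|/eqP r0].
    by rewrite q0 add0r Wi rE q0 expr0n gtn_eqF ?prime_gt0 // subr0 subrr.
  move: Wi; rewrite r0 => /eqP; rewrite expf_eq0 => /andP[_ /eqP ->].
  by rewrite addr0 -rE r0.
Qed.

(** The monomial e dominates h at [b0]. Passing to b lets every other monomial gain at least eps
    over it, which makes up for the gap T / p^N <= eps; the extreme monomial e itself is removed
    exactly. The polynomial q depends on eps but not on b, and this uniformity later yields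
    supporting lines. *)
Lemma dominant_approx b0 V h e eps :
  gge w b0 V h -> vis w (V - e%:R * b0) h`_e ->
  (e = 0%N \/ e = (size h).-1) -> (p %| e)%N -> 0 < eps ->
  exists2 q : {poly L}, (size q <= pth_size h)%N & forall b,
    (forall m, (m <= (size h).-1)%N -> m != e ->
       eps <= (m%:R - e%:R) * (b - b0)) ->
    let V' := V + e%:R * (b - b0) in
    [/\ gis w b V' h, gge w b V' (h - q ^+ p) &
      forall i, vge w (V' + T - (i * p)%:R * b) (h - q ^+ p)`_(i * p)].
Proof.
move=> hV he e0n pe eps0; have p2 := pR_ge2.
(* N is positive because the extreme coefficient vanishes only after one extraction. *)
have [N N0 Neps] : exists2 N, (0 < N)%N & T / pR ^+ N <= eps.
  have [N NT] : exists N : nat, T / eps <= N%:R.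
    exists (Num.bound (T / eps)); apply/ltW/archi_boundP.
    by apply: divr_ge0; apply: ltW => //; exact: T_gt0.
  exists N.+1 => //; rewrite ler_pdivrMr ?exprn_gt0 //; last by lra.
  rewrite -ler_pdivrMl // mulrC (le_trans NT) //.
  rewrite -natrX ler_nat ltnW // (leq_trans (ltn_expl N (prime_gt1 p_prime))) //.
  by rewrite leq_exp2l // prime_gt1.
have [q [sq _ rV rp re]] := pth_part_approx N hV.
exists q => // b Hb V'.
have step m : (m <= (size h).-1)%N -> V' - m%:R * b <= V - m%:R * b0.
  move=> mn; have [->|me] := eqVneq m e; first by rewrite /V'; lra.
  by have := Hb m mn me; rewrite /V'; lra.
have extend (g : {poly L}) c : (size g <= (size h).-1.+1)%N -> c <= 0 ->
    gge w b0 (V - c) g -> gge w b (V' - c) g.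
  move=> sg c0 gV m; have [mn|nm] := leqP m (size h).-1.
    by apply: vge_le (gV m); have := step m mn; lra.
  by rewrite nth_default ?(leq_trans sg) //; exact: vge0.
split.
- split; last by exists e; move: he; congr vis; rewrite /V'; lra.
  rewrite -[V']subr0; apply: extend; rewrite ?subr0 //; exact: leqSpred.
- by rewrite -[V']subr0; apply: extend; rewrite ?subr0 // leq_size_subX.
- move=> i; have [nm|mn] := ltnP (size h).-1 (i * p).
    by rewrite nth_default ?(leq_trans (leq_size_subX sq)) //; exact: vge0.
  have [ie|ie] := eqVneq (i * p)%N e; last first.
    by apply: vge_le (rp i); have := Hb _ mn ie; rewrite /V'; lra.
  have /re : pure_exponent h i.
    case: e0n ie => -> iE.
      move/eqP: iE; rewrite muln_eq0 => /orP[/eqP->|]; first exact: pure_exponent0.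
      by rewrite gtn_eqF ?prime_gt0.
    rewrite (_ : i = ((size h).-1 %/ p)%N); first exact: pure_exponent_top.
    by rewrite -iE mulnK ?prime_gt0.
  by rewrite gtn_eqF //= => /eqP ->; exact: vge0.
Qed.

Definition gv b h : R := xget 0 [set c | gis w b c h].

Lemma gvP b h : h != 0 -> gis w b (gv b h) h.
Proof.
by move=> h0; apply: (@xgetPex _ 0 [set c | gis w b c h]); exact: gis_exists.
Qed.

Lemma gvE b c h : gis w b c h -> gv b h = c.
Proof. by move=> H; apply: gis_inj (gvP b (gis_neq0 w_val H)) H. Qed.

Definition levels b h : set R :=
  [set t | 0 <= t <= T /\ exists2 q : {poly L}, (size q <= pth_size h)%N &
     gge w b (gv b h + t) (h - q ^+ p)].

(* Only a supremum: good decompositions are shown to exist on a dense set of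
   discs, which determines the continuous function [tfun]. *)
Definition best_level b h : R := sup (levels b h).

Lemma levels0 b h : h != 0 -> levels b h 0.
Proof.
move=> h0; split; first by rewrite lexx ltW ?T_gt0.
exists 0; first by rewrite size_poly0.
rewrite expr0n gtn_eqF ?prime_gt0 // subr0 addr0; exact: (gvP b h0).1.
Qed.

Lemma has_sup_levels b h : h != 0 -> has_sup (levels b h).
Proof.
move=> h0; split; first by exists 0; exact: levels0.
by exists T => t [/andP[_ ?] _].
Qed.

Lemma levels_le_tau b h t : h != 0 -> levels b h t -> t <= best_level b h.
Proof. by move=> h0 ht; apply: sup_upper_bound ht; exact: has_sup_levels. Qed.

Lemma tau_le b h c : h != 0 -> (forall t, levels b h t -> t <= c) -> best_level b h <= c.
Proof. by move=> h0 H; apply: ge_sup => //; exists 0; exact: levels0. Qed.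

Lemma tau_ge0 b h : h != 0 -> 0 <= best_level b h.
Proof. by move=> h0; apply: levels_le_tau => //; exact: levels0. Qed.

Lemma tau_leT b h : h != 0 -> best_level b h <= T.
Proof. by move=> h0; apply: tau_le => // t [/andP[_ ?] _]. Qed.

Lemma tau_max b V h q : gis w b V h -> (size q <= pth_size h)%N ->
  gge w b (V + T) (h - q ^+ p) -> best_level b h = T.
Proof.
move=> hV sq ht; have h0 := gis_neq0 w_val hV.
apply/eqP; rewrite eq_le tau_leT //= levels_le_tau //; split.
  by rewrite lexx ltW ?T_gt0.
by exists q => //; rewrite (gvE hV).
Qed.

Lemma tau_level b V h q t m : gis w b V h -> (size q <= pth_size h)%N ->
  0 <= t < T -> gge w b (V + t) (h - q ^+ p) -> ~~ (p %| m)%N ->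
  vis w (V + t - m%:R * b) (h - q ^+ p)`_m -> best_level b h = t.
Proof.
move=> hV sq tT ht pm hm; have h0 := gis_neq0 w_val hV.
have /andP[t0 t1] := tT.
apply/eqP; rewrite eq_le; apply/andP; split; last first.
  apply: levels_le_tau => //; split; first by rewrite t0 ltW.
  by exists q => //; rewrite (gvE hV).
apply: tau_le => // t' [_ [q' _]]; rewrite (gvE hV) => ht'.
rewrite leNgt; apply/negP => tt'.
by apply: (level_maximal w_val p_prime vpE vp_gt0 hV.1 tT ht pm hm _ ht'); lra.
Qed.

(** Once the exponents divisible by p are above the truncation, the error is either wholly above it
    or attains its Gauss valuation at another exponent. In both cases q realizes the best level. *)
Lemma tau_impure b V h q :
  gis w b V h -> (size q <= pth_size h)%N -> gge w b V (h - q ^+ p) ->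
  (forall i, vge w (V + T - (i * p)%:R * b) (h - q ^+ p)`_(i * p)) ->
  gge w b (V + best_level b h) (h - q ^+ p) /\
  (best_level b h <> T -> exists m, [/\ ~~ (p %| m)%N, (m < size (h - q ^+ p)%R)%N &
     vis w (V + best_level b h - m%:R * b) (h - q ^+ p)`_m]).
Proof.
move=> hV sq rV rp; set r := h - q ^+ p in rV rp *.
have max : gge w b (V + T) r ->
    gge w b (V + best_level b h) r /\ (best_level b h <> T -> exists m, [/\ ~~ (p %| m)%N,
    (m < size r)%N & vis w (V + best_level b h - m%:R * b) r`_m]).
  by move=> rT; have := tau_max hV sq rT => ->; split.
have [r0|r0] := eqVneq r 0; first by apply: max; rewrite r0; exact: gge0.
have [c rc] := gis_exists w_val b r0.
have [cT|cT] := leP (V + T) c; first by apply: max; apply: gge_le rc.1.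
have Vc := gis_gge rc rV; case: (rc) => rg [m rm].
have cE : c = V + (c - V) by lra.
have pm : ~~ (p %| m)%N.
  apply/negP => /dvdnP[i mE]; have := rp i; rewrite -mE (vis_vgeE _ rm); lra.
have tE : best_level b h = c - V.
  apply: (@tau_level b V h q (c - V) m) => //; rewrite -?cE //; lra.
rewrite tE -cE; split => // _; exists m; split => //.
rewrite ltnNge; apply/negP => /leq_sizeP /(_ m (leqnn _)) rm0.
by have := vis_neq0 w_val rm; rewrite rm0 eqxx.
Qed.

Lemma gge_le_radius b b' c h : b' <= b -> gge w b' c h -> gge w b c h.
Proof.
move=> bb H m; apply: vge_le (H m); rewrite lerD2l lerN2 ler_wpM2l //.
Qed.

Lemma gge_ge_radius n b b' c h : (size h <= n.+1)%N -> b' <= b ->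
  gge w b c h -> gge w b' (c - n%:R * (b - b')) h.
Proof.
move=> hn bb H m; have [mn|nm] := leqP m n; last first.
  by rewrite nth_default ?(leq_trans hn) //; exact: vge0.
apply: vge_le (H m); have : m%:R <= n%:R :> R by rewrite ler_nat.
by nra.
Qed.

(** From depth b' to depth b, Gauss valuations in degree at most n grow by an amount between 0 and n
    (b - b'). This applies to h and, with the same q, to h - q^p. *)
Lemma tau_lipschitz b b' h : h != 0 -> b' <= b ->
  `|best_level b h - best_level b' h| <= (size h).-1%:R * (b - b').
Proof.
move=> h0 bb; set n := (size h).-1; have d0 : 0 <= n%:R * (b - b').
  by rewrite mulr_ge0 //; lra.
have g1 : gv b' h <= gv b h.
  by apply: gis_gge (gvP b h0) _; apply: gge_le_radius bb (gvP b' h0).1.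
have g2 : gv b h - n%:R * (b - b') <= gv b' h.
  apply: gis_gge (gvP b' h0) _; apply: gge_ge_radius bb (gvP b h0).1.
  exact: leqSpred.
rewrite ler_norml lerBlDr lerNl opprB lerBlDr; apply/andP; split;
  apply: tau_le => // t [/andP[t0 tT] [q sq ht]].
- have [tn|tn] := leP t (n%:R * (b - b')).
    by apply: (le_trans tn); rewrite lerDl tau_ge0.
  rewrite addrC -lerBlDr; apply: levels_le_tau => //; split; first lra.
  exists q => //; apply: gge_le (gge_le_radius bb ht); lra.
- have [tn|tn] := leP t (n%:R * (b - b')).
    by apply: (le_trans tn); rewrite lerDl tau_ge0.
  rewrite addrC -lerBlDr; apply: levels_le_tau => //; split; first lra.
  exists q => //; apply: gge_le (gge_ge_radius (leq_size_subX sq) bb ht).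
  by rewrite -/n; lra.
Qed.

Lemma size_translate h a : size (h \Po ('X + a%:P)) = size h.
Proof. by rewrite size_comp_poly2 // size_XaddC. Qed.

Lemma translateK h a : h \Po ('X + a%:P) \Po ('X + (- a)%:P) = h.
Proof.
by rewrite polyCN comp_polyXaddC_K.
Qed.

Lemma gis_translate b c h a : vge w b a -> gis w b c h ->
  gis w b c (h \Po ('X + a%:P)).
Proof.
move=> ba hc; have h0 := gis_neq0 w_val hc.
have [d hd] : exists d, gis w b d (h \Po ('X + a%:P)).
  by apply: gis_exists => //; rewrite -size_poly_eq0 size_translate size_poly_eq0.
suff <- : d = c by [].
apply/eqP; rewrite eq_le; apply/andP; split.
  apply: gis_gge hc _; rewrite -(translateK h a).
  by apply: gge_comp_translate => //; [rewrite vgeN|exact: hd.1].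
by apply: gis_gge hd _; apply: gge_comp_translate => //; exact: hc.1.
Qed.

(** Translation by a preserves degrees, p-th powers and the Gauss valuation at depth b. The level
    thus depends on the disc and not on its centre. *)
Lemma tau_translate b h a : h != 0 -> vge w b a ->
  best_level b (h \Po ('X + a%:P)) = best_level b h.
Proof.
have half h' a' : h' != 0 -> vge w b a' -> best_level b h' <= best_level b (h' \Po ('X + a'%:P)).
  move=> h0 ba; have hV := gvP b h0; have hV' := gis_translate ba hV.
  apply: tau_le => // t [tT [q sq ht]].
  apply: levels_le_tau; first exact: gis_neq0 hV'.
  split=> //; exists (q \Po ('X + a'%:P)).
    by rewrite /pth_size !size_translate.
  rewrite (gvE hV') -(rmorphXn (comp_poly ('X + a'%:P))) -rmorphB.
  exact: gge_comp_translate.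
move=> h0 ba; apply/eqP; rewrite eq_le half // andbT.
rewrite -[in leRHS](translateK h a); apply: half; last by rewrite vgeN.
by rewrite -size_poly_eq0 size_translate size_poly_eq0.
Qed.

(** The monomial m realizing the level at x bounds the level at every y in [Rg], where the same q is
    valid; its value relative to h is affine in the depth with slope m - e. *)
Lemma tau_supporting (h q : {poly L}) b0 V e (Rg : set R) :
  (size q <= pth_size h)%N ->
  (forall b, Rg b -> let V' := V + e%:R * (b - b0) in
    [/\ gis w b V' h, gge w b V' (h - q ^+ p) &
      forall i, vge w (V' + T - (i * p)%:R * b) (h - q ^+ p)`_(i * p)]) ->
  forall x, Rg x -> best_level x h <> T ->
  exists m : nat, [/\ ~~ (p %| m)%N, (m <= (size h).-1)%N & forall y, Rg y ->
    best_level y h <= best_level x h + (m%:R - e%:R) * (y - x)].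
Proof.
move=> sq H x Rx xT; have [hx rx px] := H x Rx.
have [_ /(_ xT)[m [pm mn rm]]] := tau_impure hx sq rx px.
exists m; split => //; first by have := leq_trans mn (leq_size_subX sq).
move=> y Ry; have [hy ry py] := H y Ry.
have [/(_ m) + _] := tau_impure hy sq ry py.
rewrite (vis_vgeE _ rm); lra.
Qed.

End Level.

(** * Products of linear factors *)

Section RootProduct.

Variables (R : realType) (L : closedFieldType) (w : L -> \bar R).
Hypothesis w_val : is_valuation w.
Variables (p : nat) (vp : R).
Hypotheses (p_prime : prime p) (vpE : vis w vp p%:R) (vp_gt0 : 0 < vp).

Implicit Types (b c d : R) (h q g : {poly L}) (s : seq L) (mu : L -> nat).

Local Notation T := (tlevel p vp).

(** * Congruences up to terms of larger Gauss valuation *)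

Definition ggt b c h : Prop := exists2 e, 0 < e & gge w b (c + e) h.

Lemma ggtW b c h : ggt b c h -> gge w b c h.
Proof. by move=> [e e0]; apply: gge_le; lra. Qed.

Lemma ggtD b c g h : ggt b c g -> ggt b c h -> ggt b c (g + h).
Proof.
move=> [e e0 G] [e' e'0 H]; exists (Num.min e e'); first by rewrite lt_min e0.
apply: ggeD => //; [apply: gge_le G|apply: gge_le H].
  by rewrite lerD2l ge_min lexx.
by rewrite lerD2l ge_min lexx orbT.
Qed.

Lemma ggt_mull b c d g h : gge w b c g -> ggt b d h -> ggt b (c + d) (g * h).
Proof. by move=> G [e e0 H]; exists e => //; rewrite -addrA; exact: ggeM. Qed.

Definition cong b c g h : Prop := gge w b c h /\ ggt b c (g - h).

Lemma congW b c g h : cong b c g h -> gge w b c g.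
Proof.
move=> [H /ggtW GH]; have -> : g = (g - h) + h by ring.
exact: ggeD.
Qed.

Lemma cong_refl b c h : gge w b c h -> cong b c h h.
Proof. by move=> H; split=> //; exists 1 => //; rewrite subrr; exact: gge0. Qed.

Lemma congM b c d g h g' h' :
  cong b c g h -> cong b d g' h' -> cong b (c + d) (g * g') (h * h').
Proof.
move=> gh gh'; split; first exact: ggeM gh.1 gh'.1.
have -> : g * g' - h * h' = g * (g' - h') + h' * (g - h) by ring.
apply: ggtD; first exact: ggt_mull (congW gh) gh'.2.
by rewrite addrC; exact: ggt_mull gh'.1 gh.2.
Qed.

Lemma congX b c g h n : cong b c g h -> cong b (n%:R * c) (g ^+ n) (h ^+ n).
Proof.
move=> gh; elim: n => [|n IH].
  by rewrite !expr0 mul0r; apply: cong_refl; exact: gge1.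
by rewrite !exprS -add1n natrD mulrDl mul1r; exact: congM.
Qed.

Lemma cong_prod (I : eqType) (s : seq I) (P : pred I) (F G : I -> {poly L})
    (c : I -> R) b :
  (forall i, i \in s -> P i -> cong b (c i) (F i) (G i)) ->
  cong b (\sum_(i <- s | P i) c i) (\prod_(i <- s | P i) F i)
    (\prod_(i <- s | P i) G i).
Proof.
elim: s => [|i s IH] H.
  by rewrite !big_nil; apply: cong_refl; exact: gge1.
rewrite !big_cons; have {}IH := IH (fun j js => H j (@mem_behead _ (i :: s) j js)).
by case: ifP => // Pi; apply: congM => //; apply: H => //; exact: mem_head.
Qed.

Definition rootprod s mu : {poly L} := \prod_(a <- s) ('X - a%:P) ^+ mu a.

Lemma rootprod_monic s mu : rootprod s mu \is monic.
Proof. by apply: monic_prod => a _; rewrite monic_exp // monicXsubC. Qed.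

Lemma rootprod_neq0 s mu : rootprod s mu != 0.
Proof. exact: monic_neq0 (rootprod_monic s mu). Qed.

Lemma size_prod_linear (s : seq L) (P : pred L) (F : L -> L) (n : L -> nat) :
  size (\prod_(a <- s | P a) ('X - (F a)%:P) ^+ n a) =
  (\sum_(a <- s | P a) n a).+1.
Proof.
elim: s => [|a s IH]; first by rewrite !big_nil size_poly1.
rewrite !big_cons; case: ifP => // _.
rewrite size_monicM ?monic_exp ?monicXsubC //; last first.
  by rewrite -size_poly_eq0 IH.
by rewrite size_exp_XsubC IH addSn addnS.
Qed.

Lemma size_rootprod s mu : size (rootprod s mu) = (\sum_(a <- s) mu a).+1.
Proof. exact: (size_prod_linear s xpredT id). Qed.

Definition shifted s mu (c : L) : {poly L} := rootprod s mu \Po ('X + c%:P).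

Lemma shiftedE s mu (c : L) :
  shifted s mu c = \prod_(a <- s) ('X - (a - c)%:P) ^+ mu a.
Proof.
rewrite /shifted /rootprod (rmorph_prod (comp_poly ('X + c%:P))) /=.
apply: eq_bigr => a _; rewrite (rmorphXn (comp_poly ('X + c%:P))) /=.
by rewrite comp_polyB comp_polyX comp_polyC polyCB opprB addrA.
Qed.

Lemma shifted_neq0 s mu (c : L) : shifted s mu c != 0.
Proof. by rewrite -size_poly_eq0 size_translate size_rootprod. Qed.

Lemma shifted_monic s mu (c : L) : shifted s mu c \is monic.
Proof. by rewrite shiftedE; apply: monic_prod => a _; rewrite monic_exp // monicXsubC. Qed.

Definition far b (x : L) := ~~ (b%:E < w x)%E.

Lemma farP b x : reflect (exists2 v, vis w v x & v <= b) (far b x).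
Proof.
apply: (iffP idP) => [fx|[v vx vb]]; last by rewrite /far vx lte_fin -leNgt.
have [x0|/(vis_exists w_val)[v vx]] := eqVneq x 0.
  by move: fx; rewrite /far x0 (val0 w_val) ltry.
by exists v => //; move: fx; rewrite /far vx lte_fin -leNgt.
Qed.

Lemma nfar_gt b x : ~~ far b x -> exists2 v, b < v & vge w v x.
Proof.
rewrite negbK => bx; have [x0|/(vis_exists w_val)[v vx]] := eqVneq x 0.
  by exists (b + 1); [lra|rewrite x0; exact: vge0].
by exists v; [move: bx; rewrite vx lte_fin|exact: vis_vge].
Qed.

Lemma prod_const_dominant (I : eqType) (s : seq I) (P : pred I) (F : I -> L)
    (n : I -> nat) b :
  (forall i, i \in s -> P i -> far b (F i)) -> exists V,
  gge w b V (\prod_(i <- s | P i) ('X - (F i)%:P) ^+ n i) /\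
  vis w V (\prod_(i <- s | P i) ('X - (F i)%:P) ^+ n i)`_0.
Proof.
elim: s => [|i s IH] H.
  exists 0; rewrite big_nil; split; first exact: gge1.
  by rewrite coef1; exact: vis1.
have [V [VS V0]] := IH (fun j js => H j (@mem_behead _ (i :: s) j js)).
rewrite !big_cons; case: ifP => Pi; last by exists V.
have /farP[v vi vb] := H i (mem_head _ _) Pi.
exists ((n i)%:R * v + V); split.
  apply: ggeM => //; apply: ggeX => //; apply: ggeB => //.
    by apply: gge_le (gge_polyX w_val b).
  by apply: ggeC => //; exact: vis_vge.
rewrite coef0M; apply: (visM w_val) => //; rewrite coef0_exp; apply: (visX w_val).
by rewrite coefB coefX coefC /= sub0r; exact: visN.
Qed.

(** The strict inequality selects the residue class of z inside the disc of depth b around z. *)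
Definition count_in s mu b (z : L) : nat :=
  (\sum_(a <- s | (b%:E < w (a - z)%R)%E) mu a)%N.

(** In the leading form each root in the class of z contributes a factor X, and each other root a
    factor dominated by its constant term. *)
Lemma shifted_initial s mu b (z : L) : exists V, gis w b V (shifted s mu z) /\
  vis w (V - (count_in s mu b z)%:R * b) (shifted s mu z)`_(count_in s mu b z).
Proof.
set N := count_in s mu b z.
have [V2 [gV2 vV2]] := @prod_const_dominant _ s (fun a => far b (a - z))
  (fun a => a - z) mu b (fun _ _ H => H).
rewrite shiftedE (bigID (fun a => ~~ far b (a - z))) /=.
under [X in _ * X]eq_bigl do rewrite negbK.
set P2 := \prod_(a <- s | far _ _) _ in gV2 vV2 *.
set P1 := \prod_(a <- s | ~~ far _ _) _.
have P1c : cong b (N%:R * b) P1 'X^N.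
  have -> : N%:R * b = \sum_(a <- s | ~~ far b (a - z)) (mu a)%:R * b.
    by rewrite -mulr_suml -natr_sum /N /count_in; under eq_bigl do rewrite -[(_ < _)%E]negbK.
  have -> : 'X^N = \prod_(a <- s | ~~ far b (a - z)) 'X^(mu a) :> {poly L}.
    rewrite /N /count_in; elim: (s) => [|a s' IH]; first by rewrite !big_nil expr0.
    by rewrite !big_cons negbK; case: ifP => //; rewrite exprD IH.
  apply: cong_prod => a _ /nfar_gt[v bv va]; apply: congX; split.
    exact: gge_polyX.
  exists (v - b); first by rewrite subr_gt0.
  rewrite addrC subrK addrC addKr; apply: (ggeN w_val); exact: ggeC.
have [e e0 Ee] := P1c.2.
exists (N%:R * b + V2).
have coefN : vis w (N%:R * b + V2 - N%:R * b) (P1 * P2)`_N.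
  have -> : P1 * P2 = P2 * 'X^N + (P1 - 'X^N) * P2 by ring.
  rewrite coefD coefMXn ltnn subnn addrC addKr.
  apply: (vis_dom w_val vV2 (ggeM w_val Ee gV2 N)); lra.
by split=> //; split; [exact: ggeM (congW P1c) gV2|exists N].
Qed.

(** With q = 0 the error is the polynomial itself, whose dominant exponent [count_in s mu b z] is
    not divisible by p; level 0 cannot be improved. *)
Lemma tau_eq0_of_count s mu b (z : L) : ~~ (p %| count_in s mu b z)%N ->
  best_level w p vp b (shifted s mu z) = 0.
Proof.
move=> pN; have [V [hV hN]] := shifted_initial s mu b z.
apply: (@tau_level _ _ _ w_val _ _ p_prime vpE vp_gt0 b V _ 0 0 (count_in s mu b z)) => //.
- by rewrite size_poly0.
- by rewrite lexx; exact: tlevel_gt0.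
- by rewrite addr0 expr0n gtn_eqF ?prime_gt0 // subr0; exact: hV.1.
- by rewrite addr0 expr0n gtn_eqF ?prime_gt0 // subr0.
Qed.

Section Converse.

Variables (s : seq L) (mu : L -> nat) (b : R) (z : L).
Hypotheses (s_uniq : uniq s).
Hypothesis count_dvd :
  forall x, vge w b (x - z) -> (p %| count_in s mu b x)%N.

Let near (a a' : L) : bool := (b%:E < w (a - a')%R)%E.

Let near_sym a a' : near a a' = near a' a.
Proof. by rewrite /near -opprB (valN w_val). Qed.

Let near_trans a a' a'' : near a a' -> near a' a'' -> near a a''.
Proof.
move=> H H'; rewrite /near; have -> : a - a'' = (a - a') + (a' - a'') by ring.
apply: lt_le_trans (Defs.valD w_val _ _).
by rewrite lt_min; apply/andP; split.
Qed.

Let near_vge a a' : near a a' -> vge w b (a - a').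
Proof. exact: ltW. Qed.

(** A canonical representative of the residue class of a: the first root in it. The default of [nth]
    is never reached for a in s. *)
Let rep a := nth 0 s (find (near a) s).

Let has_near a : a \in s -> has (near a) s.
Proof.
move=> sa; apply/hasP; exists a => //.
by rewrite /near subrr (val0 w_val) ltry.
Qed.

Let rep_in a : a \in s -> rep a \in s.
Proof. by move=> /has_near; rewrite has_find => H; exact: mem_nth. Qed.

Let near_rep a : a \in s -> near a (rep a).
Proof. by move=> /has_near /(nth_find 0). Qed.

Let rep_eq a a' : near a a' -> rep a = rep a'.
Proof.
move=> aa; rewrite /rep; congr nth; apply: eq_find => y.
apply/idP/idP; last exact: near_trans.
by apply: near_trans; rewrite near_sym.
Qed.

Let inside a := vge w b (a - z).

Let mult (c : L) := (\sum_(a <- s | inside a && (c == rep a)) mu a)%N.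

Let dvd_mult (c : L) : (p %| mult c)%N.
Proof.
have [/hasP[a0 sa0 /andP[in0 /eqP ->]]|none] :=
  boolP (has (fun a => inside a && (c == rep a)) s).
  rewrite /mult (_ : (\sum_(a <- s | _) _)%N = count_in s mu b a0); first exact: count_dvd.
  rewrite /count_in big_seq_cond [RHS]big_seq_cond; apply: eq_bigl => a.
  have [sa /=|//] := boolP (a \in s); apply/andP/idP.
    move=> [_ /eqP reps]; apply: near_trans (near_rep sa) _.
    by rewrite -reps near_sym near_rep.
  move=> aa0; split; last by rewrite eq_sym; apply/eqP/rep_eq.
  rewrite /inside; have -> : a - z = (a - a0) + (a0 - z) by ring.
  by apply: (vgeD w_val) => //; exact: near_vge.
by rewrite /mult big_seq_cond big1 // => a /andP[sa ac]; case/negP: none; apply/hasP; exists a.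
Qed.

(** Moving each root inside the disc to the representative of its class, and replacing the factor of
    each outside root by its constant term, changes the polynomial only above its Gauss valuation.
    The multiplicities are then divisible by p and constants have p-th roots in L, so the result is
    a p-th power. *)
Lemma tau_gt0_of_count : 0 < best_level w p vp b (shifted s mu z).
Proof.
pose Q1 := \prod_(a <- s | inside a) ('X - (rep a - z)%:P) ^+ mu a.
pose kap := \prod_(a <- s | ~~ inside a) (- (a - z)) ^+ mu a.
(* The Gauss valuation at depth b of the factor X - (a - z). *)
pose val a := if inside a then b else fine (w (a - z)).
have outP a : ~~ inside a -> vis w (val a) (a - z) /\ val a < b.
  move=> na; have /(vis_exists w_val)[v vE] : a - z != 0.
    by apply/eqP => az; move: na; rewrite /inside az (vge0 w_val).
  rewrite /val (negPf na) vE; split=> //=.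
  by move: na; rewrite /inside (vis_vgeE _ vE) -ltNge.
have Q1E : Q1 = (\prod_(c <- s) ('X - (c - z)%:P) ^+ (mult c %/ p)) ^+ p.
  rewrite -prodrXl; under [RHS]eq_bigr do
    rewrite -exprM divnK ?dvd_mult // /mult (big_morph _ (exprD _) (expr0 _)).
  rewrite -(exchange_big_dep xpredT) //= /Q1 big_seq_cond [RHS]big_seq_cond.
  apply: eq_bigr => a /andP[sa _].
  by rewrite (eq_bigl (pred1 (rep a))) // -big_filter filter_pred1_uniq ?rep_in // big_seq1.
have [gam gamE] := root_exists kap (prime_gt0 p_prime).
pose q := gam *: \prod_(c <- s) ('X - (c - z)%:P) ^+ (mult c %/ p).
have qE : q ^+ p = kap *: Q1 by rewrite exprZn gamE Q1E.
pose V := \sum_(a <- s | inside a) (mu a)%:R * val a +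
  \sum_(a <- s | ~~ inside a) (mu a)%:R * val a.
have hQ : cong b V (shifted s mu z) (q ^+ p).
  rewrite qE -mul_polyC mulrC shiftedE (bigID inside) /=; apply: congM.
    apply: cong_prod => a sa ina; apply: congX; rewrite /val ina; split.
      apply: ggeB => //; first exact: gge_polyX.
      apply: ggeC => //; have -> : rep a - z = (a - z) - (a - rep a) by ring.
      by apply: (vgeB w_val) => //; exact/near_vge/near_rep.
    have [v bv vE] : exists2 v, b < v & vge w v (a - rep a).
      by apply: nfar_gt; rewrite negbK; exact: near_rep.
    exists (v - b); first by rewrite subr_gt0.
    have -> : 'X - (a - z)%:P - ('X - (rep a - z)%:P) = - (a - rep a)%:P.
      by rewrite !polyCB; ring.
    by rewrite addrC subrK; apply: (ggeN w_val); exact: ggeC.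
  rewrite /kap (rmorph_prod polyC) /=; apply: cong_prod => a _ na.
  have [va vb] := outP a na; rewrite rmorphXn /=; apply: congX; split.
    by apply: ggeC => //; apply: vis_vge; exact: visN.
  exists (b - val a); first by rewrite subr_gt0.
  rewrite addrC subrK polyCN opprK subrK; exact: gge_polyX.
have kapV : vis w (\sum_(a <- s | ~~ inside a) (mu a)%:R * val a) kap.
  rewrite /kap; elim: (s) => [|a s' IH]; first by rewrite !big_nil; exact: vis1.
  rewrite !big_cons; case: ifP => // na; apply: (visM w_val) => //.
  by apply: (visX w_val); apply: (visN w_val); case: (outP a na).
pose N := (\sum_(a <- s | inside a) mu a)%N.
have Q1N : Q1`_N = 1.
  have sQ1 : size Q1 = N.+1 by exact: size_prod_linear.
  have : Q1 \is monic by apply: monic_prod => a _; rewrite monic_exp // monicXsubC.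
  by rewrite monicE lead_coefE sQ1 => /eqP.
have [e e0 hqe] := hQ.2.
have hV : gis w b V (shifted s mu z).
  split; first exact: congW hQ; exists N.
  have -> : shifted s mu z = q ^+ p + (shifted s mu z - q ^+ p) by ring.
  rewrite coefD; apply: (vis_dom w_val _ (hqe N)); last lra.
  rewrite qE coefZ Q1N mulr1; move: kapV; congr vis.
  rewrite /V /N natr_sum mulr_suml.
  under [in RHS]eq_bigr => a ina do rewrite /val ina.
  by ring.
have T0 := tlevel_gt0 p_prime vp_gt0.
apply: (@lt_le_trans _ _ (Num.min e T)); first by rewrite lt_min e0.
apply: (levels_le_tau w_val p_prime vp_gt0); first exact: shifted_neq0.
split; first by rewrite le_min (ltW e0) (ltW T0) /= ge_min lexx orbT.
exists q; last first.
  rewrite (gvE w_val hV); apply: gge_le hqe.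
  by rewrite lerD2l ge_min lexx.
(* The degree bound on q: p deg q is the number of roots inside the disc, at most the total
   degree. *)
rewrite (leq_trans (size_scale_leq _ _)) // size_prod_linear /pth_size size_translate.
rewrite size_rootprod /= ltnS leq_divRL ?prime_gt0 // big_distrl /=.
under eq_bigr do rewrite divnK ?dvd_mult //.
rewrite /mult -(exchange_big_dep xpredT) //= big_seq_cond.
rewrite [X in (_ <= X)%N](bigID inside) /= [X in (_ <= X + _)%N]big_seq_cond.
apply: leq_trans (leq_addr _ _); apply: eq_leq; apply: eq_bigr => a /andP[sa _].
by rewrite (eq_bigl (pred1 (rep a))) // -big_filter filter_pred1_uniq ?rep_in // big_seq1.
Qed.

End Converse.

End RootProduct.

(** * Piecewise linear functions with decreasing slopes *)

Section PiecewiseLinear.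

Variables (R : realType) (P : int -> Prop) (S : set R) (F : R -> R).

Local Notation line m K x := (m%:~R * x + K : R).

Lemma line_crossing (m m' : int) (K K' x : R) : m' < m ->
  (line m K x <= line m' K' x) = (x <= (K' - K) / (m%:~R - m'%:~R)).
Proof.
move=> mm; have d0 : 0 < m%:~R - m'%:~R :> R by rewrite subr_gt0 ltr_int.
by rewrite ler_pdivlMr //; apply/idP/idP; lra.
Qed.

Lemma line_crossing_ge (m m' : int) (K K' x : R) : m' < m ->
  (line m' K' x <= line m K x) = ((K' - K) / (m%:~R - m'%:~R) <= x).
Proof.
move=> mm; have d0 : 0 < m%:~R - m'%:~R :> R by rewrite subr_gt0 ltr_int.
by rewrite ler_pdivrMr //; apply/idP/idP; lra.
Qed.

(** Induction on the number of lines. If two consecutive crossing points are out of order, the line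
    between them is redundant; otherwise the crossing points increase and serve as breakpoints. *)
Lemma pl_min_lines n (m : nat -> int) (K : nat -> R) :
  (forall j, (j < n)%N -> m j.+1 < m j) ->
  (forall j, (j <= n)%N -> P (m j)) ->
  (forall x j, S x -> (j <= n)%N -> F x <= line (m j) (K j) x) ->
  (forall x, S x -> exists2 j, (j <= n)%N & F x = line (m j) (K j) x) ->
  pl_decreasing_int_slopes P S F.
Proof.
elim: n m K => [|n IH] m K mdec mP Fle Fin.
  exists 0%N, (fun j => if j == 0%N then -oo%E else +oo%E), m; split => //.
  - by case.
  move=> j x y; rewrite leqn0 => /eqP -> Sx Sy _ _.
  have E z : S z -> F z = line (m 0%N) (K 0%N) z.
    by move=> /Fin[i]; rewrite leqn0 => /eqP ->.
  by rewrite !E //; ring.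
pose b j : R := (K j.+1 - K j) / ((m j)%:~R - (m j.+1)%:~R).
have bP j x : (j < n.+1)%N ->
    (line (m j) (K j) x <= line (m j.+1) (K j.+1) x) = (x <= b j).
  by move=> jn; rewrite line_crossing // mdec.
have bP' j x : (j < n.+1)%N ->
    (line (m j.+1) (K j.+1) x <= line (m j) (K j) x) = (b j <= x).
  by move=> jn; rewrite line_crossing_ge // mdec.
have [[j [jn bj]]|inc] := pselect (exists j, (j < n)%N /\ b j.+1 <= b j).
  have bumpl i : (i <= j)%N -> bump j.+1 i = i by rewrite /bump; lia.
  have bumpr i : (j < i)%N -> bump j.+1 i = i.+1 by rewrite /bump; lia.
  have bump_le i : (bump j.+1 i <= i.+1)%N by rewrite /bump; lia.
  (* The line of index [j.+1] is nowhere strictly below its two neighbours. *)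
  apply: (IH (fun i => m (bump j.+1 i)) (fun i => K (bump j.+1 i)))
    => [i ilt|i ile|x i Sx ile|x Sx].
  - case: (ltngtP i j) => ij.
    + by rewrite !bumpl //; [apply: mdec; lia|lia].
    + by rewrite !bumpr //; [apply: mdec; lia|lia].
    + rewrite bumpr ?bumpl //; [|lia|lia].
      rewrite ij; have m1 : m j.+1 < m j by apply: mdec; lia.
      by apply: lt_trans m1; apply: mdec; lia.
  - by apply: mP; apply: leq_trans (bump_le i) _.
  - by apply: Fle => //; apply: leq_trans (bump_le i) _.
  - have [i ile Fi] := Fin x Sx.
    case: (ltngtP i j.+1) => ij.
    + by exists i; [lia|rewrite bumpl].
    + by exists i.-1; [lia|rewrite bumpr ?prednK //; lia].
    + rewrite ij in Fi; have [xb|xb] := leP x (b j).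
        exists j; [lia|rewrite bumpl //; apply/eqP; rewrite eq_le Fle //=; last lia].
        by rewrite Fi bP //; lia.
      exists j.+1; [lia|rewrite bumpr //; apply/eqP; rewrite eq_le Fle //=].
      by rewrite Fi bP' //; apply/ltW/(le_lt_trans bj).
exists n.+1, (fun j => if j == 0%N then -oo%E else if (j <= n.+1)%N then (b j.-1)%:E
  else +oo%E), m.
have binc j : (j < n)%N -> b j < b j.+1.
  by move=> jn; rewrite ltNge; apply/negP => bj; apply: inc; exists j.
split => //; first by rewrite /= ltnn.
- move=> [|j] jn /=; first by rewrite ltNyr.
  rewrite jn; case: ifP => [jn'|_]; first by rewrite lte_fin binc.
  exact: ltry.
- move=> j x y jn Sx Sy xj yj.
  suff E z : S z -> ((if j == 0%N then -oo else
      if (j <= n.+1)%N then (b j.-1)%:E else +oo)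
    <= z%:E <= (if j.+1 == 0%N then -oo else
      if (j.+1 <= n.+1)%N then (b j.+1.-1)%:E else +oo))%E ->
      F z = line (m j) (K j) z by rewrite !E //; ring.
  move=> Sz /andP[zj jz]; have [i ile Fi] := Fin z Sz.
  apply/eqP; rewrite eq_le Fle //= Fi.
  (* Line j is compared with line i by chaining the comparisons of neighbours, each valid because z
     lies on the right side of all crossing points in between. *)
  have [ji|ij] := leqP j i.
    have [d iE] : exists d, i = (j + d)%N by exists (i - j)%N; lia.
    move: ile; rewrite iE => {Fi iE}; elim: d => [|d IHd] dn; first by rewrite addn0.
    rewrite addnS in dn *; apply: (le_trans (IHd _)); first by rewrite ltnW.
    have jn1 : (j < n.+1)%N by lia.
    have jb : z <= b j by move: jz; rewrite /= jn1 lee_fin.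
    rewrite bP //; apply: (le_trans jb); elim: d {IHd} dn => [|d IHd] dn.
      by rewrite addn0.
    by apply: le_trans (IHd _) _; rewrite ?addnS; [lia|apply/ltW/binc; lia].
  case: j jn xj yj zj jz ij => // j jn _ _ zj _ ij.
  have jb : b j <= z by move: zj; rewrite /= jn lee_fin.
  have down d : (d <= j)%N ->
      line (m j.+1) (K j.+1) z <= line (m (j - d)%N) (K (j - d)%N) z.
    elim: d => [|d IHd] dj; first by rewrite subn0 bP'.
    apply: (le_trans (IHd (ltnW dj))).
    have -> : (j - d = (j - d.+1).+1)%N by lia.
    rewrite bP'; last lia.
    apply: le_trans jb; move: (d.+1) dj => {IHd}d dj.
    elim: d dj => [|d IHd] dj; first by rewrite subn0.
    apply: le_trans (IHd (ltnW dj)); have -> : (j - d = (j - d.+1).+1)%N by lia.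
    by apply/ltW/binc; lia.
  have -> : i = (j - (j - i))%N by lia.
  by apply: down; lia.
Qed.

(** F is the minimum of its supporting lines. Points touched with the same slope share one line, so
    one line per k <= n is enough. The assumed element of P is the slope used when S is empty. *)
Lemma pl_supporting (e n : nat) : (exists m, P m) ->
  (forall x, S x -> exists k : nat, [/\ (k <= n)%N, P (k%:Z - e%:Z) &
     forall y, S y -> F y <= F x + (k%:R - e%:R) * (y - x)]) ->
  pl_decreasing_int_slopes P S F.
Proof.
move=> [m0 Pm0] H.
pose touch k x := [/\ S x, P (k%:Z - e%:Z) &
  forall y, S y -> F y <= F x + (k%:R - e%:R) * (y - x)].
pose u := rev [seq k <- iota 0 n.+1 | `[< exists x, touch k x >]].
have uP k : (k \in u) = (k <= n)%N && `[< exists x, touch k x >].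
  by rewrite mem_rev mem_filter mem_iota add0n ltnS leq0n andbC.
have u_sorted : sorted gtn u.
  by rewrite rev_sorted; apply: sorted_filter (iota_ltn_sorted _ _); exact: ltn_trans.
have slopeE k : ((k%:Z - e%:Z)%:~R : R) = k%:R - e%:R by rewrite rmorphB /= -!pmulrn.
case E : u => [|k0 u']; rewrite -?E.
  exists 0%N, (fun j => if j == 0%N then -oo%E else +oo%E), (fun=> m0); split => //.
  - by case.
  - move=> j x y _ Sx; have [k [kn Pk Hk]] := H x Sx.
    suff : k \in u by rewrite E.
    by rewrite uP kn; apply/asboolP; exists x.
have u_lt j : (j <= (size u).-1)%N -> (j < size u)%N by rewrite E.
pose pt k : R := xget 0 [set x | touch k x].
have ptP k : k \in u -> touch k (pt k).
  by rewrite uP => /andP[_ /asboolP ex]; apply: (@xgetPex _ 0 [set x | touch k x]).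
pose m j : int := (nth 0%N u j)%:Z - e%:Z.
apply: (@pl_min_lines (size u).-1 m
  (fun j => F (pt (nth 0%N u j)) - (m j)%:~R * pt (nth 0%N u j))).
- move=> j jn; rewrite /m ltrD2r ltz_nat.
  apply: (sorted_ltn_nth (fun a b c ab bc => ltn_trans bc ab) 0%N u_sorted) => //.
  + by rewrite inE; lia.
  + by rewrite inE E /= in jn *.
- by move=> j /u_lt /(mem_nth 0%N) /ptP[].
- move=> x j Sx /u_lt /(mem_nth 0%N) /ptP[_ _ /(_ x Sx)].
  by rewrite /m slopeE; lra.
- move=> x Sx; have [k [kn Pk Hk]] := H x Sx.
  have ku : k \in u by rewrite uP kn; apply/asboolP; exists x.
  exists (index k u); first by rewrite -ltnS prednK ?index_mem //; rewrite E.
  rewrite /m nth_index // slopeE; have [St _ tle] := ptP k ku.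
  by have := tle x Sx; have := Hk _ St; lra.
Qed.

End PiecewiseLinear.

(** * Explicit values of the level *)

(** Pigeonhole: k may depend on eps but takes finitely many values. If every k failed at some y_k,
    an eps below all the phi (y_k) would admit no k. *)
Lemma uniform_index (R : realType) (S : set R) (phi : R -> R) (n : nat)
    (Q : nat -> R -> Prop) :
  (forall y, S y -> 0 < phi y) ->
  (forall eps, 0 < eps -> exists2 k, (k <= n)%N &
     forall y, S y -> eps <= phi y -> Q k y) ->
  exists2 k, (k <= n)%N & forall y, S y -> Q k y.
Proof.
move=> Spos H; apply: contrapT => none.
have bad k : (k <= n)%N -> exists y, S y /\ ~ Q k y.
  move=> kn; apply: contrapT => good; apply: none; exists k => // y Sy.
  by apply: contrapT => nQ; apply: good; exists y.
have [eps [eps0 Heps]] : exists eps, 0 < eps /\ forall k, (k <= n)%N ->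
    exists y, [/\ S y, eps <= phi y & ~ Q k y].
  elim: {H none} n bad => [|n IH] bad.
    have [y [Sy nQ]] := bad 0%N (leqnn 0).
    exists (phi y); split; first exact: Spos.
    by move=> k; rewrite leqn0 => /eqP ->; exists y.
  have [eps [eps0 Heps]] := IH (fun k kn => bad k (leqW kn)).
  have [y [Sy nQ]] := bad n.+1 (leqnn _).
  exists (Num.min eps (phi y)); split; first by rewrite lt_min eps0 Spos.
  move=> k; rewrite leq_eqVlt => /predU1P[->|kn].
    by exists y; rewrite ge_min lexx orbT.
  have [y' [Sy' ey' nQ']] := Heps k kn; exists y'; split=> //.
  by rewrite ge_min ey'.
have [k kn HQ] := H eps eps0; have [y [Sy ey]] := Heps k kn.
by apply; exact: HQ.
Qed.

Lemma coef_XaddC_exp (A : comNzRingType) (c : A) n k :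
  (('X + c%:P) ^+ n)`_k = c ^+ (n - k) *+ 'C(n, k).
Proof.
rewrite addrC exprDn coef_sum.
under eq_bigr => i _ do rewrite coefMn -rmorphXn /= coefCM coefXn.
have [kn|nk] := ltnP k n.+1.
  rewrite (bigD1 (Ordinal kn)) //= eqxx mulr1 big1 ?addr0 // => i ik.
  rewrite (_ : (k == i) = false) ?mulr0 ?mul0rn //; apply/eqP => ki.
  by case/eqP: ik; apply: val_inj.
rewrite bin_small // mulr0n big1 // => i _.
by rewrite gtn_eqF ?mulr0 ?mul0rn // (leq_trans (ltn_ord i)).
Qed.

Lemma size_XaddC_exp (A : idomainType) (c : A) n : size (('X + c%:P) ^+ n) = n.+1.
Proof. by rewrite -[c]opprK polyCN size_exp_XsubC. Qed.

Section Values.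

Variables (R : realType) (L : closedFieldType) (w : L -> \bar R).
Hypothesis w_val : is_valuation w.
Variables (p : nat) (vp : R).
Hypotheses (p_prime : prime p) (vpE : vis w vp p%:R) (vp_gt0 : 0 < vp).

Implicit Types (b c d : R) (h q g : {poly L}).

Local Notation T := (tlevel p vp).
Local Notation tau := (best_level w p vp).

(** Here phi measures the distance from the critical depth [b0]. Each eps has its own q, hence its
    own supporting slope at x, valid where phi >= eps; [uniform_index] provides a slope valid on all
    of S. *)
Lemma pl_dominated (P : int -> Prop) (S : set R) (phi : R -> R) b0 V h e :
  (exists m, P m) ->
  (forall m, (m <= (size h).-1)%N -> ~~ (p %| m)%N -> P (m%:Z - e%:Z)) ->
  (forall b m, (m <= (size h).-1)%N -> m != e ->
     0 < phi b -> phi b <= (m%:R - e%:R) * (b - b0)) ->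
  gge w b0 V h -> vis w (V - e%:R * b0) h`_e ->
  (e = 0%N \/ e = (size h).-1) -> (p %| e)%N ->
  (forall b, S b -> 0 < phi b /\ tau b h <> T) ->
  pl_decreasing_int_slopes P S (fun b => tau b h).
Proof.
move=> exP HP Hphi hV he e0n pe HS.
apply: (@pl_supporting _ _ _ _ e (size h).-1) => // x Sx.
have [x0 xT] := HS x Sx.
have [||k kn Hk] := @uniform_index R S phi (size h).-1 (fun k y =>
    P (k%:Z - e%:Z) /\ tau y h <= tau x h + (k%:R - e%:R) * (y - x)).
- by move=> y /HS[].
- move=> eps eps0; have m0 : 0 < Num.min eps (phi x) by rewrite lt_min eps0.
  have [q sq Hq] := dominant_approx w_val p_prime vpE vp_gt0 hV he e0n pe m0.
  pose Rg := [set b | Num.min eps (phi x) <= phi b].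
  have [||m [pm mn Hm]] := @tau_supporting _ _ _ w_val _ _ p_prime vpE vp_gt0
      h q b0 V e Rg sq _ x _ xT.
  + move=> b Rb V'; apply: Hq => m mn me; apply: (le_trans Rb (Hphi b m mn me _)).
    exact: lt_le_trans m0 Rb.
  + by rewrite /Rg /= ge_min lexx orbT.
  exists m => // y Sy ey; split; first exact: HP.
  by apply: Hm; rewrite /Rg /= ge_min ey.
- exists k; split=> //; first by case: (Hk x Sx).
  by move=> y /Hk[].
Qed.

(** By Bézout 1 is a combination of n and p, so n cannot have positive value as p does. *)
Lemma vis_nat n : (0 < n < p)%N -> vis w 0 n%:R.
Proof.
move=> /andP[n0 np].
have unit v : 0 < v -> ~~ vge w v n%:R.
  move=> v0; apply/negP => nv; case: (egcdnP p n0) => km kn E _.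
  have cop : gcdn n p = 1%N.
    by apply/eqP; rewrite -/(coprime n p) coprime_sym prime_coprime // gtnNdvd.
  have one : km%:R * n%:R - kn%:R * p%:R = 1 :> L.
    by rewrite -!natrM E cop natrD addrC addKr.
  have m1 : Num.min v vp <= v by rewrite ge_min lexx.
  have m2 : Num.min v vp <= vp by rewrite ge_min lexx orbT.
  have := vgeB w_val (vgeM w_val (vge_nat w_val km) (vge_le m1 nv))
    (vgeM w_val (vge_nat w_val kn) (vge_le m2 (vis_vge vpE))).
  by rewrite one add0r (vis_vgeE _ (vis1 w_val)) leNgt lt_min v0 vp_gt0.
have [v vE] : exists v, vis w v n%:R.
  apply: (vis_exists w_val); apply/eqP => nE.
  by have := unit 1 ltr01; rewrite nE vge0.
have v0 : 0 <= v by rewrite -(vis_vgeE _ vE); exact: vge_nat.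
have [v1|v1] := ltP 0 v; first by have := unit v v1; rewrite vis_vge.
by rewrite /vis vE; congr EFin; apply/le_anti; rewrite v1.
Qed.

Lemma tau_value b V h q t m : gis w b V h -> (size q <= pth_size p h)%N ->
  0 <= t -> gge w b (V + t) (h - q ^+ p) -> ~~ (p %| m)%N ->
  vis w (V + t - m%:R * b) (h - q ^+ p)`_m -> tau b h = Num.min t T.
Proof.
move=> hV sq t0 ht pm hm; have [tT|Tt] := ltP t T.
  by apply: (tau_level w_val p_prime vpE vp_gt0 hV sq _ ht pm hm); rewrite t0.
by apply: (tau_max w_val p_prime vp_gt0 hV sq); apply: gge_le ht; lra.
Qed.

Lemma gge_subX b c d g h n : gge w b c g -> gge w b c h -> gge w b (c + d) (g - h) ->
  gge w b (n%:R * c + d) (g ^+ n - h ^+ n).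
Proof.
move=> G H GH; rewrite subrXX; case: n => [|n].
  by rewrite big_ord0 mulr0; exact: gge0.
have -> : n.+1%:R * c + d = (c + d) + n%:R * c by rewrite -natr1; ring.
apply: (ggeM w_val) => //; apply: gge_sum => // i _.
have i_n : (i <= n)%N by rewrite -ltnS.
have -> : n%:R * c = (n.+1.-1 - i)%:R * c + i%:R * c.
  by rewrite /= natrB //; ring.
by apply: (ggeM w_val); exact: ggeX.
Qed.

Lemma gis_const_dominant b V h : gge w b V h -> vis w V h`_0 -> gis w b V h.
Proof. by move=> hV h0; split=> //; exists 0%N; rewrite mul0r subr0. Qed.

Lemma not_dvd_prime_lt n : (0 < n < p)%N -> ~~ (p %| n)%N.
Proof. by move=> /andP[n0 np]; rewrite gtnNdvd. Qed.

(** Take q constant with q^p = A^m. The linear coefficient m A^(m - 1) of the error, with m a unit,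
    gives the level. *)
Lemma tau_one_root b be A m : (0 < m < p)%N -> vis w be A -> be < b ->
  tau b (('X + A%:P) ^+ m) = Num.min (b - be) T.
Proof.
move=> mp Abe beb; set h := ('X + A%:P) ^+ m.
have /andP[m0 m_lt] := mp.
have A0 := vis_neq0 w_val Abe.
have [g gE] := root_exists (A ^+ m) (prime_gt0 p_prime).
have XA : gge w b be ('X + A%:P).
  apply: (ggeD w_val); first by apply: gge_le (gge_polyX w_val b); exact: ltW.
  by apply: (ggeC w_val); exact: vis_vge.
have hV : gis w b (m%:R * be) h.
  apply: gis_const_dominant; first exact: ggeX.
  by rewrite coef_XaddC_exp subn0 bin0 mulr1n; exact: visX.
apply: (@tau_value b (m%:R * be) h g%:P (b - be) 1) => //.
- by rewrite (leq_trans (size_polyC_leq1 _)).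
- by lra.
- rewrite -rmorphXn /= gE rmorphXn; apply: gge_subX => //.
    by apply: (ggeC w_val); exact: vis_vge.
  by rewrite addrC subrK addrK; exact: gge_polyX.
- by apply: not_dvd_prime_lt; rewrite prime_gt1.
- rewrite -rmorphXn coefB coefC /= subr0 coef_XaddC_exp bin1.
  have := visM w_val (visX w_val (m - 1) Abe) (vis_nat mp).
  by congr vis; [rewrite natrB //; ring|rewrite mulr_natr].
Qed.

Lemma prime_pred_range : (0 < p.-1 < p)%N.
Proof. by have := prime_gt1 p_prime; case: (p) => [|[|k]] //= _; rewrite ltnSn. Qed.

(** Take q = X. The error X^m ((X + u)^n - X^n) contains n u X^(p - 1), with n a unit, and this
    monomial gives the level. *)
Lemma tau_two_roots_inside b be u m n : (0 < n)%N -> (m + n)%N = p -> (0 < m)%N ->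
  vis w be u -> b < be ->
  tau b ('X ^+ m * ('X + u%:P) ^+ n) = Num.min (be - b) T.
Proof.
move=> n0 mnp m0 ube bbe; set h := _ * _.
have n_lt : (0 < n < p)%N by rewrite n0 -mnp -[X in (X < _)%N]add0n ltn_add2r.
have Xu : gge w b b ('X + u%:P).
  apply: (ggeD w_val); first exact: gge_polyX.
  by apply: (ggeC w_val); apply: vge_le (vis_vge ube); exact: ltW.
have hmonic : h \is monic.
  by rewrite monicMl ?monic_exp ?monicX // -[u]opprK polyCN monicXsubC.
have hsize : size h = p.+1.
  rewrite size_monicM ?monic_exp ?monicX //; last first.
    by rewrite expf_neq0 // -size_poly_eq0 size_XaddC.
  by rewrite size_polyXn size_XaddC_exp -mnp addSn addnS.
have pE : p%:R = m%:R + n%:R :> R by rewrite -mnp natrD.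
have hV : gis w b (p%:R * b) h.
  split.
    by rewrite pE mulrDl; apply: (ggeM w_val); [exact: gge_polyXn|exact: ggeX].
  exists p; have -> : h`_p = 1 by apply/eqP; move: hmonic; rewrite monicE lead_coefE hsize.
  by rewrite subrr; exact: vis1.
have rhoE : h - 'X ^+ p = 'X ^+ m * (('X + u%:P) ^+ n - 'X ^+ n).
  by rewrite mulrBr -exprD mnp.
apply: (@tau_value b (p%:R * b) h 'X (be - b) p.-1) => //.
- by rewrite size_polyX /pth_size hsize /= divnn prime_gt0.
- by lra.
- rewrite rhoE pE mulrDl -addrA; apply: (ggeM w_val).
    by apply: (ggeX w_val); exact: gge_polyX.
  apply: gge_subX => //; first exact: gge_polyX.
  by rewrite [b + _]addrC subrK addrAC subrr add0r; apply: (ggeC w_val); exact: vis_vge.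
- by apply: not_dvd_prime_lt; exact: prime_pred_range.
- have -> : p.-1 = (m + n.-1)%N by rewrite -mnp -{1}(prednK n0) addnS.
  have coef_pred : (('X + u%:P) ^+ n - 'X ^+ n)`_n.-1 = u *+ n.
    rewrite coefB coef_XaddC_exp coefXn; case: (n) n0 => // k _ /=.
    by rewrite subSnn expr1 binSn ltn_eqF // subr0.
  rewrite rhoE coefXnM ltnNge leq_addr addKn coef_pred.
  have := visM w_val ube (vis_nat n_lt); congr vis; last by rewrite mulr_natr.
  by rewrite pE natrD -subn1 natrB //; ring.
Qed.

(** Replace X + B by (B / A) (X + A), which has the same constant term. As m + n = p, the product
    becomes (g (X + A))^p with g^p = (B / A)^n. The two factors differ by ((A - B) / A) X, and the
    level is read at exponent 1. *)
Lemma tau_two_roots_outside b A B be vA vB m n :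
  (0 < n)%N -> (m + n)%N = p -> (0 < m)%N ->
  vis w vA A -> vis w vB B -> vis w be (A - B) ->
  vA < b -> vB < b -> vB <= vA ->
  tau b (('X + A%:P) ^+ m * ('X + B%:P) ^+ n) = Num.min (be - vB + (b - vA)) T.
Proof.
move=> n0 mnp m0 AvA BvB ABbe Ab Bb BA; set h := _ * _.
have n_lt : (0 < n < p)%N by rewrite n0 -mnp -[X in (X < _)%N]add0n ltn_add2r.
have A0 := vis_neq0 w_val AvA; have B0 := vis_neq0 w_val BvB.
have beB : vB <= be.
  by rewrite -(vis_vgeE _ ABbe); apply: (vgeB w_val (vge_le BA (vis_vge AvA)) (vis_vge BvB)).
have XA c C : vis w c C -> c < b -> gge w b c ('X + C%:P).
  move=> Cc cb; apply: (ggeD w_val); first by apply: gge_le (gge_polyX w_val b); exact: ltW.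
  by apply: (ggeC w_val); exact: vis_vge.
have hV : gis w b (m%:R * vA + n%:R * vB) h.
  apply: gis_const_dominant.
    by apply: (ggeM w_val); apply: (ggeX w_val); exact: XA.
  rewrite coef0M !coef_XaddC_exp !subn0 !bin0 !mulr1n.
  by apply: (visM w_val); exact: visX.
have [g gE] := root_exists ((B / A) ^+ n) (prime_gt0 p_prime).
pose G := 'X + B%:P; pose H := (B / A) *: ('X + A%:P).
have ApE : ('X + A%:P) ^+ p = ('X + A%:P) ^+ m * ('X + A%:P) ^+ n by rewrite -exprD mnp.
have rhoE : h - (g *: ('X + A%:P)) ^+ p = ('X + A%:P) ^+ m * (G ^+ n - H ^+ n).
  by rewrite exprZn gE /H exprZn ApE mulrBr scalerAr.
have GHE : G - H = ((A - B) / A) *: 'X.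
  rewrite /G /H; apply/polyP => k.
  rewrite !(coefD, coefN, coefZ, coefX, coefC).
  by case: k => [|[|k]] /=; field.
have visBA : vis w (vB - vA) (B / A) by apply: (visM w_val) => //; exact: visV.
apply: (@tau_value b (m%:R * vA + n%:R * vB) h (g *: ('X + A%:P)) _ 1) => //.
- rewrite (leq_trans (size_scale_leq _ _)) // size_XaddC /pth_size.
  have -> : (size h).-1 = p; last by rewrite divnn prime_gt0.
  rewrite size_monicM; last first.
  + by rewrite expf_neq0 // -size_poly_eq0 size_XaddC.
  + by rewrite monic_exp // -[A]opprK polyCN monicXsubC.
  by rewrite !size_XaddC_exp -mnp addSn addnS.
- by lra.
- rewrite rhoE -addrA; apply: (ggeM w_val).
    by apply: (ggeX w_val); exact: XA.
  apply: gge_subX.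
  + exact: XA.
  + have -> : vB = (vB - vA) + vA by lra.
    by apply: (ggeZ w_val); [exact: vis_vge|exact: XA].
  + rewrite GHE; have -> : vB + (be - vB + (b - vA)) = (be - vA) + b by ring.
    apply: (ggeZ w_val); last exact: gge_polyX.
    by apply: vis_vge; apply: (visM w_val) => //; exact: visV.
- by apply: not_dvd_prime_lt; rewrite prime_gt1.
- have coef1 : (G ^+ n - H ^+ n)`_1 = B ^+ (n - 1) * n%:R * ((A - B) / A).
    rewrite coefB /H exprZn coefZ !coef_XaddC_exp bin1.
    have E : (B / A) ^+ n * A ^+ (n - 1) = B ^+ (n - 1) * (B / A).
      case: (n) n0 => // k _; rewrite subn1 /= exprSr mulrAC -exprMn.
      by rewrite divfK.
    rewrite [X in _ - X]mulrnAr E mulrBl divff //.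
    move: (B ^+ (n - 1)) (B / A) => x y.
    by rewrite mulr_natr mulrBr mulr1 mulrnAl.
  have coef0 : (G ^+ n - H ^+ n)`_0 = 0.
    rewrite coefB /H exprZn coefZ !coef_XaddC_exp !bin0 !subn0 !mulr1n.
    by rewrite expr_div_n divfK ?subrr // expf_neq0.
  rewrite rhoE coefM big_ord_recl big_ord1 /= coef1 coef0 mulr0 addr0.
  rewrite coef_XaddC_exp subn0 bin0 mulr1n.
  have := visM w_val (visX w_val m AvA) (visM w_val (visM w_val (visX w_val (n - 1) BvB)
    (vis_nat n_lt)) (visM w_val ABbe (visV w_val AvA))).
  by congr vis; rewrite natrB //; ring.
Qed.

End Values.

(** * Discs *)

Definition real_val (R : realType) (F : fieldType) (v : F -> \bar rat) (x : F) :
  \bar R := er_map (ratr : rat -> R) (v x).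

Lemma er_map_ratr_le (R : realType) (x y : \bar rat) :
  (er_map (ratr : rat -> R) x <= er_map ratr y)%E = (x <= y)%E.
Proof.
case: x y => [x| |] [y| |]; rewrite ?leey ?leNye //= ?lee_fin ?ler_rat //.
all: by rewrite ?leye_eq ?leeNy_eq.
Qed.

Lemma real_val_valuation (R : realType) (F : fieldType) (v : F -> \bar rat) :
  is_valuation v -> is_valuation (real_val R v).
Proof.
move=> v_val; split=> [x|x|x y|x y]; rewrite /real_val.
- by have := val_neqNy v_val x; case: (v x).
- rewrite -(val_eqy v_val x); split=> [|->//].
  by case: (v x).
- rewrite (Defs.valM v_val); have := val_neqNy v_val x; have := val_neqNy v_val y.
  by case: (v x) (v y) => [a| |] [b| |] //= _ _; rewrite rmorphD.
- have := Defs.valD v_val x y; rewrite !ge_min.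
  by rewrite !er_map_ratr_le.
Qed.

Lemma vis_real_val (R : realType) (F : fieldType) (v : F -> \bar rat) s x :
  v x = s%:E -> vis (real_val R v) (ratr s) x.
Proof. by rewrite /vis /real_val => ->. Qed.

Section Discs.

Variables (R : realType) (L C : fieldType) (psi : {rmorphism L -> C}).
Variables (vL : L -> \bar rat) (vC : C -> \bar rat).
Hypothesis vL_val : is_valuation vL.
Hypothesis C_completion : is_completion psi vL vC.
Hypothesis vL_surj : forall s : rat, exists x, vL x = s%:E.

Local Notation wL := (real_val R vL).
Local Notation wC := (real_val R vC).
Local Notation disc := (disc R vC).
Local Notation berk := (berk R vC).
Local Notation cd a b := (closed_disc vC (psi a) (b : R)).
Local Notation md a b := (mkdisc vC (psi a) (b : R)).

Implicit Types (a z : L) (b s : R) (D E : disc).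

Lemma wL_val : is_valuation wL.
Proof. exact: real_val_valuation. Qed.

Lemma wC_val : is_valuation wC.
Proof. by case: C_completion => vC_val _ _ _; exact: real_val_valuation. Qed.

Lemma wC_psi x : wC (psi x) = wL x.
Proof. by case: C_completion => _ H _ _; rewrite /real_val H. Qed.

Lemma vge_psi b x : vge wC b (psi x) = vge wL b x.
Proof. by rewrite /vge wC_psi. Qed.

Lemma closed_discE (c : C) b y : closed_disc vC c b y = vge wC b (y - c).
Proof. by []. Qed.

Lemma closed_disc_psi a b z : closed_disc vC (psi a) b (psi z) = vge wL b (z - a).
Proof. by rewrite closed_discE -rmorphB vge_psi. Qed.

Lemma rat_value (x y : R) : x < y -> exists s (c : L), [/\ x < s, s < y & vis wL s c].
Proof.
move=> xy; have [q] := @rat_in_itvoo R x y xy.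
rewrite in_itv /= => /andP[xq qy]; have [c cE] := vL_surj q.
by exists (ratr q), c; split => //; exact: vis_real_val.
Qed.

(** The density of the value group forces b' <= b: otherwise c plus an element of value strictly
    between b and b' would lie in the first disc only. *)
Lemma closed_disc_sub (c c' : C) b b' :
  closed_disc vC c b `<=` closed_disc vC c' b' <-> b' <= b /\ vge wC b' (c - c').
Proof.
split=> [H|[bb cc] y]; last first.
  rewrite !closed_discE => yc; have -> : y - c' = (y - c) + (c - c') by ring.
  by apply: (vgeD wC_val) => //; apply: vge_le yc.
have cc : vge wC b' (c - c').
  by have := H c; rewrite !closed_discE subrr; apply; exact: vge0 wC_val _.
split => //; rewrite leNgt; apply/negP => bb.
have [s [x [bs sb' xs]]] := rat_value bb.
have /H : closed_disc vC c b (c + psi x).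
  by rewrite closed_discE addrAC subrr add0r vge_psi (vis_vgeE _ xs) ltW.
rewrite closed_discE => cx; have := vgeB wC_val cx cc.
have -> : c + psi x - c' - (c - c') = psi x by ring.
by rewrite vge_psi (vis_vgeE _ xs) leNgt sb'.
Qed.

Lemma disc_eq D E : disc_set D = disc_set E -> depth D = depth E -> D = E.
Proof.
case: D E => [S b e] [S' b' e'] /= SS bb; subst.
by congr Disc; exact: Prop_irrelevance.
Qed.

Lemma disc_sub_depth D E : disc_set D `<=` disc_set E -> depth E <= depth D.
Proof.
have [c ->] := disc_ex D; have [c' ->] := disc_ex E.
by move=> /closed_disc_sub[].
Qed.

Lemma disc_set_inj D E : disc_set D = disc_set E -> D = E.
Proof.
move=> DE; apply: disc_eq => //; apply/eqP.
by rewrite eq_le !disc_sub_depth ?DE.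
Qed.

Lemma mkdisc_eqP a a' b b' : md a b = md a' b' <-> b = b' /\ vge wL b (a - a').
Proof.
split=> [E|[-> aa]].
  have bb : b = b' by have := congr1 (@depth _ _ _) E.
  have : cd a b `<=` cd a' b' by have /= -> := congr1 (@disc_set _ _ _) E.
  by move=> /closed_disc_sub[_]; rewrite -rmorphB vge_psi bb.
apply: disc_set_inj => /=; apply/seteqP; split; apply/closed_disc_sub;
  rewrite lexx -rmorphB vge_psi; split=> //.
by rewrite vge_sub //; exact: wL_val.
Qed.

(** L is dense in C, so discs can be handled through centres in L. *)
Lemma disc_center_exists D : exists a, D = md a (depth D).
Proof.
case: D => S b [c Sc] /=.
have [q _ bq] : exists2 q : rat, True & b <= ratr q.
  have [q] := @rat_in_itvoo R b (b + 1) ltac:(lra).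
  by rewrite in_itv /= => /andP[bq _]; exists q => //; exact: ltW.
case: C_completion => _ _ _ /(_ c q)[a ca]; exists a.
have cab : vge wC b (c - psi a).
  apply: (@vge_le _ _ _ (ratr q)) => //.
  by rewrite /vge /real_val -[(ratr q)%:E]/(er_map ratr q%:E) er_map_ratr_le.
apply: disc_set_inj; rewrite /= Sc; apply/seteqP; split; apply/closed_disc_sub;
  split=> //.
by rewrite vge_sub //; exact: wC_val.
Qed.

Lemma disc_of_point D z : disc_set D (psi z) -> D = md z (depth D).
Proof.
have [a aE] := disc_center_exists D.
rewrite {1}aE /= closed_disc_psi {2}aE => H.
by rewrite {1}aE; apply/mkdisc_eqP; split=> //; rewrite vge_sub //; exact: wL_val.
Qed.

Lemma leBH D E : leB (TypeH D) (TypeH E) <-> disc_set D `<=` disc_set E.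
Proof.
split=> [H x Dx|H _ [x Dx <-]]; last by exists x => //; exact: H.
by have [|y Ey [<-]] := H (Some x); first by exists x.
Qed.

Lemma leB_mkdisc a a' b b' :
  leB (TypeH (md a b)) (TypeH (md a' b')) <-> b' <= b /\ vge wL b' (a - a').
Proof. by rewrite leBH /= closed_disc_sub -rmorphB vge_psi. Qed.

Lemma leB_pointH (z : C) D : leB (TypeI (Some z)) (TypeH D) <-> disc_set D z.
Proof.
split=> [/(_ (Some z) erefl)[y Dy [<-]] //|Dz _ ->]; by exists z.
Qed.

Lemma leB_Hpoint (z : C) D : ~ leB (TypeH D) (TypeI (Some z)).
Proof.
have [a ->] := disc_center_exists D => H.
have [s [x [bs _ xs]]] := @rat_value (depth D) (depth D + 1) ltac:(lra).
have point x' : vge wL (depth D) x' -> psi (a + x') = z.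
  move=> xd; suff /H [] : region (TypeH (md a (depth D))) (Some (psi (a + x'))) by [].
  by exists (psi (a + x')) => //=; rewrite closed_disc_psi addrAC subrr add0r.
have := point 0 (vge0 wL_val _); rewrite addr0 => az.
have := point x; rewrite (vis_vgeE _ xs) ltW // -az => /(_ isT) /fmorph_inj /eqP.
by rewrite addrC -subr_eq0 addrK (negPf (vis_neq0 wL_val xs)).
Qed.

Lemma leB_infty (x : berk) : leB (TypeI None) x -> x = TypeI None.
Proof.
case: x => [[z|]//|D] H; first by have := H None I.
by have [] := H None I.
Qed.

Lemma leB_anti (x y : berk) : leB x y -> leB y x -> x = y.
Proof.
case: x y => [[z|]|D] [[z'|]|E] //.
- by move=> /(_ (Some z) erefl) [->].
- by move=> _ /leB_infty.
- by move=> _ /leB_Hpoint.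
- by move=> /leB_infty.
- by move=> /leB_infty.
- by move=> /leB_Hpoint.
- by move=> _ /leB_infty.
- by move=> /leBH H /leBH H'; congr TypeH; apply: disc_set_inj; apply/seteqP.
Qed.

Lemma is_join_unique (x y J J' : berk) : is_join x y J -> is_join x y J' -> J = J'.
Proof. by move=> [? ? m] [? ? m']; apply: leB_anti; [exact: m|exact: m']. Qed.

(** Here c is the minimum of b, b' and v(a - a'), given by its universal property so that a = a', of
    infinite value, is not a separate case. *)
Lemma is_join_discs a a' b b' c : c <= b -> c <= b' -> vge wL c (a - a') ->
  (forall d, d <= b -> d <= b' -> vge wL d (a - a') -> d <= c) ->
  is_join (TypeH (md a b)) (TypeH (md a' b')) (TypeH (md a c)).
Proof.
move=> cb cb' ca cmax; split.
- by apply/leB_mkdisc; rewrite subrr; split=> //; exact: vge0 wL_val _.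
- by apply/leB_mkdisc; split=> //; rewrite vge_sub //; exact: wL_val.
- move=> [[z|]//|E]; first by move=> /leB_Hpoint.
  have [e ->] := disc_center_exists E => /leB_mkdisc[eb ea] /leB_mkdisc[eb' ea'].
  apply/leB_mkdisc; split=> //; apply: cmax => //.
  have -> : a - a' = (a - e) - (a' - e) by ring.
  exact: (vgeB wL_val).
Qed.

Lemma join_depth_exists a a' b b' : exists c,
  [/\ c <= b, c <= b', vge wL c (a - a') &
    forall d, d <= b -> d <= b' -> vge wL d (a - a') -> d <= c].
Proof.
pose m := Num.min b b'.
have m1 : m <= b by rewrite ge_min lexx.
have m2 : m <= b' by rewrite ge_min lexx orbT.
have [->|aa] := eqVneq a a'.
  exists m; split => //; first by rewrite subrr; exact: vge0 wL_val _.
  by move=> d db db' _; rewrite le_min db.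
have [s sE] : exists s, vis wL s (a - a') by apply: (vis_exists wL_val); rewrite subr_eq0.
exists (Num.min m s); split.
- by rewrite ge_min m1.
- by rewrite ge_min m2.
- by rewrite (vis_vgeE _ sE) ge_min lexx orbT.
- by move=> d db db'; rewrite (vis_vgeE _ sE) !le_min db db'.
Qed.

Lemma deltaE a a' b b' c : c <= b -> c <= b' -> vge wL c (a - a') ->
  (forall d, d <= b -> d <= b' -> vge wL d (a - a') -> d <= c) ->
  delta (md a b) (md a' b') = (b - c) + (b' - c).
Proof.
move=> cb cb' ca cmax; have J := is_join_discs cb cb' ca cmax.
rewrite /delta /disc_join.
case: xgetP => [E -> JE|/(_ (md a c))//].
by have [<-] := is_join_unique J JE.
Qed.

Lemma delta_same a b b' : delta (md a b) (md a b') = `|b - b'|.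
Proof.
have [bb|bb] := leP b b'.
  rewrite (@deltaE _ _ _ _ b) //; first by rewrite distrC ger0_norm; lra.
  by rewrite subrr; exact: vge0 wL_val _.
rewrite (@deltaE _ _ _ _ b') //; first by rewrite ger0_norm; lra.
- exact: ltW.
- by rewrite subrr; exact: vge0 wL_val _.
Qed.

Lemma delta_ge0 D E : 0 <= delta D E.
Proof.
have [a ->] := disc_center_exists D; have [a' ->] := disc_center_exists E.
have [c [cb cb' ca cmax]] := join_depth_exists a a' (depth D) (depth E).
by rewrite (deltaE cb cb' ca cmax); lra.
Qed.

Lemma delta_eq0 D E : delta D E = 0 -> D = E.
Proof.
have [a ->] := disc_center_exists D; have [a' ->] := disc_center_exists E.
have [c [cb cb' ca cmax]] := join_depth_exists a a' (depth D) (depth E).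
rewrite (deltaE cb cb' ca cmax) => d0; apply/mkdisc_eqP.
by split; [lra|apply: vge_le ca; lra].
Qed.

Lemma delta_refl D : delta D D = 0.
Proof. by have [a ->] := disc_center_exists D; rewrite delta_same subrr normr0. Qed.

End Discs.

(** * The tree spanned by the branch points *)

Section Tree.

Variables (R : realType) (L : closedFieldType) (C : fieldType).
Variables (psi : {rmorphism L -> C}) (vL : L -> \bar rat) (vC : C -> \bar rat).
Hypothesis vL_val : is_valuation vL.
Hypothesis C_completion : is_completion psi vL vC.
Hypothesis vL_surj : forall s : rat, exists x, vL x = s%:E.

Local Notation wL := (real_val R vL).
Local Notation wC := (real_val R vC).
Local Notation disc := (disc R vC).
Local Notation berk := (berk R vC).
Local Notation md a b := (mkdisc vC (psi a) (b : R)).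
Local Notation eta := (@eta R L C psi vC).
Local Notation wLv := (wL_val R vL_val).
Local Notation wCv := (wC_val R C_completion).
Local Notation is_joinU := (is_join_unique vL_val C_completion vL_surj).

Implicit Types (a z : L) (b s : R) (D E : disc) (x : berk) (A : set (option L)).

Lemma open_path_sym (x y z : berk) : open_path x y z -> open_path y x z.
Proof.
move=> [[J [xJ yJ Jm] [zJ xyz]] nz]; split.
  by exists J; [split=> // w' yw xw; exact: Jm|split=> //; case: xyz; [right|left]].
by move=> [zy|zx]; apply: nz; [right|left].
Qed.

Lemma mkdisc_contains a b : leB (eta (Some a)) (TypeH (md a b)).
Proof. by apply/leB_pointH; rewrite /= closed_discE subrr; exact: vge0 wCv _. Qed.

Lemma above_point a x : leB (eta (Some a)) x -> x <> eta (Some a) ->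
  x <> TypeI None -> exists b, x = TypeH (md a b).
Proof.
case: x => [[z|]|D] // H ne _; last first.
  exists (depth D); congr TypeH; move/leB_pointH: H.
  exact: (disc_of_point vL_val C_completion vL_surj).
by have [za] := H (Some (psi a)) erefl; case: ne; rewrite /Defs.eta /= za.
Qed.

Lemma open_path_infty a x :
  open_path (eta (Some a)) (eta None) x <-> exists b, x = TypeH (md a b).
Proof.
split=> [[[J _ [_ [ax|/leB_infty xE]]] nx]|[b ->]].
- by apply: above_point => // xE; apply: nx; [left|right].
- by case: nx; right.
- split; last by case.
  exists (TypeI None); last by split=> //; left; exact: mkdisc_contains.
  by split=> // y _ /leB_infty ->.
Qed.

Lemma is_join_points a a' c : vis wL c (a - a') ->
  is_join (eta (Some a)) (eta (Some a')) (TypeH (md a c)).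
Proof.
move=> ac; split; first exact: mkdisc_contains.
  apply/leB_pointH; rewrite /= (closed_disc_psi C_completion) vge_sub; last exact: wLv.
  exact: vis_vge ac.
move=> [[z|]|E] // az a'z.
  have := az (Some (psi a)) erefl; have := a'z (Some (psi a')) erefl => -[] <- [].
  move=> /fmorph_inj aa; have := vis_neq0 wLv ac.
  by rewrite aa subrr eqxx.
move/leB_pointH: az => /(disc_of_point vL_val C_completion vL_surj) EE.
move/leB_pointH: a'z; rewrite EE /= (closed_disc_psi C_completion) vge_sub; last exact: wLv.
rewrite (vis_vgeE _ ac) => cE; apply/(leB_mkdisc C_completion vL_surj).
by rewrite subrr; split=> //; exact: vge0 wLv _.
Qed.

Lemma open_path_points a a' c x : vis wL c (a - a') ->
  open_path (eta (Some a)) (eta (Some a')) x <->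
  exists b, c <= b /\ (x = TypeH (md a b) \/ x = TypeH (md a' b)).
Proof.
move=> ac; have J := is_join_points ac; split.
  move=> [[J' J'j [xJ ax]] nx].
  rewrite (is_joinU J'j J) in xJ.
  have xN : x <> TypeI None by move=> xE; rewrite xE in xJ; have := leB_infty xJ.
  have below a0 b : leB (TypeH (md a0 b)) (TypeH (md a c)) -> c <= b.
    by move=> /(leB_mkdisc C_completion vL_surj)[].
  case: ax => ax.
    have [b xE] : exists b, x = TypeH (md a b).
      by apply: above_point => // xE; apply: nx; left.
    by exists b; split; [rewrite xE in xJ; exact: below xJ|left].
  have [b xE] : exists b, x = TypeH (md a' b).
    by apply: above_point => // xE; apply: nx; right.
  by exists b; split; [rewrite xE in xJ; exact: below xJ|right].
move=> [b [cb xE]]; split; last by case: xE => ->; case.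
exists (TypeH (md a c)) => //; split.
  case: xE => ->; apply/(leB_mkdisc C_completion vL_surj); split=> //.
    by rewrite subrr; exact: vge0 wLv _.
  by rewrite vge_sub; [exact: vis_vge ac|exact: wLv].
by case: xE => ->; [left|right]; exact: mkdisc_contains.
Qed.

(** Says that the path from z to w passes through the disc of depth b around z. *)
Definition separated_at b z (w : option L) : Prop :=
  if w is Some z' then z' <> z /\ ~~ (b%:E < wL (z - z')%R)%E else True.

Lemma SigmaP A x : Sigma psi A x <-> exists z b,
  [/\ A (Some z), x = TypeH (md z b) & exists2 w, A w & separated_at b z w].
Proof.
have sepP b z z' c : vis wL c (z - z') -> c <= b -> separated_at b z (Some z').
  move=> zc cb; split; last by rewrite zc lte_fin -leNgt.
  by move=> zz; have := vis_neq0 wLv zc; rewrite zz subrr eqxx.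
split.
  move=> [u [v [Au Av uv]]]; wlog uS : u v Au Av uv / exists z, u = Some z.
    move=> H; case: u Au uv => [z|] Au uv; first by apply: (H (Some z) v) => //; exists z.
    case: v Av uv => [z|] Av uv; last by case: uv.
    by move=> /open_path_sym; apply: (H (Some z) None) => //; exists z.
  have [z uz] := uS; rewrite uz in Au uv *; case: v Av uv => [z'|] Av uv.
    have [c zc] : exists c, vis wL c (z - z').
      by apply: (vis_exists wLv); rewrite subr_eq0; apply/eqP => zz; rewrite zz in uv.
    move=> /(open_path_points _ zc)[b [cb [->|->]]].
      by exists z, b; split => //; exists (Some z') => //; exact: sepP cb.
    exists z', b; split => //; exists (Some z) => //; apply: sepP cb.
    by rewrite -opprB; exact: (visN wLv).
  by move=> /open_path_infty[b ->]; exists z, b; split => //; exists None.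
move=> [z [b [Az -> [[z'|] Aw /= zw]]]]; last first.
  exists (Some z), None; split => //; apply/open_path_infty.
  by exists b.
have [zz zb] := zw; have [c zc] : exists c, vis wL c (z - z').
  by apply: (vis_exists wLv); rewrite subr_eq0; apply/eqP => zE; apply: zz.
exists (Some z), (Some z'); split => //; first by case=> zE; apply: zz.
apply/(open_path_points _ zc); exists b; split; last by left.
by move: zb; rewrite zc lte_fin -leNgt.
Qed.

Lemma path_connected a (I : set R) : connected I ->
  connected [set TypeH (md a b) | b in I].
Proof.
move=> Ic; apply: (connected_continuous_connected Ic).
apply/continuous_subspaceT/continuousP => O [Oopen _ _].
rewrite openE => b /= /Oopen[e e0 He]; apply/nbhs_ballP; exists e => //= b'.
rewrite /ball /= => bb; apply: He; rewrite (delta_same vL_val C_completion vL_surj) //.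
Qed.

Lemma connected_le (c : R) : connected [set b | b <= c].
Proof.
apply/connected_intervalP => x y xc yc b /andP[_ bc]; exact: le_trans yc.
Qed.

Lemma connected_ge (c : R) : connected [set b | c <= b].
Proof.
apply/connected_intervalP => x y xc yc b /andP[bc _]; exact: le_trans bc.
Qed.

Lemma TypeH_inj D E : TypeH D = TypeH E -> D = E.
Proof. by case. Qed.

Lemma TypeH_depth D E : TypeH D = TypeH E -> depth D = depth E.
Proof. by move=> /TypeH_inj ->. Qed.

(* The direction at [md a b] towards [a]. *)
Definition branch a b : set berk := [set x | match x with
  | TypeH E => b < depth E /\ forall y, disc_set E y -> (b%:E < wC (y - psi a)%R)%E
  | TypeI (Some y) => (b%:E < wC (y - psi a)%R)%E
  | TypeI None => False
  end].

Lemma lt_val_sub (F : fieldType) (w : F -> \bar R) (x y z : F) b :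
  is_valuation w ->
  (b%:E < w (x - y)%R)%E -> (b%:E < w (y - z)%R)%E -> (b%:E < w (x - z)%R)%E.
Proof.
move=> wv xy yz; have -> : x - z = (x - y) + (y - z) by ring.
by apply: lt_le_trans (Defs.valD wv _ _); rewrite lt_min xy.
Qed.

Lemma lt_valN (F : fieldType) (w : F -> \bar R) (x y : F) b :
  is_valuation w -> (b%:E < w (x - y)%R)%E = (b%:E < w (y - x)%R)%E.
Proof. by move=> wv; rewrite -opprB (valN wv). Qed.

Lemma vge_lt_val (F : fieldType) (w : F -> \bar R) (x : F) b c :
  b < c -> vge w c x -> (b%:E < w x)%E.
Proof. by move=> bc; apply: lt_le_trans; rewrite lte_fin. Qed.

Lemma branch_mkdisc a b a' s :
  branch a b (TypeH (md a' s)) <-> b < s /\ (b%:E < wL (a' - a)%R)%E.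
Proof.
split=> [[bs H]|[bs H]].
  split=> //; have := H (psi a'); rewrite -rmorphB (wC_psi R C_completion); apply.
  by rewrite /= closed_discE subrr; exact: vge0 wCv _.
split=> // y /= ya; apply: (@lt_val_sub _ _ _ (psi a')) => //; first exact: wCv.
  exact: vge_lt_val ya.
by rewrite -rmorphB (wC_psi R C_completion).
Qed.

Lemma branch_open a b : open (branch a b).
Proof.
split=> [D|y ya|//].
- have [d ->] := disc_center_exists C_completion vL_surj D.
  move=> /branch_mkdisc[bs ad]; exists (depth D - b); first by rewrite subr_gt0.
  move=> E; have [e ->] := disc_center_exists C_completion vL_surj E.
  have [c [c1 c2 cde cm]] := join_depth_exists vL_val d e (depth D) (depth E).
  rewrite (deltaE vL_val C_completion vL_surj c1 c2 cde cm) => lt.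
  apply/branch_mkdisc; split; first lra.
  apply: (lt_val_sub wLv _ ad); rewrite (lt_valN _ _ _ wLv).
  by apply: vge_lt_val cde; lra.
- exists (b + 1) => s bs; split=> /=; first lra.
  move=> x /= xy; apply: (lt_val_sub wCv _ ya).
  by apply: vge_lt_val xy; lra.
Qed.

(** A branch is thus open and closed relative to any set avoiding its vertex, so a connected set
    that avoids the vertex and meets the branch stays in it. *)
Lemma branch_closed a b : closed (branch a b `|` [set TypeH (md a b)]).
Proof.
rewrite -[X in closed X]setCK; apply: open_closedC; split=> [D|y ya|_ y].
- have [d DE] := disc_center_exists C_completion vL_surj D.
  move=> Dn; exists (delta D (md a b)).
    rewrite lt_neqAle (delta_ge0 vL_val C_completion vL_surj) andbT eq_sym.
    apply/eqP => /(delta_eq0 vL_val C_completion vL_surj) Dab.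
    by apply: Dn; right; rewrite Dab.
  move=> E lt [EV|/TypeH_inj EE]; last by rewrite EE ltxx in lt.
  move: EV lt; have [e ->] := disc_center_exists C_completion vL_surj E.
  move=> /branch_mkdisc[bE ea].
  have [c [c1 c2 cde cm]] := join_depth_exists vL_val d e (depth D) (depth E).
  have [c' [c1' c2' cda cm']] := join_depth_exists vL_val d a (depth D) b.
  rewrite DE (deltaE vL_val C_completion vL_surj c1 c2 cde cm).
  rewrite (deltaE vL_val C_completion vL_surj c1' c2' cda cm') => lt.
  have [cb|bc] := leP c b.
    suff : c <= c' by lra.
    apply: cm' => //; have -> : d - a = (d - e) + (e - a) by ring.
    apply: (vgeD wLv) => //; apply: ltW.
    by apply: le_lt_trans ea; rewrite lee_fin.
  apply: Dn; left; rewrite DE; apply/branch_mkdisc; split; first lra.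
  by apply: (lt_val_sub wLv _ ea); apply: vge_lt_val cde.
- exists (b + 1) => s bs [[_ /(_ y)]|].
    rewrite /= closed_discE subrr => /(_ (vge0 wCv _)) yb.
    by apply: ya; left.
  by move=> /TypeH_depth /= sb; lra.
- exists (b - 1) => s bs [[/= sb _]|]; first lra.
  by move=> /TypeH_depth /= sb; lra.
Qed.

Variable f : {poly L}.
Local Notation B := (branch_set f).
Local Notation SB := (Sigma psi B : set berk).

Lemma SigmaB x : SB x <-> exists z b, root f z /\ x = TypeH (md z b).
Proof.
split=> [/SigmaP[z [b [Bz -> _]]]|[z [b [fz ->]]]]; first by exists z, b.
by apply/SigmaP; exists z, b; split=> //; exists None.
Qed.

Lemma limit_point_nbhd (U : set berk) x (O : set berk) :
  limit_point U x -> open O -> O x -> U `&` O !=set0.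
Proof.
move=> Ux Oo Ox; have [|y [_ Uy Oy]] := Ux O; last by exists y.
by apply: open_nbhs_nbhs.
Qed.

(** A component without infinity as a limit lies in one downward branch at D, and every root in that
    residue class is reached from it. *)
Lemma component_limits D U : is_component (SB `\ TypeH D) U ->
  ~ limit_point U (eta None) -> exists z,
  disc_set D (psi z) /\ limits_in_branch_set psi f U =
  [set u : option L | exists a, [/\ u = Some a, root f a & ((depth D)%:E < wL (a - z)%R)%E]].
Proof.
set b := depth D => -[x [SBx xD] UE] noinf.
have [z [s [fz xE]]] := (SigmaB x).1 SBx.
have path_sub z' t I : root f z' -> connected I -> I t ->
    (forall t', I t' -> TypeH (md z' t') <> TypeH D) ->
    [set TypeH (md z' t') | t' in I] `<=`
      connected_component (SB `\ TypeH D) (TypeH (md z' t)).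
  move=> fz' Ic It ID; apply: connected_component_max.
  - by exists t.
  - move=> _ [t' It' <-]; split; last exact: ID.
    by apply/SigmaB; exists z', t'.
  - exact: path_connected.
(* If x is not strictly below D, the larger discs around z avoid D and climb to infinity. *)
have [[zD bs]|out] := pselect (disc_set D (psi z) /\ b < s); last first.
  exfalso; apply: noinf => O; rewrite nbhsE => -[W [[Oo1 Oo2 Oo3] Winf] OO].
  have [N HN] := Oo3 Winf (psi z); exists (TypeH (md z (Num.min N s))).
  split; [by apply/eqP| |by apply: OO; apply: HN; rewrite ge_min lexx].
  rewrite UE xE; apply: (path_sub z s [set t | t <= s]) => //.
  - exact: connected_le.
  - by rewrite /= lexx.
  - move=> t ts /TypeH_inj tD; apply: out; have zD : disc_set D (psi z).
      by rewrite -tD /= closed_discE subrr; exact: vge0 wCv _.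
    split=> //; rewrite lt_neqAle; apply/andP; split.
      apply/eqP => bs; apply: xD; rewrite xE; congr TypeH.
      by rewrite -bs /b; exact/esym/(disc_of_point vL_val C_completion vL_surj).
    by rewrite /b -tD /=.
  - by exists (Num.min N s) => //=; rewrite ge_min lexx orbT.
have DE : D = md z b := disc_of_point vL_val C_completion vL_surj zD.
have Ux : U x by rewrite UE; apply: connected_component_refl.
have UV : U `<=` branch z b.
  have Vx : branch z b x.
    rewrite xE; apply/branch_mkdisc; split=> //.
    by rewrite subrr (val0 wLv) ltry.
  have <- : U `&` branch z b = U.
    have Uc : connected U by rewrite UE; exact: component_connected.
    apply: Uc.
    - by exists x.
    - by exists (branch z b) => //; exact: branch_open.
    - exists (branch z b `|` [set TypeH (md z b)]); first exact: branch_closed.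
      apply/seteqP; split=> y [Uy Vy]; split=> //; first by left.
      case: Vy => // yE; rewrite UE in Uy; have [_] := connected_component_sub Uy.
      by move=> nD; case: nD; rewrite DE.
  by move=> y [].
exists z; split=> //; apply/seteqP; split=> [u [Bu Uu]|_ [a [-> fa az]]].
  case: u Bu Uu => [a|] fa Ua; last by case: noinf.
  exists a; split=> //; rewrite ltNge; apply/negP => az.
  have [||y [/UV Vy nV]] := @limit_point_nbhd U (eta (Some a))
      (~` (branch z b `|` [set TypeH (md z b)])) Ua.
  - by apply: closed_openC; exact: branch_closed.
  - case=> // /=; rewrite -rmorphB (wC_psi R C_completion).
    by rewrite ltNge az.
  - by apply: nV; left.
split=> // O; rewrite nbhsE => -[W [[Oo1 Oo2 Oo3] Wa] OO].
have [N HN] := Oo2 (psi a) Wa.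
(* At depth c the discs around z and a coincide and are still strictly inside D: the path climbs
   from x to there and descends towards a. *)
have [c [bc cs ca]] : exists c, [/\ b < c, c <= s & vge wL c (a - z)].
  have [c bc ca] : exists2 c, b < c & vge wL c (a - z).
    have [->|/(vis_exists wLv)[c ac]] := eqVneq (a - z) 0.
      by exists (b + 1); [lra|exact: vge0 wLv _].
    by exists c; [move: az; rewrite ac lte_fin|exact: vis_vge].
  exists (Num.min c s); split; first by rewrite lt_min bc.
    by rewrite ge_min lexx orbT.
  by apply: vge_le ca; rewrite ge_min lexx.
have avoid z' t : c <= t -> TypeH (md z' t) <> TypeH D.
  by move=> ct /TypeH_depth /= tb; move: bc; rewrite /b -tb; lra.
exists (TypeH (md a (Num.max N c))).
split; [by apply/eqP| |by apply: OO; apply: HN; rewrite le_max lexx].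
rewrite UE; apply: (@connected_component_trans _ _ (TypeH (md z c))).
  rewrite xE; apply: (path_sub z s [set t | c <= t]) => //.
  - exact: connected_ge.
  - by move=> t; exact: avoid.
  - by exists c => //=.
have -> : md z c = md a c.
  apply/(mkdisc_eqP vL_val C_completion vL_surj); split=> //.
  by rewrite vge_sub; [|exact: wLv].
apply: (path_sub a c [set t | c <= t]) => //.
- exact: connected_ge.
- exact: lexx.
- by move=> t; exact: avoid.
- by exists (Num.max N c) => //=; rewrite le_max lexx orbT.
Qed.

End Tree.

(** * Identification of the function t *)

Lemma coef_comp_scaleX (A : comNzRingType) (u : {poly A}) (b : A) m :
  (u \Po (b *: 'X))`_m = b ^+ m * u`_m.
Proof.
rewrite comp_polyE coef_sum.
under eq_bigr do rewrite exprZn !coefZ coefXn.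
have [ms|sm] := ltnP m (size u).
  rewrite (bigD1 (Ordinal ms)) //= eqxx mulr1 mulrC big1 ?addr0 // => i im.
  rewrite (_ : (m == i) = false) ?mulr0 //; apply/eqP => mi.
  by case/eqP: im; apply: val_inj.
rewrite [in RHS]nth_default // mulr0 big1 // => i _.
by rewrite gtn_eqF ?mulr0 // (leq_trans (ltn_ord i)).
Qed.

Section TFunction.

Variables (R : realType) (L : closedFieldType) (C : fieldType).
Variables (psi : {rmorphism L -> C}) (vL : L -> \bar rat) (vC : C -> \bar rat).
Hypothesis vL_val : is_valuation vL.
Hypothesis C_completion : is_completion psi vL vC.
Hypothesis vL_surj : forall s : rat, exists x, vL x = s%:E.
Variables (p : nat) (vq : rat).
Hypotheses (p_prime : prime p) (vqE : vL p%:R = vq%:E) (vq_gt0 : 0 < vq).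

Local Notation wL := (real_val R vL).
Local Notation disc := (disc R vC).
Local Notation md a b := (mkdisc vC (psi a) (b : R)).
Local Notation wLv := (wL_val R vL_val).
Local Notation vp := (ratr vq : R).
Local Notation T := (tlevel p vp).
Local Notation tau := (best_level wL p vp).

Lemma val_prime : vis wL vp p%:R.
Proof. exact: vis_real_val. Qed.

Lemma val_prime_gt0 : 0 < vp.
Proof. by rewrite ltr0q. Qed.

Lemma tmaxE : ratr (tmax p vL) = T.
Proof. by rewrite /tmax vqE /= /tlevel fmorph_div rmorphM /= !ratr_nat. Qed.

Implicit Types (a : L) (h g q rho : {poly L}) (D E : disc).

Lemma er_map_min (x y : \bar rat) : er_map (ratr : rat -> R) (Order.min x y) =
  Order.min (er_map ratr x) (er_map ratr y).
Proof.
have [xy|yx] := leP x y.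
  by rewrite min_l // er_map_ratr_le.
by rewrite min_r // er_map_ratr_le ltW.
Qed.

Lemma gauss_ge (c : R) g :
  (c%:E <= er_map ratr (gauss vL g))%E <-> gge wL 0 c g.
Proof.
have -> : (c%:E <= er_map ratr (gauss vL g))%E = all (fun i : 'I_(size g) => vge wL c g`_i) (index_enum _).
  rewrite /gauss -big_all.
  elim/big_rec2: _ => [|i x y _ IH]; first by rewrite leey.
  by rewrite er_map_min le_min IH.
split=> [/allP H m|H].
  rewrite mulr0 subr0; have [ms|sm] := ltnP m (size g); first by apply: (H (Ordinal ms)); rewrite mem_index_enum.
  by rewrite nth_default //; exact: vge0 wLv _.
by apply/allP => i _; have := H i; rewrite mulr0 subr0.
Qed.

Lemma gauss_finite g : g != 0 -> exists2 r : rat, gauss vL g = r%:E & gis wL 0 (ratr r) g.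
Proof.
move=> g0; have [c gc] := gis_exists wLv 0 g0.
have /gauss_ge cg := gc.1.
case gE : (gauss vL g) cg => [r| |] cg.
- exists r => //; have rg : gge wL 0 (ratr r) g by apply/gauss_ge; rewrite gE.
  suff <- : c = ratr r by [].
  apply/eqP; rewrite eq_le (gis_gge gc rg) andbT.
  by move: cg; rewrite /= lee_fin.
- have /(gis_gge gc) : gge wL 0 (c + 1) g by apply/gauss_ge; rewrite gE leey.
  by lra.
- by move: cg; rewrite /= leeNy_eq.
Qed.

Lemma t_dec_ge g rho (V t : R) : gis wL 0 V g ->
  (t%:E <= er_map ratr (t_dec vL g rho))%E <-> gge wL 0 (V + t) rho.
Proof.
move=> gV; have [r gr rV] := gauss_finite (gis_neq0 wLv gV).
rewrite (gis_inj gV rV) -gauss_ge /t_dec gr.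
case: (gauss vL rho) => [x| |] /=; rewrite ?leey ?leeNy_eq //.
by rewrite rmorphB /= !lee_fin lerBrDl.
Qed.

(** The function t rescales each disc to the unit disc, whereas [best_level] varies the depth; this
    is the dictionary between the two. *)
Lemma gge_scale (b : L) (be c : R) h : vis wL be b ->
  gge wL 0 c (h \Po (b *: 'X)) <-> gge wL be c h.
Proof.
move=> bb; have vE m x : vge wL c (b ^+ m * x) = vge wL (c - m%:R * be) x.
  have bm := visX wLv m bb.
  have [->|/(vis_exists wLv)[v vx]] := eqVneq x 0.
    by rewrite mulr0 !(vge0 wLv).
  rewrite (vis_vgeE _ (visM wLv bm vx)) (vis_vgeE _ vx).
  by apply/idP/idP; lra.
split=> H m; have := H m; rewrite coef_comp_scaleX mulr0 subr0 vE //.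
Qed.

Lemma gis_scale (b : L) (be V : R) h : vis wL be b ->
  gis wL be V h -> gis wL 0 V (h \Po (b *: 'X)).
Proof.
move=> bb [hV [m hm]]; split; first exact/(gge_scale _ _ bb).
exists m; rewrite coef_comp_scaleX mulr0 subr0.
by have := visM wLv (visX wLv m bb) hm; congr vis; ring.
Qed.

Lemma affine_substE h (a b : L) :
  affine_subst h a b = h \Po ('X + a%:P) \Po (b *: 'X).
Proof. by rewrite -comp_polyA comp_polyD comp_polyX comp_polyC. Qed.

Lemma size_scale h (b : L) : b != 0 -> size (h \Po (b *: 'X)) = size h.
Proof. by move=> b0; rewrite size_comp_poly2 // size_scale // size_polyX. Qed.

Lemma scaleK h (b : L) : b != 0 -> h \Po (b^-1 *: 'X) \Po (b *: 'X) = h.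
Proof.
move=> b0; rewrite -comp_polyA comp_polyZ comp_polyX scalerA mulVf //.
by rewrite scale1r comp_polyXr.
Qed.

Lemma decomposition_scale h q (b : L) : b != 0 -> (size q <= pth_size p h)%N ->
  decomposition p (h \Po (b *: 'X)) (q \Po (b *: 'X)) ((h - q ^+ p) \Po (b *: 'X)).
Proof.
move=> b0 sq; split; last by rewrite !size_scale.
rewrite -(rmorphXn (comp_poly (b *: 'X))) -rmorphD.
by congr (comp_poly _); ring.
Qed.

Lemma decomposition_unscale h g q rho (b : L) : b != 0 -> g = h \Po (b *: 'X) ->
  decomposition p g q rho -> exists q',
  (size q' <= pth_size p h)%N /\ rho = (h - q' ^+ p) \Po (b *: 'X).
Proof.
move=> b0 -> [gE sq]; exists (q \Po (b^-1 *: 'X)); split.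
  by rewrite size_scale ?invr_eq0 //; move: sq; rewrite size_scale.
rewrite (rmorphB (comp_poly (b *: 'X))) (rmorphXn (comp_poly (b *: 'X))) /=.
by rewrite scaleK // gE; ring.
Qed.

Lemma tau_good h a b q rho : h != 0 -> b != 0 ->
  good_decomposition p vL (affine_subst h a b) q rho ->
  (tau (ratr (fine (vL b))) (h \Po ('X + a%:P)))%:E =
    er_map ratr (Order.min (t_dec vL (affine_subst h a b) rho) (tmax p vL)%:E).
Proof.
move=> h0 b0; have [be bE] : exists be : rat, vL b = be%:E.
  have := val_neqNy vL_val b; have := (val_eqy vL_val b).1.
  case: (vL b) => [r _ _|H _|//]; first by exists r.
  by move: b0; rewrite H ?eqxx.
rewrite bE affine_substE /=; set ha := h \Po _; set g := ha \Po _.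
have bb : vis wL (ratr be) b by exact: vis_real_val.
have ha0 : ha != 0 by rewrite -size_poly_eq0 size_translate size_poly_eq0.
have hV := gvP wLv (ratr be) ha0; set V := gv _ _ _ in hV.
have gV : gis wL 0 V g by exact: gis_scale bb hV.
move=> [dec good]; have [q' [sq' rhoE]] := decomposition_unscale b0 erefl dec.
have lev t : (t%:E <= er_map ratr (t_dec vL g rho))%E <->
    gge wL (ratr be) (V + t) (ha - q' ^+ p).
  by rewrite (t_dec_ge _ _ gV) rhoE (gge_scale _ _ bb).
rewrite er_map_min /= tmaxE.
case: good => [tT|[tT tmx]].
  have TT : (T%:E <= er_map ratr (t_dec vL g rho))%E.
    by rewrite -tmaxE -[(ratr _)%:E]/(er_map ratr _%:E) er_map_ratr_le.
  rewrite min_r //; congr EFin.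
  by apply: (tau_max wLv p_prime val_prime_gt0 hV sq'); exact/lev.
rewrite min_l; last first.
  by rewrite -tmaxE -[(ratr _)%:E]/(er_map ratr _%:E) er_map_ratr_le ltW.
have t0 : (0%:E <= er_map (ratr : rat -> R) (t_dec vL g rho))%E.
  have : decomposition p g 0 g.
    by rewrite /decomposition expr0n gtn_eqF ?prime_gt0 // add0r size_poly0.
  move=> /tmx; rewrite -(er_map_ratr_le R); apply: le_trans.
  by apply/(t_dec_ge _ _ gV); rewrite addr0; exact: gV.1.
have [t tE] : exists t, t_dec vL g rho = t%:E.
  by case: (t_dec vL g rho) tT t0 => [t| |] //; exists t.
rewrite tE /= in tT t0 lev *; congr EFin; apply/eqP; rewrite eq_le; apply/andP; split.
  apply: (tau_le wLv p_prime val_prime_gt0 ha0) => t' [_ [q'' sq'' ht']].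
  have /tmx := decomposition_scale b0 sq''.
  rewrite -(er_map_ratr_le R) tE /= -lee_fin; apply: le_trans.
  exact/(t_dec_ge _ _ gV)/(gge_scale _ _ bb).
apply: (levels_le_tau wLv p_prime val_prime_gt0) => //; split.
  by rewrite -tmaxE ler_rat -lee_fin t0 -lee_fin ltW.
by exists q' => //; apply/lev.
Qed.

Definition center D : L := xget 0 [set a | D = md a (depth D)].

Lemma centerP D : D = md (center D) (depth D).
Proof.
exact: (@xgetPex _ 0 [set a | D = md a (depth D)]
  (disc_center_exists C_completion vL_surj D)).
Qed.

Definition disc_tau h D : R := tau (depth D) (h \Po ('X + (center D)%:P)).

Lemma translate_neq0 h a : h != 0 -> h \Po ('X + a%:P) != 0.
Proof. by move=> h0; rewrite -size_poly_eq0 size_translate size_poly_eq0. Qed.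

Lemma tau_recenter h a a' (b : R) : h != 0 -> vge wL b (a - a') ->
  tau b (h \Po ('X + a%:P)) = tau b (h \Po ('X + a'%:P)).
Proof.
move=> h0 aa; rewrite -(tau_translate wLv p_prime val_prime_gt0 (translate_neq0 a' h0) aa).
congr (best_level _ _ _ _ _).
rewrite -comp_polyA comp_polyD comp_polyX comp_polyC -addrA -polyCD.
by rewrite subrK.
Qed.

Lemma disc_tauE h a (b : R) : h != 0 ->
  disc_tau h (md a b) = tau b (h \Po ('X + a%:P)).
Proof.
move=> h0; apply: tau_recenter => //=.
have /(mkdisc_eqP vL_val C_completion vL_surj)[_] := centerP (md a b).
by rewrite (vge_sub wLv).
Qed.

(** Climb from D to the join with centre a, exchange the centre there, and descend to E with centre
    a'. *)
Lemma disc_tau_lipschitz h D E : h != 0 ->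
  `|disc_tau h E - disc_tau h D| <= (size h).-1%:R * delta D E.
Proof.
move=> h0; have [a ->] := disc_center_exists C_completion vL_surj D.
have [a' ->] := disc_center_exists C_completion vL_surj E.
set b := depth D; set b' := depth E.
have [c [cb cb' ca cmax]] := join_depth_exists vL_val a a' b b'.
rewrite (deltaE vL_val C_completion vL_surj cb cb' ca cmax) !disc_tauE //.
have ha0 := translate_neq0 a h0; have ha'0 := translate_neq0 a' h0.
have := tau_lipschitz wLv p_prime val_prime_gt0 ha0 cb.
have := tau_lipschitz wLv p_prime val_prime_gt0 ha'0 cb'.
rewrite (tau_recenter h0 ca) !size_translate => H' H.
rewrite mulrDr [leRHS]addrC; apply: le_trans (lerD H' H).
by rewrite [X in _ <= _ + X]distrC; apply: ler_distD.
Qed.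

Lemma is_tfun_disc_tau h : h != 0 -> is_tfun p vL psi h (disc_tau h).
Proof.
move=> h0; split=> [a b q rho b0 good|D e e0].
  by rewrite disc_tauE // (tau_good h0 b0 good).
have n0 : 0 < (size h).-1%:R + 1 :> R by rewrite ltr_wpDl.
exists (e / ((size h).-1%:R + 1)); first by rewrite divr_gt0.
move=> E; rewrite ltr_pdivlMr // => lt.
apply: (le_lt_trans (disc_tau_lipschitz D E h0)); apply: le_lt_trans lt.
have := delta_ge0 vL_val C_completion vL_surj D E; lra.
Qed.

(** A slightly deeper disc inside D is chosen around a centre a with v(z - a) <= t for all roots z.
    The constant term dominates from depth t on, so [dominant_approx] yields a good decomposition at
    any rational depth beyond t. *)
Lemma good_decomposition_dense s mu D (e : R) : 0 < e ->
  exists a b q rho, [/\ b != 0,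
    delta D (md a (ratr (fine (vL b)))) < e &
    good_decomposition p vL (affine_subst (rootprod s mu) a b) q rho].
Proof.
move=> e0; have [a0 ->] := disc_center_exists C_completion vL_surj D.
set b0 := depth D.
(* No value v(a0 - z) lies strictly between b0 and m, so translating a0 by x with b0 < v(x) < m
   makes v(z - a) <= v(x) for every root. *)
have [m [bm me mP]] : exists m, [/\ b0 < m, m <= b0 + e &
    forall z v, z \in s -> vis wL v (a0 - z) -> b0 < v -> m <= v].
  elim: s => [|z s [m [bm me mP]]]; first by exists (b0 + e); split => //; lra.
  have [az|/(vis_exists wLv)[v vE]] := eqVneq (a0 - z) 0.
    exists m; split => // z' v; rewrite inE => /predU1P[->|]; last exact: mP.
    by move=> vz; have := vis_neq0 wLv vz; rewrite az eqxx.
  exists (if b0 < v then Num.min m v else m); split.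
  - by case: ifP => // bv; rewrite lt_min bm.
  - by case: ifP => // bv; rewrite ge_min me.
  move=> z' v'; rewrite inE => /predU1P[->|zs] vz' bv'; last first.
    by have := mP z' v' zs vz' bv'; case: ifP => // _ ?; rewrite ge_min; apply/orP; left.
  by rewrite -(vis_inj vE vz') in bv' *; rewrite bv' ge_min lexx orbT.
have [t [x [bt tm xt]]] := rat_value vL_surj bm.
have [t'] := @rat_in_itvoo R t m tm; rewrite in_itv /= => /andP[tt' t'm].
have [b bE] := vL_surj t'.
have bb : vis wL (ratr t' : R) b by exact: vis_real_val.
have b_neq0 := vis_neq0 wLv bb.
set a := a0 + x; set h := rootprod s mu.
have h0 : h != 0 by exact: rootprod_neq0.
have far_roots z : z \in s -> true -> far wL t (z - a).
  move=> zs _; have -> : z - a = - ((a0 - z) + x) by rewrite /a; ring.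
  rewrite /far (valN wLv) -leNgt.
  have [az|/(vis_exists wLv)[v vE]] := eqVneq (a0 - z) 0; first by rewrite az add0r xt.
  have [vb|vb] := ltP b0 v.
    have := mP z v zs vE vb => mv; rewrite addrC.
    by rewrite (vis_dom wLv xt (vis_vge vE)) //; lra.
  rewrite (vis_dom wLv vE (vis_vge xt)); last lra.
  by rewrite lee_fin; lra.
have [V [hV hc]] := prod_const_dominant wLv mu far_roots.
rewrite -shiftedE -/h in hV hc.
have ha0 : shifted s mu a != 0 by exact: shifted_neq0.
have hc' : vis wL (V - 0%:R * t) (shifted s mu a)`_0 by rewrite mul0r subr0.
have eps0 : 0 < ratr t' - t by rewrite subr_gt0.
have [q sq Hq] := dominant_approx wLv p_prime val_prime val_prime_gt0 hV hc' (or_introl erefl)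
  (dvdn0 p) eps0.
have [] := Hq (ratr t').
  move=> i _ i0; rewrite subr0; apply: ler_peMl; first exact: ltW.
  by rewrite ler1n lt0n.
rewrite mul0r addr0 => gV rV rp.
have [tl lev] := tau_impure wLv p_prime val_prime val_prime_gt0 gV sq rV rp.
have gV0 : gis wL 0 V (shifted s mu a \Po (b *: 'X)) by exact: gis_scale bb gV.
exists a, b, (q \Po (b *: 'X)), ((shifted s mu a - q ^+ p) \Po (b *: 'X)).
rewrite bE affine_substE -/(shifted s mu a); split=> //.
  have aa : vge wL b0 (a0 - a).
    by have -> : a0 - a = - x by [rewrite /a; ring]; rewrite (vgeN wLv) (vis_vgeE _ xt) ltW.
  have bt' : b0 <= ratr t' by apply: ltW; exact: lt_trans tt'.
  rewrite (deltaE vL_val C_completion vL_surj (lexx b0) bt' aa) //=.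
  by rewrite subrr add0r; move: t'm me; lra.
split; first exact: decomposition_scale.
set g := _ \Po _ in gV0 *; set rho := _ \Po _.
have levP c : (c%:E <= er_map ratr (t_dec vL g rho))%E <->
    gge wL (ratr t') (V + c) (shifted s mu a - q ^+ p).
  exact: iff_trans (t_dec_ge _ _ gV0) (gge_scale _ _ bb).
have [tT|tT] := leP (tmax p vL)%:E (t_dec vL g rho); [by left|right; split=> //].
have nT : tau (ratr t') (shifted s mu a) <> T.
  move=> tE; move: tl; rewrite tE => /levP; rewrite -tmaxE.
  by rewrite -[(ratr _)%:E]/(er_map ratr _%:E) er_map_ratr_le leNgt tT.
have [m' [pm' _ mv]] := lev nT.
move=> q' rho' dec'; have [q'' [sq'' ->]] := decomposition_unscale b_neq0 erefl dec'.
rewrite -(er_map_ratr_le R); apply: le_trans ((levP _).2 tl).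
set Y := er_map _ _; rewrite leNgt; apply/negP => tY.
have [c tc cY] : exists2 c, tau (ratr t') (shifted s mu a) < c & (c%:E <= Y)%E.
  case YE : Y tY => [y| |] //= tY; first by exists y; rewrite // YE.
  by exists (tau (ratr t') (shifted s mu a) + 1); [lra|rewrite leey].
move: cY => /(t_dec_ge _ _ gV0) /(gge_scale _ _ bb) hq''.
apply: (level_maximal wLv p_prime val_prime val_prime_gt0 gV.1 _ tl pm' mv _ hq''); last lra.
rewrite (tau_ge0 wLv p_prime val_prime_gt0 _ ha0) /= lt_neqAle.
by apply/andP; split; [apply/eqP|exact: (tau_leT wLv p_prime val_prime_gt0 _ ha0)].
Qed.

(** [disc_tau] shows that the choice defining [tfun] is not the default; two continuous solutions
    agree on the dense set of discs with good decompositions, hence everywhere. *)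
Lemma tfunE s mu D : tfun p vL psi (rootprod s mu) D = disc_tau (rootprod s mu) D.
Proof.
set h := rootprod s mu; have h0 : h != 0 by exact: rootprod_neq0.
have [ta tc] : is_tfun p vL psi h (tfun p vL psi h : disc -> R).
  apply: (@xgetPex _ _ [set t : disc -> R | is_tfun p vL psi h t]).
  by exists (disc_tau h); exact: is_tfun_disc_tau.
have [sa sc] := is_tfun_disc_tau h0.
apply/eqP; rewrite -subr_eq0 -normr_eq0; apply/eqP/le_anti.
rewrite normr_ge0 andbT; apply/ler_addgt0Pl => e e0; rewrite addr0.
have e2 : 0 < e / 2 by lra.
have [d d0 Hd] := tc D _ e2; have [d' d'0 Hd'] := sc D _ e2.
have dd : 0 < Num.min d d' by rewrite lt_min d0.
have [a [b [q [rho [b0 + good]]]]] := good_decomposition_dense s mu D dd.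
rewrite lt_min => /andP[/Hd H1 /Hd' H2].
have E : tfun p vL psi h (md a (ratr (fine (vL b)))) = disc_tau h (md a (ratr (fine (vL b)))).
  by have := ta a b q rho b0 good; rewrite -(sa a b q rho b0 good) => -[].
rewrite E in H1; rewrite distrC in H1.
set u := disc_tau _ (md _ _) in H1 H2.
have -> : tfun p vL psi h D - disc_tau h D = (tfun p vL psi h D - u) + (u - disc_tau h D) by ring.
apply: (le_trans (ler_normD _ _)); lra.
Qed.

End TFunction.

(** * The partition of the branch set *)

Lemma fsbig_uniq_seq (A : Type) (idx : A) (op : Monoid.com_law idx) (I : choiceType)
    (P : set I) (s : seq I) (F : I -> A) :
  uniq s -> (forall a, P a -> a \in s) ->
  \big[op/idx]_(a \in P) F a = \big[op/idx]_(a <- s | `[< P a >]) F a.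
Proof.
move=> s_uniq Ps; rewrite -[RHS]big_filter [RHS]fsbig_seq ?filter_uniq //.
apply: eq_fsbigl.
apply/seteqP; split=> a /=; rewrite mem_filter.
  by move=> Pa; rewrite Ps // andbT; apply/asboolP.
by move=> /andP[/asboolP].
Qed.

Section Partition.

Variables (R : realType) (L : closedFieldType) (C : fieldType).
Variables (psi : {rmorphism L -> C}) (vL : L -> \bar rat) (vC : C -> \bar rat).
Hypothesis vL_val : is_valuation vL.
Hypothesis C_completion : is_completion psi vL vC.
Hypothesis vL_surj : forall s : rat, exists x, vL x = s%:E.
Variables (p : nat) (f : {poly L}) (rs : seq L).
Hypotheses (rs_uniq : uniq rs) (rsE : forall a, (a \in rs) = root f a).

Local Notation wL := (real_val R vL).
Local Notation disc := (disc R vC).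
Local Notation berk := (berk R vC).
Local Notation md a b := (mkdisc vC (psi a) (b : R)).
Local Notation wLv := (wL_val R vL_val).
Local Notation B := (branch_set f).
Local Notation mu := (fun a => mup a f).
Local Notation far := (far wL).

Implicit Types (A : set (option L)) (a z : L) (b : R) (D E : disc).

Definition roots_in A : seq L := [seq a <- rs | `[< A (Some a) >]].

Lemma roots_in_uniq A : uniq (roots_in A).
Proof. exact: filter_uniq. Qed.

Lemma mem_roots_in A a : A `<=` B -> (a \in roots_in A) = `[< A (Some a) >].
Proof.
move=> AB; rewrite mem_filter; case: asboolP => //= Aa.
by rewrite rsE; exact: AB Aa.
Qed.

Lemma mcardE A : A `<=` B -> mcard p f A =
  ((if `[< A None >] then multiplicity p f None else 0) +
  \sum_(a <- rs | `[< A (Some a) >]) mu a)%N.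
Proof.
move=> AB; rewrite /mcard (@fsbig_uniq_seq _ _ _ _ _ (None :: map Some rs)).
- rewrite big_cons big_map; case: ifP => _ //.
- rewrite /= map_inj_uniq ?rs_uniq ?andbT; last by move=> ? ? [].
  by apply/mapP => -[].
- move=> [a|] Aa; rewrite inE //=; apply/mapP; exists a => //.
  by rewrite rsE; exact: AB Aa.
Qed.

Lemma f_E A : A `<=` B -> f_ f (finite_part A) = rootprod (roots_in A) mu.
Proof.
move=> AB; rewrite /f_ /rootprod /roots_in big_filter.
rewrite (@fsbig_uniq_seq _ _ _ _ _ rs) // => a Aa.
by rewrite rsE; exact: AB Aa.
Qed.

Lemma count_inE A b z : count_in wL (roots_in A) mu b z =
  (\sum_(a <- rs | `[< A (Some a) >] && ((b%:E < wL (a - z)%R)%E)) mu a)%N.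
Proof. by rewrite /count_in /roots_in big_filter_cond. Qed.

(** A count not divisible by p is nonzero, so some root of A is in the class; since p divides the
    total, some member of A is outside it. The disc lies on the path between the two. *)
Lemma Sigma_of_count A b z : A `<=` B -> (p %| mcard p f A)%N ->
  ~~ (p %| count_in wL (roots_in A) mu b z)%N ->
  Sigma psi A (TypeH (md z b) : berk).
Proof.
move=> AB pA pc; rewrite count_inE in pc.
have [/hasP[a ars /andP[/asboolP Aa az]]|none] := boolP (has
    (fun a => `[< A (Some a) >] && (b%:E < wL (a - z)%R)%E) rs); last first.
  case/negP: pc; rewrite big_seq_cond big1 // => a /andP[ars aA].
  by case/negP: none; apply/hasP; exists a.
have -> : md z b = md a b.
  apply/(mkdisc_eqP vL_val C_completion vL_surj); split=> //.
  by rewrite (vge_sub wLv); exact: ltW.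
apply/(SigmaP vL_val C_completion vL_surj); exists a, b; split=> //.
have [AN|nAN] := pselect (A None); first by exists None.
have [/hasP[a' ars' /andP[/asboolP Aa' az']]|none] := boolP (has
    (fun a => `[< A (Some a) >] && far b (a - z)) rs); last first.
  case/negP: pc; move: pA; rewrite mcardE // asboolF // add0n.
  rewrite [X in (_ %| X)%N -> _](_ : _ = (\sum_(a <- rs | `[< A (Some a) >] &&
    (b%:E < wL (a - z)%R)%E) mu a)%N) //.
  rewrite big_seq_cond [RHS]big_seq_cond; apply: eq_bigl => a'.
  have [ars' /=|//] := boolP (a' \in rs).
  have [/= Aa'|//] := boolP (`[< _ >]).
  by apply/esym/negbNE/negP => az'; case/negP: none; apply/hasP; exists a'; rewrite // Aa'.
exists (Some a') => //; split; first by move=> aa; move: az'; rewrite aa /far az.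
apply: contra az' => aa'.
by apply: (lt_val_sub wLv _ az); rewrite (lt_valN _ _ _ wLv).
Qed.

Variables (h : nat) (r : 'I_h.+1 -> set (option L)).
Hypothesis r_partition : @component_partition R p L C psi vC f h r.

Local Notation Sigma_ i := (Sigma psi (r i) : set berk).

Lemma r_sub i : r i `<=` B.
Proof. by case: r_partition => <- _ _ _ x rx; exists i. Qed.

Lemma Sigma_component i : is_component (Sigma_star p psi f : set berk) (Sigma_ i).
Proof. by case: r_partition => _ _ comp _; apply/comp; exists i. Qed.

Lemma isolating_radius z b : exists b', b <= b' /\
  forall a, a \in rs -> vge wL b' (a - z) -> a = z.
Proof.
elim: rs => [|a s [b' [bb' H]]]; first by exists b.
have [az|/(vis_exists wLv)[v vE]] := eqVneq (a - z) 0.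
  exists b'; split=> // a'; rewrite inE => /predU1P[->|]; last exact: H.
  by move=> _; apply/eqP; rewrite -subr_eq0 az.
exists (Num.max b' (v + 1)); split; first by rewrite le_max bb'.
move=> a'; rewrite inE => /predU1P[->|a's].
  by rewrite (vis_vgeE _ vE) ge_max => /andP[_ ?]; exfalso; lra.
by move=> az; apply: H => //; apply: vge_le az; rewrite le_max lexx.
Qed.

Lemma Sigma_deep i z b w b' : r i (Some z) -> r i w ->
  separated_at vL b z w -> b <= b' -> Sigma_ i (TypeH (md z b')).
Proof.
move=> rz rw sep bb; apply/(SigmaP vL_val C_completion vL_surj); exists z, b'.
split=> //; exists w => //; case: w sep {rw} => //= z' [zz' zb]; split=> //.
by apply: contra zb; apply: le_lt_trans; rewrite lee_fin.
Qed.

(** Components that meet coincide. A disc around z in [r i] so small that z is its only root then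
    also belongs to the tree of [r l], which puts z in [r l]. *)
Lemma Sigma_disjoint i l x : Sigma_ i x -> Sigma_ l x -> i = l.
Proof.
move=> ix lx; have [y _ iE] := Sigma_component i; have [y' _ lE] := Sigma_component l.
have il : Sigma_ i = Sigma_ l.
  rewrite iE lE in ix lx *.
  by rewrite (same_connected_component ix) (same_connected_component lx).
have [z [b [rz xE [w rw sep]]]] := (SigmaP vL_val C_completion vL_surj _ _).1 ix.
have [b' [bb' isol]] := isolating_radius z b.
have : Sigma_ i (TypeH (md z b')) by exact: Sigma_deep sep bb'.
rewrite il => /(SigmaP vL_val C_completion vL_surj)[z' [c [rz' /TypeH_inj]]].
move=> /(mkdisc_eqP vL_val C_completion vL_surj)[_ zz'] _.
have zE : z' = z by apply: isol; [rewrite rsE; exact: (r_sub rz')|rewrite (vge_sub wLv)].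
case: r_partition => _ triv _ _; apply: triv => //; exists (Some z).
by split=> //; rewrite -zE.
Qed.

(** Some residue class of D contains a number of branch points not divisible by p. For l different
    from i the tree of [r l] avoids D, so [r l] lies wholly inside or wholly outside that class and
    contributes a multiple of p. Hence [r i] does not. *)
Lemma Sigma_count i D : Sigma_ i (TypeH D) -> exists z, disc_set D (psi z) /\
  ~~ (p %| count_in wL (roots_in (r i)) mu (depth D) z)%N.
Proof.
move=> iD; have [y _ iE] := Sigma_component i.
have [SBD [U [Ucomp Uinf pU]]] : Sigma_star p psi f (TypeH D : berk).
  by move: iD; rewrite iE => /connected_component_sub.
have [z [zD limE]] := component_limits vL_val C_completion vL_surj Ucomp Uinf.
exists z; split=> //; apply: contra pU => pi.
set b := depth D in pi limE *.
have DE : D = md z b := disc_of_point vL_val C_completion vL_surj zD.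
rewrite limE mcardE; last by move=> _ [a [-> fa _]].
rewrite asboolF ?add0n; last by move=> [a []].
(* The index of the part containing a; the implication only makes it total. *)
have idxP a : exists l, (a \in rs) ==> `[< r l (Some a) >].
  have [ars|_] := boolP (a \in rs); last by exists ord0.
  case: r_partition => cover _ _ _.
  have [l _ rla] : (\bigcup_i r i) (Some a) by rewrite cover /= -rsE.
  by exists l; apply/asboolP.
pose idx a := xchoose (idxP a).
have idx_eq a l : a \in rs -> (idx a == l) = `[< r l (Some a) >].
  move=> ars; have /implyP/(_ ars)/asboolP := xchooseP (idxP a); rewrite -/(idx a) => ra.
  apply/eqP/asboolP => [<- //|la].
  by case: r_partition => _ triv _ _; apply: triv => //; exists (Some a).
rewrite (eq_bigl (fun a => `[< [set u | exists a, [/\ u = Some a, root f a &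
  (b%:E < wL (a - z)%R)%E]] (Some a) >])) //.
rewrite (partition_big idx xpredT) //=; apply: dvdn_sum => l _.
rewrite (_ : (\sum_(a <- rs | _) _)%N = count_in wL (roots_in (r l)) mu b z); last first.
  rewrite count_inE big_seq_cond [RHS]big_seq_cond; apply: eq_bigl => a.
  have [ars /=|//] := boolP (a \in rs); rewrite idx_eq // andbC.
  congr andb; apply/asboolP/idP => [[_ [[<-] _]]//|az].
  by exists a; split=> //; rewrite -rsE.
have [->//|li] := eqVneq l i; rewrite count_inE.
have [/hasP[a ars /andP[/asboolP la az]]|none] := boolP (has
    (fun a => `[< r l (Some a) >] && (b%:E < wL (a - z)%R)%E) rs); last first.
  rewrite big_seq_cond big1 // => a /andP[ars aA].
  by case/negP: none; apply/hasP; exists a.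
have inside w : r l w -> ~ separated_at vL b a w.
  move=> lw sep; case/eqP: li; apply: (@Sigma_disjoint _ _ (TypeH D)) => //.
  apply/(SigmaP vL_val C_completion vL_surj); exists a, b; split=> //; last by exists w.
  rewrite DE; congr TypeH; apply/(mkdisc_eqP vL_val C_completion vL_surj).
  by split=> //; rewrite (vge_sub wLv); exact: ltW.
have lN : ~ r l None by move=> /inside; apply.
case: r_partition => _ _ _ /(_ l); rewrite mcardE; last exact: r_sub.
rewrite asboolF // add0n.
rewrite [X in (_ %| X)%N -> _](_ : _ = (\sum_(a <- rs | `[< r l (Some a) >] &&
    (b%:E < wL (a - z)%R)%E) mu a)%N) //.
apply: eq_bigl => a'; have [/= /asboolP la'|//] := boolP (`[< _ >]).
apply/esym; have [->//|aa] := eqVneq a' a.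
apply/negbNE/negP => far'; apply: (inside _ la'); split.
  by move=> aE; rewrite aE eqxx in aa.
apply: contra far' => near'; apply: (lt_val_sub wLv _ az).
by rewrite (lt_valN _ _ _ wLv).
Qed.

End Partition.

(** * Parts (a), (b) and (c) *)

Lemma roots_exist (L : closedFieldType) (f : {poly L}) : f != 0 ->
  exists rs : seq L, uniq rs /\ forall a, (a \in rs) = root f a.
Proof.
move=> f0; have [rs fE] := closed_field_poly_normal f.
exists (undup rs); split=> [|a]; first exact: undup_uniq.
by rewrite mem_undup fE rootZ ?lead_coef_eq0 // root_prod_XsubC.
Qed.

Section Parts.

Variables (R : realType) (L : closedFieldType) (C : fieldType).
Variables (psi : {rmorphism L -> C}) (vL : L -> \bar rat) (vC : C -> \bar rat).
Hypothesis vL_val : is_valuation vL.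
Hypothesis C_completion : is_completion psi vL vC.
Hypothesis vL_surj : forall s : rat, exists x, vL x = s%:E.
Variables (p : nat) (vq : rat).
Hypotheses (p_prime : prime p) (vqE : vL p%:R = vq%:E) (vq_gt0 : 0 < vq).
Variable f : {poly L}.

Local Notation wL := (real_val R vL).
Local Notation disc := (disc R vC).
Local Notation berk := (berk R vC).
Local Notation md a b := (mkdisc vC (psi a) (b : R)).
Local Notation wLv := (wL_val R vL_val).
Local Notation vp := (ratr vq : R).
Local Notation T := (tlevel p vp).
Local Notation vpE := (val_prime R vqE).
Local Notation vp_gt0 := (val_prime_gt0 R vq_gt0).
Local Notation tau := (best_level wL p vp).
Local Notation B := (branch_set f).
Local Notation mu := (fun a => mup a f).
Local Notation SigmaP := (SigmaP vL_val C_completion vL_surj).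
Local Notation mkdisc_eqP := (mkdisc_eqP vL_val C_completion vL_surj).

Variable rs : seq L.
Hypotheses (rs_uniq : uniq rs) (rsE : forall a, (a \in rs) = root f a).

Implicit Types (A : set (option L)) (a z : L) (b : R) (D E : disc).

Local Notation t_ A := (tfun p vL psi (f_ f (finite_part A)) : disc -> R).

Lemma tfun_mkdisc A a b : A `<=` B ->
  t_ A (md a b) = tau b (shifted (roots_in rs A) mu a).
Proof.
move=> AB; rewrite (f_E rs_uniq rsE AB).
rewrite (tfunE vL_val C_completion vL_surj p_prime vqE vq_gt0).
by rewrite (disc_tauE vL_val C_completion vL_surj p_prime vq_gt0) // rootprod_neq0.
Qed.

Lemma tfun_eq0 (h : nat) (r : 'I_h.+1 -> set (option L)) i D :
  @component_partition R p L C psi vC f h r ->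
  t_ (r i) D = 0 <-> Sigma psi (r i) (TypeH D).
Proof.
move=> part; have riB : r i `<=` B by exact: (r_sub part).
have pr : (p %| mcard p f (r i))%N by case: part.
split=> [tD|/(Sigma_count vL_val C_completion vL_surj rs_uniq rsE part)[z [zD pc]]].
  have [a aE] := disc_center_exists C_completion vL_surj D.
  move: tD; rewrite aE tfun_mkdisc // => tD; apply: contrapT => nS.
  have := @tau_gt0_of_count _ _ _ wLv _ _ p_prime vp_gt0 (roots_in rs (r i)) mu
    (depth D) a (roots_in_uniq rs_uniq _).
  rewrite tD ltxx => H; suff : false by []; apply: H => x xa.
  apply/negbNE/negP => pc; apply: nS.
  have := Sigma_of_count vL_val C_completion vL_surj rs_uniq rsE riB pr pc.
  by congr Sigma; congr TypeH; apply/mkdisc_eqP.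
rewrite (disc_of_point vL_val C_completion vL_surj zD) tfun_mkdisc //.
exact: (tau_eq0_of_count wLv p_prime vpE vp_gt0).
Qed.

(** No root is closer to a than c, so the constant term dominates at depth c; positive slopes are
    exponents minus e = 0. *)
Lemma pl_tfun_outside A a c : A `<=` B ->
  (forall b, c < b -> forall z, A (Some z) -> ~ closed_disc vC (psi a) b (psi z)) ->
  pl_decreasing_int_slopes (fun m : int => 0 < m)
    [set b | c < b /\ t_ A (md a b) <> T] (fun b => t_ A (md a b)).
Proof.
move=> AB out; set S := [set b | _].
have -> : (fun b => t_ A (md a b)) = (fun b => tau b (shifted (roots_in rs A) mu a)).
  by apply: funext => b; rewrite tfun_mkdisc.
have far_a z : z \in roots_in rs A -> true -> far wL c (z - a).
  rewrite (mem_roots_in rsE) // => /asboolP Az _; apply/negP => near.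
  have nf : ~~ far wL c (z - a) by rewrite negbK.
  have [v cv vz] := nfar_gt wLv nf.
  by apply: (out v cv z Az); rewrite (closed_disc_psi C_completion).
have [V [hV hc]] := prod_const_dominant wLv mu far_a.
rewrite -shiftedE in hV hc.
apply: (@pl_dominated _ _ _ wLv _ _ p_prime vpE vp_gt0 _ S (fun b => b - c) c V _ 0) => //.
- by exists 1.
- by move=> m _; rewrite subr0; case: m => //; rewrite dvdn0.
- move=> b m mn m0 bc; rewrite subr0; apply: ler_peMl; first exact: ltW.
  by rewrite ler1n lt0n.
- by rewrite mul0r subr0.
- by left.
- by move=> b [cb]; rewrite tfun_mkdisc // subr_gt0.
Qed.

Lemma min_value (s : seq L) a : (exists2 z, z \in s & z != a) ->
  exists d : R, (forall z, z \in s -> vge wL d (z - a)) /\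
    (exists2 z, z \in s & vis wL d (z - a)).
Proof.
elim: s => [[z]//|y s IH ex].
have [sa|ns] := pselect (exists2 z, z \in s & z != a); last first.
  have ya : y != a.
    by case: ex => z; rewrite inE => /predU1P[->//|zs za]; case: ns; exists z.
  have [v vE] : exists v, vis wL v (y - a) by apply: (vis_exists wLv); rewrite subr_eq0.
  exists v; split; last by exists y; rewrite ?mem_head.
  move=> z; rewrite inE => /predU1P[->|zs]; first exact: vis_vge.
  have [->|za] := eqVneq z a; first by rewrite subrr (vge0 wLv).
  by case: ns; exists z.
have [d [dall [z zs zd]]] := IH sa.
have [yd|yd] := boolP (vge wL d (y - a)).
  exists d; split; last by exists z; rewrite // inE zs orbT.
  by move=> x; rewrite inE => /predU1P[->//|]; exact: dall.
have [v vE] : exists v, vis wL v (y - a).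
  by apply: (vis_exists wLv); apply: contra yd => /eqP ->; exact: vge0 wLv _.
exists v; split; last by exists y; rewrite ?mem_head.
move=> x; rewrite inE => /predU1P[->|xs]; first exact: vis_vge.
by apply: vge_le (dall x xs); move: yd; rewrite (vis_vgeE _ vE); lra.
Qed.

(** The leading term dominates at the critical depth d, the minimum of v(z - a) over the roots in A,
    and its exponent is divisible by p because infinity is not in A. As s contains A, its depth is
    at most d. *)
Lemma pl_tfun_inside A (s : set (option L)) a : A `<=` B -> ~ A None ->
  (p %| mcard p f A)%N -> A `<=` s -> A (Some a) ->
  (exists2 z, A (Some z) & z <> a) ->
  pl_decreasing_int_slopes (fun m : int => m < 0)
    [set b | (b%:E < @cluster_depth R L C psi vC s)%E /\ t_ A (md a b) <> T]
    (fun b => t_ A (md a b)).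
Proof.
move=> AB AN pA As Aa [z0 Az0 z0a]; set S := [set b | _].
have -> : (fun b => t_ A (md a b)) = (fun b => tau b (shifted (roots_in rs A) mu a)).
  by apply: funext => b; rewrite tfun_mkdisc.
have rootsP z : z \in roots_in rs A <-> A (Some z).
  by rewrite (mem_roots_in rsE) //; split=> /asboolP.
have [d [dall [z1 z1A z1d]]] : exists d : R,
    (forall z, z \in roots_in rs A -> vge wL d (z - a)) /\
    (exists2 z, z \in roots_in rs A & vis wL d (z - a)).
  by apply: min_value; exists z0; [exact/rootsP|exact/eqP].
have depth_le b : (b%:E < @cluster_depth R L C psi vC s)%E -> b < d.
  move=> bs; rewrite -lte_fin; apply: (lt_le_trans bs).
  apply: ereal_inf_lbound; exists z1, a; split; [exact/As/rootsP|exact: As|].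
  by rewrite -[RHS]/(real_val R vC (psi (z1 - a))) (wC_psi R C_completion).
set hh := shifted _ _ _; pose n := (size hh).-1.
have nE : n = (\sum_(z <- roots_in rs A) mu z)%N.
  by rewrite /n /hh size_translate size_rootprod.
have pn : (p %| n)%N.
  by move: pA; rewrite (mcardE p rs_uniq rsE AB) asboolF // add0n nE /roots_in big_filter.
have hV : gge wL d (n%:R * d) hh.
  rewrite nE natr_sum mulr_suml /hh shiftedE.
  apply: (congW wLv (h := \prod_(z <- roots_in rs A) ('X - (z - a)%:P) ^+ mu z)).
  apply: (cong_prod wLv) => z zA _; apply: (cong_refl wLv); apply: (ggeX wLv).
  by apply: (ggeB wLv); [exact: (gge_polyX wLv d)|apply: (ggeC wLv); exact: dall].
have hn : hh`_n = 1.
  by apply/eqP; have := shifted_monic (roots_in rs A) mu a; rewrite monicE lead_coefE.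
apply: (@pl_dominated _ _ _ wLv _ _ p_prime vpE vp_gt0 _ S (fun b => d - b) d
  (n%:R * d) _ n) => //.
- by exists (-1).
- move=> m mn pm; rewrite subr_lt0 ltz_nat ltn_neqAle mn andbT.
  by apply/eqP => mE; rewrite mE pn in pm.
- move=> b m mn mne bd; have : m%:R + 1 <= n%:R :> R.
    by rewrite natr1 ler_nat ltn_neqAle mne.
  by nra.
- by rewrite subrr hn; exact: vis1 wLv.
- by right.
- by move=> b [/depth_le bd]; rewrite tfun_mkdisc // subr_gt0.
Qed.

End Parts.

(** * Open paths and distances *)

Section Pairs.

Variables (R : realType) (L : closedFieldType) (C : fieldType).
Variables (psi : {rmorphism L -> C}) (vL : L -> \bar rat) (vC : C -> \bar rat).
Hypothesis vL_val : is_valuation vL.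
Hypothesis C_completion : is_completion psi vL vC.
Hypothesis vL_surj : forall s : rat, exists x, vL x = s%:E.

Local Notation disc := (disc R vC).
Local Notation berk := (berk R vC).
Local Notation md a b := (mkdisc vC (psi a) (b : R)).
Local Notation eta := (@eta R L C psi vC).
Local Notation wLv := (wL_val R vL_val).
Local Notation wCv := (wC_val R C_completion).
Local Notation SigmaP := (SigmaP vL_val C_completion vL_surj).
Local Notation mkdisc_eqP := (mkdisc_eqP vL_val C_completion vL_surj).

Implicit Types (A : set (option L)) (a z : L) (b : R) (D E : disc).

Lemma not_below_deep (x : berk) z : x <> eta (Some z) ->
  exists b0, forall b, b0 <= b -> ~ leB x (TypeH (md z b)).
Proof.
case: x => [[y|]|D] nx.
- have yz : y - psi z != 0.
    by rewrite subr_eq0; apply/eqP => yE; apply: nx; rewrite /Defs.eta /= yE.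
  have [v vE] := vis_exists wCv yz; exists (v + 1) => b vb /leB_pointH /=.
  by rewrite closed_discE (vis_vgeE _ vE); lra.
- by exists 0 => b _ /leB_infty.
- exists (depth D + 1) => b Db /leBH /(disc_sub_depth C_completion vL_surj) /=; lra.
Qed.

(** From some depth on, the discs around z have no point below them other than those near z, so a
    path containing all of them ends at z. *)
Lemma open_path_endpoint (x y : berk) z b0 :
  (forall b, b0 <= b -> open_path x y (TypeH (md z b))) ->
  x = eta (Some z) \/ y = eta (Some z).
Proof.
move=> H; apply: contrapT => /not_orP[/not_below_deep[b1 H1] /not_below_deep[b2 H2]].
pose b := Num.max b0 (Num.max b1 b2).
have bb : b0 <= b by rewrite le_max lexx.
have [[J _ [_ [xb|yb]]] _] := H b bb.
  by apply: (H1 b) xb; rewrite !le_max lexx orbT.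
by apply: (H2 b) yb; rewrite !le_max lexx !orbT.
Qed.

Lemma Sigma_end A z w : A (Some z) -> A w -> w <> Some z ->
  exists b0, forall b, b0 <= b -> Sigma psi A (TypeH (md z b) : berk).
Proof.
move=> Az Aw wz; case: w Aw wz => [z'|] Aw wz; last first.
  by exists 0 => b _; apply/SigmaP; exists z, b; split=> //; exists None.
have zz : z - z' != 0 by rewrite subr_eq0; apply/eqP => zE; apply: wz; rewrite zE.
have [v vE] := vis_exists wLv zz; exists v => b vb.
apply/SigmaP; exists z, b; split=> //; exists (Some z') => //; split.
  by move=> zE; apply: wz; rewrite zE.
by rewrite vE lte_fin -leNgt.
Qed.

(** Each finite member of A is an end of the path, which leaves at most two. With infinity and two
    finite members, the path between the latter would miss the discs above their join, which are in
    the tree of A. *)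
Lemma Sigma_open_path_pair A (x y : berk) : (Sigma psi A : set berk) !=set0 ->
  Sigma psi A = open_path x y -> exists z w,
  [/\ A (Some z), A w, w <> Some z & forall u, A u -> u = Some z \/ u = w].
Proof.
move=> [x0 /SigmaP[z [b [Az _ [w Aw sep]]]]] Axy.
have wz : w <> Some z by move=> wE; move: sep; rewrite wE => -[].
exists z, w; split=> // u Au; apply: contrapT => /not_orP[uz uw].
have finite a w' : A (Some a) -> A w' -> w' <> Some a ->
    x = eta (Some a) \/ y = eta (Some a).
  move=> Aa Aw' w'a; have [b0 H] := Sigma_end Aa Aw' w'a.
  by apply: (@open_path_endpoint x y a b0) => b' /H; rewrite Axy.
have eta_inj a a' : eta (Some a) = eta (Some a') -> a = a'.
  by move=> [] /fmorph_inj.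
have infinite a a' : A None -> A (Some a) -> A (Some a') -> Some a <> Some a' -> False.
  move=> AN Aa Aa' aa.
  have aa' : a - a' != 0 by rewrite subr_eq0; apply/eqP => aE; apply: aa; rewrite aE.
  have [v vE] := vis_exists wLv aa'.
  have path : open_path (eta (Some a)) (eta (Some a')) (TypeH (md a (v - 1)) : berk).
    have : Sigma psi A (TypeH (md a (v - 1)) : berk).
      by apply/SigmaP; exists a, (v - 1); split=> //; exists None.
    have := finite a None Aa AN; have := finite a' None Aa' AN; rewrite Axy.
    move=> [//|xa'|ya'] [//|xa|ya].
    - by case: aa; move: xa'; rewrite xa => /eta_inj ->.
    - by rewrite xa' ya => /open_path_sym.
    - by rewrite xa ya'.
    - by case: aa; move: ya'; rewrite ya => /eta_inj ->.
  have := (open_path_points vL_val C_completion vL_surj _ vE).1 path.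
  by move=> [b' [vb [|]]] /TypeH_depth /= bE; move: vb;
    rewrite -bE lerBrDr gerDl ler10.
case: w Aw wz uw {sep} => [z'|] Aw wz uw; last first.
  by case: u Au uz uw => [z'|] Au uz uw //; apply: (infinite z z' Aw Az Au) => zE; apply: uz.
case: u Au uz uw => [z''|] Au uz uw; last first.
  by apply: (infinite z z' Au Az Aw) => zE; apply: wz.
have := finite z _ Az Aw wz.
have := finite z' _ Aw Az (fun e => wz (esym e)).
have := finite z'' _ Au Az (fun e => uz (esym e)).
have n1 : z'' <> z by move=> zE; apply: uz; rewrite zE.
have n2 : z'' <> z' by move=> zE; apply: uw; rewrite zE.
have n3 : z' <> z by move=> zE; apply: wz; rewrite zE.
by move=> [] h1 [] h2 [] h3; first
  [ by apply: n1; apply: eta_inj; rewrite -h1 -h3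
  | by apply: n2; apply: eta_inj; rewrite -h1 -h2
  | by apply: n3; apply: eta_inj; rewrite -h2 -h3 ].
Qed.

Lemma dist_attained D E (Lam : set berk) : Lam (TypeH E) ->
  (forall E', Lam (TypeH E') -> delta D E <= delta D E') ->
  dist_to D Lam = delta D E.
Proof.
move=> LE Emin; rewrite /dist_to; apply/eqP; rewrite eq_le; apply/andP; split.
  apply: ge_inf; last by exists E.
  by exists (delta D E) => _ [E' LE' <-]; exact: Emin.
apply: lb_le_inf; first by exists (delta D E), E.
by move=> _ [E' LE' <-]; exact: Emin.
Qed.

Lemma dist_self D (Lam : set berk) : Lam (TypeH D) -> dist_to D Lam = 0.
Proof.
move=> LD; rewrite (dist_attained LD); last first.
  by move=> E _; rewrite (delta_refl vL_val C_completion vL_surj)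
    (delta_ge0 vL_val C_completion vL_surj).
exact: (delta_refl vL_val C_completion vL_surj).
Qed.

End Pairs.

(** * Part (d) *)

Section Distance.

Variables (R : realType) (L : closedFieldType) (C : fieldType).
Variables (psi : {rmorphism L -> C}) (vL : L -> \bar rat) (vC : C -> \bar rat).
Hypothesis vL_val : is_valuation vL.
Hypothesis C_completion : is_completion psi vL vC.
Hypothesis vL_surj : forall s : rat, exists x, vL x = s%:E.
Variables (p : nat) (vq : rat).
Hypotheses (p_prime : prime p) (vqE : vL p%:R = vq%:E) (vq_gt0 : 0 < vq).
Variable f : {poly L}.
Hypothesis f_mult : forall z : L, root f z -> (1 <= mup z f <= p.-1)%N.

Local Notation wL := (real_val R vL).
Local Notation disc := (disc R vC).
Local Notation berk := (berk R vC).
Local Notation md a b := (mkdisc vC (psi a) (b : R)).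
Local Notation wLv := (wL_val R vL_val).
Local Notation vp := (ratr vq : R).
Local Notation T := (tlevel p vp).
Local Notation vpE := (val_prime R vqE).
Local Notation vp_gt0 := (val_prime_gt0 R vq_gt0).
Local Notation tau := (best_level wL p vp).
Local Notation B := (branch_set f).
Local Notation mu := (fun a => mup a f).
Local Notation SigmaP := (SigmaP vL_val C_completion vL_surj).
Local Notation mkdisc_eqP := (mkdisc_eqP vL_val C_completion vL_surj).
Local Notation deltaE := (deltaE vL_val C_completion vL_surj).

Variable rs : seq L.
Hypotheses (rs_uniq : uniq rs) (rsE : forall a, (a \in rs) = root f a).
Variable A : set (option L).
Hypotheses (AB : A `<=` B).

Local Notation t_ := (tfun p vL psi (f_ f (finite_part A)) : disc -> R).
Local Notation SA := (Sigma psi A : set berk).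

Implicit Types (a z : L) (b : R) (D E : disc).

Let mult_range z : A (Some z) -> (0 < mup z f < p)%N.
Proof.
move=> /AB /f_mult /andP[-> /=]; rewrite -ltnS prednK //; exact: prime_gt0.
Qed.

Lemma roots_in_perm (s : seq L) : uniq s -> (forall z, (z \in s) <-> A (Some z)) ->
  perm_eq (roots_in rs A) s.
Proof.
move=> s_uniq sA; apply: uniq_perm => //; first exact: roots_in_uniq.
move=> z; rewrite (mem_roots_in rsE z AB).
by apply/asboolP/idP => /sA.
Qed.

Lemma tau_roots_in (s : seq L) a b : uniq s -> (forall z, (z \in s) <-> A (Some z)) ->
  t_ (md a b) = tau b (\prod_(z <- s) ('X + (a - z)%:P) ^+ mu z).
Proof.
move=> s_uniq sA; rewrite (tfun_mkdisc vL_val C_completion vL_surj p_prime vqE vq_gt0 rs_uniq rsE) //.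
congr best_level; rewrite shiftedE (perm_big _ (roots_in_perm s_uniq sA)) /=.
by apply: eq_bigr => z _; rewrite -polyCN opprB.
Qed.

Lemma vis_of_not_vge b x : ~ vge wL b x -> exists2 v, vis wL v x & v < b.
Proof.
move=> nb; have x0 : x != 0 by apply/eqP => x0; apply: nb; rewrite x0 (vge0 wLv).
have [v vE] := vis_exists wLv x0; exists v => //.
by move/negP: nb; rewrite (vis_vgeE _ vE) -ltNge.
Qed.

(** The tree consists of all discs around z; the nearest one is the join, at depth v(a - z). *)
Lemma tfun_one_root z a b : A None -> A (Some z) ->
  (forall u, A u -> u = Some z \/ u = None) -> ~ SA (TypeH (md a b)) ->
  t_ (md a b) = Num.min (dist_to (md a b) SA) T.
Proof.
move=> AN Az Aonly nS.
have SAz s : SA (TypeH (md z s)) by apply/SigmaP; exists z, s; split=> //; exists None.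
have [be beE beb] : exists2 be, vis wL be (a - z) & be < b.
  apply: vis_of_not_vge => az; apply: nS.
  by have -> : md a b = md z b by apply/mkdisc_eqP.
have sA u : (u \in [:: z]) <-> A (Some u).
  rewrite inE; split=> [/eqP -> //|/Aonly[[->]|//]]; exact: eqxx.
rewrite (tau_roots_in _ _ _ sA) // big_seq1.
rewrite (tau_one_root wLv p_prime vpE vp_gt0 (mult_range Az) beE beb); congr Num.min.
have dE : delta (md a b) (md z be) = b - be.
  rewrite (deltaE (ltW beb) (lexx be) (vis_vge beE)) => [|d _ dbe _ //].
  by rewrite subrr addr0.
rewrite (dist_attained (SAz be)) ?dE // => E /SigmaP[z' [s [/Aonly[[->]|//] EE _]]].
rewrite (TypeH_inj EE).
have [c [c1 c2 ca cm]] := join_depth_exists vL_val a z b s.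
rewrite (deltaE c1 c2 ca cm); move: ca; rewrite (vis_vgeE _ beE); lra.
Qed.

Section TwoRoots.

Variables (z z' : L) (be : R).
Hypotheses (Az : A (Some z)) (Az' : A (Some z')) (zz' : vis wL be (z - z')).
Hypothesis Aonly : forall u, A u -> u = Some z \/ u = Some z'.
Hypothesis pA : (p %| mcard p f A)%N.

Let z_neq : z != z'.
Proof. by rewrite -subr_eq0; exact: (vis_neq0 wLv zz'). Qed.

Let sA u : (u \in [:: z; z']) <-> A (Some u).
Proof.
rewrite !inE; split=> [/orP[]/eqP -> //|/Aonly[][->]]; first by rewrite eqxx.
by rewrite eqxx orbT.
Qed.

Let s_uniq : uniq [:: z; z'].
Proof. by rewrite /= inE z_neq. Qed.

(** The sum is divisible by p and lies strictly between 0 and 2 p. *)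
Let mult_sum : (mup z f + mup z' f = p)%N.
Proof.
have nAN : ~ A None by move=> /Aonly[].
move: pA; rewrite (mcardE p rs_uniq rsE AB) asboolF // add0n -big_filter.
rewrite (perm_big _ (roots_in_perm s_uniq sA)) /= big_cons big_seq1 => /dvdnP[k kE].
have /andP[m0 mp] := mult_range Az; have /andP[m'0 m'p] := mult_range Az'.
have p0 := prime_gt0 p_prime.
have : (0 < k * p < 2 * p)%N by rewrite -kE mul2n -addnn addn_gt0 m0 /= -addnS leq_add // ltnW.
rewrite kE; case: k {kE} => [|[|k]]; rewrite ?mul0n ?mul1n //.
by rewrite ltn_pmul2r // andbC.
Qed.

Let SA_root u s : A (Some u) -> be <= s -> SA (TypeH (md u s)).
Proof.
move=> Au bes; apply/SigmaP; exists u, s; split=> //.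
have far_zz : ~~ (s%:E < wL (z - z')%R)%E by rewrite zz' lte_fin -leNgt.
have [[->]|[->]] := Aonly Au.
  by exists (Some z') => //; split=> // zE; move: z_neq; rewrite zE eqxx.
exists (Some z) => //; split; first by move=> zE; move: z_neq; rewrite zE eqxx.
by rewrite -opprB (valN wLv).
Qed.

Let SA_inv E : SA (TypeH E) -> exists u s,
  [/\ E = md u s, be <= s & u = z \/ u = z'].
Proof.
move=> /SigmaP[u [s [Au /TypeH_inj -> [w Aw sep]]]]; exists u, s; split=> //.
  have [[uE]|[uE]] := Aonly Au; have [wE|wE] := Aonly Aw; move: sep; rewrite uE wE /=.
  - by case.
  - by case=> _; rewrite zz' lte_fin -leNgt.
  - by case=> _; rewrite -opprB (valN wLv) zz' lte_fin -leNgt.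
  - by case.
by case: (Aonly Au) => -[]; [left|right].
Qed.

Lemma tfun_two_roots_inside b : ~ SA (TypeH (md z b)) ->
  t_ (md z b) = Num.min (dist_to (md z b) SA) T.
Proof.
move=> nS; have bbe : b < be by rewrite ltNge; apply/negP => bes; apply/nS/SA_root.
rewrite (tau_roots_in _ _ s_uniq sA) big_cons big_seq1 subrr polyC0 addr0.
have /andP[m0 _] := mult_range Az; have /andP[m'0 _] := mult_range Az'.
rewrite (tau_two_roots_inside wLv p_prime vpE vp_gt0 m'0 mult_sum m0 zz' bbe).
congr Num.min.
have dE : delta (md z b) (md z be) = be - b.
  by rewrite (delta_same vL_val C_completion vL_surj) ltr0_norm; lra.
rewrite (dist_attained (SA_root Az (lexx be))) ?dE // => E /SA_inv[u [s [-> bes _]]].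
have [c [c1 c2 ca cm]] := join_depth_exists vL_val z u b s.
rewrite (deltaE c1 c2 ca cm); lra.
Qed.

Lemma tfun_two_roots_outside a b vA vB :
  vis wL vA (a - z) -> vis wL vB (a - z') -> vA < b -> vB < b -> vB <= vA ->
  t_ (md a b) = Num.min (dist_to (md a b) SA) T.
Proof.
move=> AE BE Ab Bb BA.
rewrite (tau_roots_in _ _ s_uniq sA) big_cons big_seq1.
have /andP[m0 _] := mult_range Az; have /andP[m'0 _] := mult_range Az'.
have ABbe : vis wL be ((a - z) - (a - z')).
  by have := visN wLv zz'; congr vis; ring.
rewrite (tau_two_roots_outside wLv p_prime vpE vp_gt0 m'0 mult_sum m0 AE BE ABbe Ab Bb BA).
congr Num.min.
(* Either the disc branches off at or above the join of z and z', or on the way from the join down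
   to z. The nearest point of the tree is the join in the first case and the branching point in the
   second, at depth [s0] either way. *)
have tri : (vA <= be /\ vA = vB) \/ (be < vA /\ vB = be).
  have [Abe|beA] := leP vA be; [left|right]; split=> //.
    apply/le_anti; rewrite BA andbT -(vis_vgeE _ BE).
    have -> : a - z' = (a - z) - ((a - z) - (a - z')) by ring.
    by apply: (vgeB wLv (vis_vge AE)); rewrite (vis_vgeE _ ABbe).
  have : vis wL be (a - z').
    have -> : a - z' = - ((a - z) - (a - z')) + (a - z) by ring.
    exact: (vis_dom wLv (visN wLv ABbe) (vis_vge AE)).
  by move/(vis_inj BE).
pose s0 := Num.max be vA.
have s0be : be <= s0 by rewrite le_max lexx.
have s0A : vA <= s0 by rewrite le_max lexx orbT.
have s0E : s0 - vA = be - vB.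
  rewrite /s0; case: tri => -[h1 h2].
    by rewrite max_l // h2.
  by rewrite max_r ?h2 ?subrr // ltW.
have dE : delta (md a b) (md z s0) = be - vB + (b - vA).
  rewrite (deltaE (ltW Ab) s0A (vis_vge AE)) ?s0E; first by rewrite addrC.
  by move=> d _ _; rewrite (vis_vgeE _ AE).
rewrite (dist_attained (SA_root Az s0be)) ?dE // => E /SA_inv[u [s [-> bes uE]]].
have [c [c1 c2 ca cm]] := join_depth_exists vL_val a u b s.
rewrite (deltaE c1 c2 ca cm); case: uE ca => ->.
  by rewrite (vis_vgeE _ AE); case: tri => -[h1 h2]; lra.
by rewrite (vis_vgeE _ BE); lra.
Qed.

End TwoRoots.

Lemma tfun_pair D (x y : berk) : SA !=set0 -> SA = open_path x y ->
  (p %| mcard p f A)%N -> (t_ D = 0 <-> SA (TypeH D)) ->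
  t_ D = Num.min (dist_to D SA) T.
Proof.
move=> SA0 SAxy pA t0.
have [DS|nS] := pselect (SA (TypeH D)).
  rewrite (dist_self vL_val C_completion vL_surj DS) t0.2 // min_l //.
  by apply: ltW; exact: (tlevel_gt0 p_prime vp_gt0).
have [z [w [Az Aw wz Aonly]]] :=
  Sigma_open_path_pair vL_val C_completion vL_surj SA0 SAxy.
have [a DE] := disc_center_exists C_completion vL_surj D.
case: w Aw wz Aonly => [z'|] Aw wz Aonly; last first.
  by rewrite DE in nS *; exact: (tfun_one_root Aw Az).
have zz0 : z - z' != 0 by rewrite subr_eq0; apply/eqP => zE; apply: wz; rewrite zE.
have [be beE] := vis_exists wLv zz0.
have beE' : vis wL be (z' - z) by have := visN wLv beE; rewrite opprB.
have Aonly' u : A u -> u = Some z' \/ u = Some z by move=> /Aonly[]; [right|left].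
have recenter u : vge wL (depth D) (a - u) -> D = md u (depth D).
  by move=> au; rewrite {1}DE; apply/mkdisc_eqP.
(* A disc off the tree that contains one root contains both and can be centred at it; otherwise the
   roots are ordered by closeness to a. *)
have [Dz|/vis_of_not_vge[vA AE Ab]] := pselect (vge wL (depth D) (a - z)).
  rewrite (recenter z Dz) in nS *.
  exact: (tfun_two_roots_inside Az Aw beE Aonly pA).
have [Dz'|/vis_of_not_vge[vB BE Bb]] := pselect (vge wL (depth D) (a - z')).
  rewrite (recenter z' Dz') in nS *.
  exact: (tfun_two_roots_inside Aw Az beE' Aonly' pA).
rewrite DE; have [BA|AB'] := leP vB vA.
  exact: (tfun_two_roots_outside Az Aw beE Aonly pA AE BE).
exact: (tfun_two_roots_outside Aw Az beE' Aonly' pA BE AE Bb Ab (ltW AB')).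
Qed.

End Distance.

(** * Conclusion *)

(** With s = e n / d, take a d-th root of the n-th power of an element of value e. *)
Lemma valuation_surjective (R : realType) (K : fieldType) (v : K -> \bar rat)
    (L : closedFieldType) (iota : {rmorphism K -> L}) (vL : L -> \bar rat) :
  discrete_valuation v -> is_valuation vL -> (forall x, vL (iota x) = v x) ->
  forall s : rat, exists x, vL x = s%:E.
Proof.
move=> [_ [e e0 [[x0 x0E] _]]] vL_val ext s.
have wLv := real_val_valuation R vL_val.
have d0 : (0 < `|denq (s / e)|)%N by rewrite absz_gt0 denq_neq0.
have sE : s = e * (numq (s / e))%:~R / (denq (s / e))%:~R.
  by rewrite -mulrA divq_num_den mulrC divfK // gt_eqF.
have dE : denq (s / e) = `|denq (s / e)|%N :> int by rewrite gez0_abs // ltW // denq_gt0.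
move: d0 sE dE; set d := `|_|%N; set n := numq _ => d0 sE dE.
have x0v : vis (real_val R vL) (ratr e) (iota x0).
  by apply: vis_real_val; rewrite ext.
have [u uv] : exists u, vis (real_val R vL) (n%:~R * ratr e) u.
  case: (n) => m; first by exists (iota x0 ^+ m); have := visX wLv m x0v.
  exists ((iota x0 ^+ m.+1)^-1); have := visV wLv (visX wLv m.+1 x0v).
  by congr vis; rewrite NegzE mulrNz mulNr.
have [y yE] := root_exists u d0.
have y0 : y != 0.
  by apply/eqP => y0; have := vis_neq0 wLv uv; rewrite -yE y0 expr0n gtn_eqF // eqxx.
have [q qE] : exists q : rat, vL y = q%:E.
  have := val_neqNy vL_val y; have := (val_eqy vL_val y).1.
  case: (vL y) => [q _ _|H _|//]; first by exists q.
  by move: y0; rewrite H ?eqxx.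
exists y; rewrite qE; congr EFin.
have := visX wLv d (vis_real_val R qE); rewrite yE => /(vis_inj uv) H.
have {}H : n%:~R * e = d%:R * q.
  apply: (@fmorph_inj _ R ratr); rewrite !rmorphM /= ratr_int ratr_nat; exact: H.
rewrite sE mulrC [e * _]mulrC H dE -pmulrn mulrA mulVf ?mul1r //.
by rewrite pnatr_eq0 -lt0n.
Qed.

(** The value of p is positive because p vanishes in the residue field, and finite because p is
    nonzero in K. *)
Lemma residue_char_value (R : realType) (K k : fieldType) (v : K -> \bar rat)
    (red : K -> k) p : is_valuation v -> is_residue_map v red ->
  p \in [pchar k] -> p \notin [pchar K] ->
  exists2 q : rat, v p%:R = q%:E & 0 < q.
Proof.
move=> v_val redP pk pK; have wv := real_val_valuation R v_val.
have vn n : (0 <= v n%:R)%E.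
  by rewrite -(er_map_ratr_le R) /= rmorph0; exact: vge_nat wv n.
have redn n : red n%:R = n%:R.
  elim: n => [|n IH].
    by apply/(red_eq0 redP); rewrite ?(vn 0%N) // (val_eqy v_val 0).2.
  by rewrite -natr1 -[n.+1%:R]natr1 (redD redP) ?(red1 redP) ?IH // -[1]/(1%:R) vn.
have /andP[p_prime /eqP p0] := pk.
have pv : (0 < v p%:R)%E by apply/(red_eq0 redP) => //; rewrite redn p0.
have : p%:R != 0 :> K by apply: contra pK => pK0; rewrite inE p_prime.
case vE : (v p%:R) pv => [q| |//] pv pK0; first by exists q.
by move: pK0; rewrite ((val_eqy v_val _).1 vE) eqxx.
Qed.

Theorem theorem5p9 (R : realType) (p : nat)
  (K : fieldType) (v : K -> \bar rat)
  (k : closedFieldType) (red : K -> k)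
  (L : closedFieldType) (iota : {rmorphism K -> L}) (vL : L -> \bar rat)
  (C : fieldType) (psi : {rmorphism L -> C}) (vC : C -> \bar rat)
  (p_prime : prime p)
  (v_discrete : discrete_valuation v)
  (v_complete : val_complete v)
  (red_residue : is_residue_map v red)
  (k_char : p \in [pchar k])
  (K_char : p \notin [pchar K])
  (L_closure : is_algebraic_closure iota)
  (vL_val : is_valuation vL)
  (vL_ext : forall x : K, vL (iota x) = v x)
  (C_completion : is_completion psi vL vC)
  (f : {poly K}) (fL : {poly L})
  (fL_def : fL = map_poly iota f)
  (f_monic : f \is monic)
  (f_mult : forall z : L, root fL z -> (1 <= mup z fL <= p.-1)%N)
  (f_deg : ~~ (p %| (size f).-1)%N)
  (f_genus : superelliptic_positive_genus p fL)
  (h : nat) (r : 'I_h.+1 -> set (option L))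
  (r_partition : @component_partition R p L C psi vC fL h r)
  (r_infty : r ord0 None)
  (i : 'I_h.+1) :
  let t : disc R vC -> R := tfun p vL psi (f_ fL (finite_part (r i))) in
  let T : R := ratr (tmax p vL) in
  [/\ forall D : disc R vC, t D = 0 <-> Sigma psi (r i) (TypeH D),
      i != ord0 ->
        forall s : set (option L),
          @smallest_cluster R L C psi vC fL (r i) s ->
        forall a : L, r i (Some a) ->
        let F := fun b : R => t (mkdisc vC (psi a) b) in
        pl_decreasing_int_slopes (fun m : int => m < 0)
          [set b | (b%:E < @cluster_depth R L C psi vC s)%E /\ F b <> T] F,
      forall a : L, ~ r i (Some a) ->
        forall c : R,
          (forall b : R, c < b -> forall z : L, r i (Some z) ->
             ~ closed_disc vC (psi a) b (psi z)) ->
        let F := fun b : R => t (mkdisc vC (psi a) b) in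
        pl_decreasing_int_slopes (fun m : int => 0 < m)
          [set b | c < b /\ F b <> T] F
    & @clustered_in_pairs R p L C psi vC fL ->
        forall D : disc R vC,
          t D = Num.min (dist_to D (Sigma psi (r i))) T].
Proof.
move=> t T.
have vL_surj := valuation_surjective R v_discrete vL_val vL_ext.
have [v_val _] := v_discrete.
have [q vq q0] := residue_char_value R v_val red_residue k_char K_char.
have vLq : vL p%:R = q%:E by rewrite -(rmorph_nat iota) vL_ext.
have TE : T = tlevel p (ratr q) by exact: tmaxE.
have fL0 : fL != 0 by rewrite fL_def map_poly_eq0 monic_neq0.
have [rs [rs_uniq rsE]] := roots_exist fL0.
have riB : r i `<=` branch_set fL by exact: (r_sub r_partition).
have pri : (p %| mcard p fL (r i))%N by case: r_partition.
have tr_eq0 D : t D = 0 <-> Sigma psi (r i) (TypeH D).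
  exact: (tfun_eq0 vL_val C_completion vL_surj p_prime vLq q0 rs_uniq rsE).
have comp_i := Sigma_component r_partition i.
have Sigma_ne : (Sigma psi (r i) : set (berk R vC)) !=set0.
  by have [x Sx ->] := comp_i; exists x; exact: connected_component_refl.
split=> //.
- move=> i0 s [_ ris _] a ra F.
  have nN : ~ r i None.
    move=> riN; case/eqP: i0; case: r_partition => _ triv _ _.
    by apply: triv => //; exists None.
  rewrite TE; apply: (pl_tfun_inside R vL_val C_completion vL_surj p_prime vLq q0
    rs_uniq rsE riB nN pri ris ra).
  (* A nonempty tree has two distinct ends in [r i], both finite here, so one of them differs from
     a. *)
  have [x /(SigmaP vL_val C_completion vL_surj)[z [b [rz _ [w rw sep]]]]] := Sigma_ne.
  case: w rw sep => [z'|//] rz' [zz' _].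
  have [za|za] := eqVneq z a; last by exists z => //; exact/eqP.
  by exists z' => // z'a; apply: zz'; rewrite za.
- move=> a _ c out F; rewrite TE.
  exact: (pl_tfun_outside vL_val C_completion vL_surj p_prime vLq q0 rs_uniq rsE riB out).
- move=> [_ paths] D; have [x [y [_ Exy]]] := paths _ comp_i; rewrite TE.
  exact: (tfun_pair vL_val C_completion vL_surj p_prime vLq q0 f_mult rs_uniq rsE
    riB Sigma_ne Exy pri (tr_eq0 D)).
Qed.
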